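(* Let $d \in (0,1)$ with $d > \frac13$ and let $n\ge 1$ be a fixed integer. For each $l\ge 1$ let $\Gamma$ be a random group in the Gromov density model with $n$ generators, relators of length $l$ and density $d$. Then $\Gamma$ has property (T) with overwhelming probability, i.e. $$\lim_{l\to\infty} \mathbb{P}\big(\Gamma \text{ has property (T)}\big) = 1 .$$
   Context: Property (T) is Kazhdan's property (T) for discrete, finitely generated groups. Let $S=\{s_1,\dots,s_n\}$ be a set of $n$ generators. A word $r=x_1x_2\cdots x_l$ with letters $x_i\in S\cup S^{-1}$ is cyclically reduced if $x_i\neq x_{i+1}^{-1}$ for $1\le i\le l$, where $x_{l+1}$ is identified with $x_1$. A random group in the Gromov density model with parameters $n,l,d$ is $\Gamma=\langle S\mid R\rangle$, where $R$ consists of $\lfloor (2n-1)^{ld}\rfloor$ relators chosen uniformly and independently (repetitions allowed) from the set of all cyclically reduced words of length $l$ over $S\cup S^{-1}$. *)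

(* Defs.v *)
From HB Require Import structures.
From mathcomp Require Import all_boot all_order all_algebra complex.
From mathcomp Require Import sesquilinear generic_quotient.
From mathcomp Require Import all_classical all_reals all_analysis.

Set Implicit Arguments.
Unset Strict Implicit.
Unset Printing Implicit Defensive.

Import Order.TTheory GRing.Theory Num.Theory.
Import numFieldNormedType.Exports.
Import ComplexField.

Local Open Scope classical_set_scope.
Local Open Scope ring_scope.
Local Open Scope complex_scope.

(* (i, false) stands for the generator s_i and (i, true) for its inverse. *)
Notation letter n := ('I_n * bool)%type.
Notation word n := (seq (letter n)).

Section Words.
Variable n : nat.
Implicit Types (x y : letter n) (w : word n).

Definition linv x : letter n := (x.1, ~~ x.2).

Definition winv w : word n := rev (map linv w).

Lemma linvK : involutive linv.
Proof. by case=> i b; rewrite /linv /= negbK. Qed.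

Lemma winvK : involutive winv.
Proof. by move=> w; rewrite /winv map_rev revK mapK //; apply: linvK. Qed.

(* The wrap-around is included: the last letter must not be inverse to the
   first one. *)
Definition cyclically_reduced w : bool := cycle (fun x y => x != linv y) w.

Definition cr_word (l : nat) : finType :=
  {w : l.-tuple (letter n) | cyclically_reduced w}.

End Words.

Section Presentation.
Local Open Scope quotient_scope.
Variables (n : nat) (rels : seq (word n)).

(* The congruence on the free monoid over S and S^-1 whose quotient is
   <S | rels>. *)
Inductive pres_eq : word n -> word n -> Prop :=
| pres_refl u : pres_eq u u
| pres_sym u v : pres_eq u v -> pres_eq v u
| pres_trans u v w : pres_eq u v -> pres_eq v w -> pres_eq u w
| pres_cat u u' v v' :
    pres_eq u u' -> pres_eq v v' -> pres_eq (u ++ v) (u' ++ v')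
| pres_cancel x : pres_eq [:: x; linv x] [::]
| pres_rel r : r \in rels -> pres_eq r [::].

Definition pres_eqb (u v : word n) : bool := `[< pres_eq u v >].

Lemma pres_eqbP u v : reflect (pres_eq u v) (pres_eqb u v).
Proof. exact: asboolP. Qed.

Fact pres_eqb_refl : reflexive pres_eqb.
Proof. by move=> u; apply/pres_eqbP; apply: pres_refl. Qed.

Fact pres_eqb_sym : symmetric pres_eqb.
Proof. by move=> u v; apply/pres_eqbP/pres_eqbP; apply: pres_sym. Qed.

Fact pres_eqb_trans : transitive pres_eqb.
Proof.
by move=> v u w /pres_eqbP uv /pres_eqbP vw; apply/pres_eqbP/(pres_trans uv vw).
Qed.

Canonical pres_eq_equiv :=
  EquivRel pres_eqb pres_eqb_refl pres_eqb_sym pres_eqb_trans.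

Definition presented : Type := {eq_quot pres_eq_equiv}.
HB.instance Definition _ := Choice.on presented.
HB.instance Definition _ := EqQuotient.on presented.

Definition pres_class (w : word n) : presented := \pi_presented w.

Definition pres_one : presented := pres_class [::].
Definition pres_mul (a b : presented) : presented :=
  pres_class (repr a ++ repr b).
Definition pres_inv (a : presented) : presented := pres_class (winv (repr a)).

Lemma pres_classP u v : pres_class u = pres_class v <-> pres_eq u v.
Proof. by split=> [/eqmodP/pres_eqbP|/pres_eqbP uv] //; apply/eqmodP. Qed.

Lemma pres_repr u : pres_eq (repr (pres_class u)) u.
Proof. by apply/pres_classP; rewrite /pres_class reprK. Qed.

Lemma pres_mulE u v : pres_mul (pres_class u) (pres_class v) = pres_class (u ++ v).
Proof. by apply/pres_classP; apply: pres_cat; apply: pres_repr. Qed.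

Lemma pres_catV w : pres_eq (w ++ winv w) [::].
Proof.
elim: w => [|x w IHw]; first exact: pres_refl.
have -> : (x :: w) ++ winv (x :: w) = [:: x] ++ (w ++ winv w) ++ [:: linv x].
  by rewrite /winv /= rev_cons -cats1 catA.
apply: pres_trans (pres_cancel x).
rewrite -[[:: x; linv x]]/([:: x] ++ [::] ++ [:: linv x]).
apply: pres_cat; first exact: pres_refl.
by apply: pres_cat; [exact: IHw | exact: pres_refl].
Qed.

Lemma pres_catVw w : pres_eq (winv w ++ w) [::].
Proof. by rewrite -{2}[w]winvK; apply: pres_catV. Qed.

Fact pres_mulA : associative pres_mul.
Proof.
move=> a b c; rewrite -[a]reprK -[b]reprK -[c]reprK -!/(pres_class _).
by rewrite !pres_mulE catA.
Qed.

Fact pres_mul1 : left_id pres_one pres_mul.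
Proof. by move=> a; rewrite -[a]reprK -/(pres_class _) pres_mulE. Qed.

Fact pres_mulr1 : right_id pres_one pres_mul.
Proof. by move=> a; rewrite -[a]reprK -/(pres_class _) pres_mulE cats0. Qed.

Fact pres_mulV : left_inverse pres_one pres_inv pres_mul.
Proof.
move=> a; rewrite -{2}[a]reprK -/(pres_class _) pres_mulE.
by apply/pres_classP; apply: pres_catVw.
Qed.

Fact pres_mulrV : right_inverse pres_one pres_inv pres_mul.
Proof.
move=> a; rewrite -{1}[a]reprK -/(pres_class _) pres_mulE.
by apply/pres_classP; apply: pres_catV.
Qed.

HB.instance Definition _ := isGroup.Build presented
  pres_mulA pres_mul1 pres_mulr1 pres_mulV pres_mulrV.

End Presentation.

Section PropertyT.
Variables (R : realType) (G : groupType).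

(* A complex Hilbert space is a complete normed space over R[i] whose norm
   comes from an inner product (antilinear in the second argument). *)
Definition hilbert_product (H : completeNormedModType R[i])
    (ip : {dot H for Num.conj}) : Prop :=
  forall v : H, ip v v = `|v| ^+ 2.

Definition unitary_rep (H : completeNormedModType R[i])
    (ip : {dot H for Num.conj}) (pi : G -> {linear H -> H}) : Prop :=
  [/\ forall v, pi 1%g v = v,
      forall g h v, pi (g * h)%g v = pi g (pi h v) &
      forall g u v, ip (pi g u) (pi g v) = ip u v].

(* Existence of a Kazhdan pair (K, eps); since G carries the discrete topology,
   compact subsets are finite and every representation is continuous. *)
Definition property_T : Prop :=
  exists (K : seq G) (eps : R), 0 < eps /\
    forall (H : completeNormedModType R[i]) (ip : {dot H for Num.conj})
           (pi : G -> {linear H -> H}),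
      hilbert_product ip -> unitary_rep ip pi ->
      (exists v : H, v != 0 /\
         forall g, g \in K -> `|pi g v - v| < eps%:C * `|v|) ->
      exists v : H, v != 0 /\ forall g, pi g v = v.

End PropertyT.

Section Gromov.
Variables (R : realType) (n l : nat) (d : R).

Definition num_relators : nat :=
  Num.truncn ((2 * n - 1)%N%:R `^ (l%:R * d) : R).

Definition relators : finType := num_relators.-tuple (cr_word n l).

Definition gromov_group (t : relators) : groupType :=
  presented [seq tval (val w) | w <- t].

(* Independent uniform relators: the uniform measure on the set of tuples. *)
Definition gromov_prob (P : groupType -> Prop) : R :=
  #|[set t : relators | `[< P (gromov_group t) >]]%SET|%:R / #|{: relators}|%:R.

End Gromov.

(* Main.v *)
(** Zuk's criterion, in a form adapted to relators of arbitrary length. Cut a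
    relator of length [l] into three words [u v w] of almost equal length. For a
    unitary representation [pi] and a vector [x] put [f w = pi w x - x]. As
    [u v w = 1], the pairs [(u^-1, v)], [(v^-1, w)], [(w^-1, u)] satisfy
    [|f u^-1 - f v| = |f w|] and cyclically, so the average of [|f|^2] over the
    relators is the quadratic form at [f] of the random graph (the link) having
    these pairs as edges. If the link were the mean graph, a complete multipartite
    graph whose nontrivial eigenvalues have modulus at most [1/(2n-1) <= 1/3], this
    would give [Delta^2 >= c Delta] for the Laplacian [Delta] of the uniform measure
    on reduced words, hence Kazhdan's property.

    It remains to compare the link with its mean. There are about
    [(2n-1)^(ld)] edges on about [(2n-1)^(l/3)] vertices, so degrees are polynomially
    large in the number of vertices and Chernoff's bound controls them. For the
    operator norm, split the relators into a large constant number [J] of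
    independent batches with centered adjacency operators [X_j]. The [p]-th power of
    the average of the [X_j] is the average of the products over words in
    ['I_J^p]: words with a repetition are rare (a proportion [p^2/J]) and are bounded
    by the degree bound, while for words without repetition independence makes the
    expected squared Frobenius norm multiplicative. All this is for [n >= 2]; for
    [n = 1] the group is finite cyclic. *)

Require Import Defs.
From HB Require Import structures.
From mathcomp Require Import all_boot all_order all_algebra complex.
From mathcomp Require Import sesquilinear.
From mathcomp Require Import ring lra zify.
From mathcomp Require Import all_classical all_reals all_analysis.

Set Implicit Arguments.
Unset Strict Implicit.
Unset Printing Implicit Defensive.

Import Order.TTheory GRing.Theory Num.Theory.
Import numFieldNormedType.Exports.
Import ComplexField.

Local Open Scope classical_set_scope.
Local Open Scope complex_scope.
Local Open Scope ring_scope.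

(** * Positive semidefinite forms *)

(** The threshold 1/3 enters through one ratio. Put Q = 2n-1. The link has O(Q^(l/3)) vertices, a
    batch has a fixed proportion of the Q^(ld) relators, and the failure probability is at most a
    constant times [Lm * (Lm / N) ^ K0], where [Lm / N] is O(Q^(-(d-1/3)l)). So a fixed moment
    [K0 = 2^k] beats the number of vertices. The three lengths differ by at most one, so degree
    bound and target norm stay in a fixed ratio and the number of batches does not depend on [l]. No
    eigenvalue is ever computed. Every spectral statement is an inequality between real positive
    semidefinite forms, obtained from Cauchy-Schwarz and valid for functions with values in an
    arbitrary form space. Hence the random event concerns scalar kernels only and serves all unitary
    representations at once; complex Hilbert spaces come in at the end, through the real part of
    their inner product. The passage from the gap to a fixed vector avoids the spectral theorem too:
    gradient descent for the energy contracts geometrically, and completeness is used once, for its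
    limit. *)

Record psd_form (R : realFieldType) (E : lmodType R) (B : E -> E -> R) : Prop :=
  PsdForm {
    psdC : forall x y, B x y = B y x;
    psdDl : forall x y z, B (x + y) z = B x z + B y z;
    psdZl : forall a x y, B (a *: x) y = a * B x y;
    psd_ge0 : forall x, 0 <= B x x }.

Section PsdForm.
Variables (R : realFieldType) (E : lmodType R) (B : E -> E -> R).
Hypothesis HB : psd_form B.

Lemma psdDr x y z : B z (x + y) = B z x + B z y.
Proof. by rewrite !(psdC HB z) (psdDl HB). Qed.

Lemma psdZr a x y : B x (a *: y) = a * B x y.
Proof. by rewrite !(psdC HB x) (psdZl HB). Qed.

Lemma psd0l y : B 0 y = 0.
Proof. by rewrite -(scale0r (0 : E)) (psdZl HB) mul0r. Qed.

Lemma psdNl x y : B (- x) y = - B x y.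
Proof. by rewrite -scaleN1r (psdZl HB) mulN1r. Qed.

Lemma psdNr x y : B x (- y) = - B x y.
Proof. by rewrite !(psdC HB x) psdNl. Qed.

Lemma psd_suml (I : Type) (r : seq I) (P : pred I) (F : I -> E) y :
  B (\sum_(i <- r | P i) F i) y = \sum_(i <- r | P i) B (F i) y.
Proof.
by elim/big_rec2: _ => [|i u v _ <-]; rewrite ?psd0l ?(psdDl HB).
Qed.

Lemma psd_sumr (I : Type) (r : seq I) (P : pred I) (F : I -> E) y :
  B y (\sum_(i <- r | P i) F i) = \sum_(i <- r | P i) B y (F i).
Proof. by rewrite (psdC HB) psd_suml; apply: eq_bigr => i _; rewrite (psdC HB). Qed.

Lemma psd_sqD x y : B (x + y) (x + y) = B x x + 2 * B x y + B y y.
Proof. by rewrite psdDr !(psdDl HB) (psdC HB y x); ring. Qed.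

Lemma psd_sqB x y : B (x - y) (x - y) = B x x - 2 * B x y + B y y.
Proof. by rewrite psd_sqD !(psdNr, psdNl); ring. Qed.

Lemma psd_sqZ a x : B (a *: x) (a *: x) = a ^+ 2 * B x x.
Proof. by rewrite (psdZl HB) psdZr; ring. Qed.

Lemma psd_amgm x y : 2 * `|B x y| <= B x x + B y y.
Proof.
have h1 := psd_ge0 HB (x + y); have h2 := psd_ge0 HB (x - y).
rewrite psd_sqD in h1; rewrite psd_sqB in h2.
by case: (ler0P (B x y)) => _; lra.
Qed.

Lemma psd_CS x y : B x y ^+ 2 <= B x x * B y y.
Proof.
have [y0|yn0] := eqVneq (B y y) 0.
  suff -> : B x y = 0 by rewrite expr0n /= y0 mulr0.
  have [//|xyn0] := eqVneq (B x y) 0.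
  (* If [B y y = 0], the square of [x - a *: y] is affine in [a]; this [a] makes it equal to -1. *)
  have := psd_ge0 HB (x - ((B x x + 1) / (2 * B x y)) *: y).
  rewrite psd_sqB psd_sqZ psdZr y0 mulr0 addr0.
  have -> : B x x - 2 * ((B x x + 1) / (2 * B x y) * B x y) = - 1 by field.
  by rewrite oppr_ge0 => /le_lt_trans/(_ ltr01); rewrite ltxx.
have yp : 0 < B y y by rewrite lt_neqAle eq_sym yn0 (psd_ge0 HB).
have := psd_ge0 HB (x - (B x y / B y y) *: y).
rewrite psd_sqB psd_sqZ psdZr.
have -> : B x x - 2 * (B x y / B y y * B x y) + (B x y / B y y) ^+ 2 * B y y
  = B x x - B x y ^+ 2 / B y y by field.
by rewrite subr_ge0 ler_pdivrMr.
Qed.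

(** The right side is symmetrized into a double sum and compared termwise by [psd_amgm] for
    [a j *: F i] and [a i *: F j]. This version yields the Frobenius bound, [psd_sq_suml1] the Schur
    test. *)
Lemma psd_sq_suml2 (I : finType) (P : pred I) (a : I -> R) (F : I -> E) :
  B (\sum_(i | P i) a i *: F i) (\sum_(i | P i) a i *: F i)
    <= (\sum_(i | P i) a i ^+ 2) * \sum_(i | P i) B (F i) (F i).
Proof.
rewrite psd_suml.
under eq_bigr => i _ do rewrite psd_sumr.
have -> : (\sum_(i | P i) a i ^+ 2) * (\sum_(i | P i) B (F i) (F i)) =
  2^-1 * \sum_(i | P i) \sum_(j | P j)
    (a i ^+ 2 * B (F j) (F j) + a j ^+ 2 * B (F i) (F i)).
  under [X in _ = _ * X]eq_bigr => i _ do rewrite big_split /= -mulr_sumr -mulr_suml.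
  rewrite big_split /= -mulr_suml -mulr_sumr; by field.
rewrite mulr_sumr; apply: ler_sum => i _; rewrite mulr_sumr; apply: ler_sum => j _.
rewrite (psdZl HB) psdZr mulrA.
have := psd_amgm (a j *: F i) (a i *: F j); rewrite !psd_sqZ (psdZl HB) psdZr.
have := ler_norm (a j * (a i * B (F i) (F j))); lra.
Qed.

Lemma psd_sq_suml1 (I : finType) (P : pred I) (a : I -> R) (F : I -> E) :
  B (\sum_(i | P i) a i *: F i) (\sum_(i | P i) a i *: F i)
    <= (\sum_(i | P i) `|a i|) * \sum_(i | P i) `|a i| * B (F i) (F i).
Proof.
rewrite psd_suml.
under eq_bigr => i _ do rewrite psd_sumr.
have -> : (\sum_(i | P i) `|a i|) * (\sum_(i | P i) `|a i| * B (F i) (F i)) =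
  2^-1 * \sum_(i | P i) \sum_(j | P j)
    (`|a i| * (`|a j| * B (F j) (F j)) + `|a j| * (`|a i| * B (F i) (F i))).
  under [X in _ = _ * X]eq_bigr => i _ do rewrite big_split /= -mulr_sumr -mulr_suml.
  rewrite big_split /= -mulr_suml -mulr_sumr; by field.
rewrite mulr_sumr; apply: ler_sum => i _; rewrite mulr_sumr; apply: ler_sum => j _.
rewrite (psdZl HB) psdZr mulrA.
have h := psd_amgm (F i) (F j).
apply: le_trans (ler_norm _) _; rewrite !normrM.
have := ler_wpM2l (mulr_ge0 (normr_ge0 (a i)) (normr_ge0 (a j))) h; lra.
Qed.

Lemma psd_sq_sum (I : finType) (P : pred I) (F : I -> E) :
  B (\sum_(i | P i) F i) (\sum_(i | P i) F i)
    <= #|[pred i | P i]|%:R * \sum_(i | P i) B (F i) (F i).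
Proof.
have := psd_sq_suml1 P (fun=> 1) F; rewrite normr1.
under eq_bigr => i _ do rewrite scale1r.
under [X in _ <= _ * X]eq_bigr => i _ do rewrite mul1r.
by rewrite sumr_const.
Qed.

Section PowerIteration.
Variables (T : E -> E) (c : R).
Hypotheses (Tsym : forall x y, B (T x) y = B x (T y)) (c0 : 0 <= c).

Lemma psd_iter_sym n x y : B (iter n T x) y = B x (iter n T y).
Proof. by elim: n x y => // n IH x y; rewrite iterS Tsym IH -iterSr. Qed.

(* Since [|T^k x|^2 = <T^2k x, x>], a bound on [T^(2^s)] descends to [T] by
   successive applications of Cauchy-Schwarz. *)
Lemma psd_sym_bound s :
  (forall x, B (iter (2 ^ s) T x) (iter (2 ^ s) T x) <= (c ^+ 2) ^+ (2 ^ s) * B x x) ->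
  forall x, `|B x (T x)| <= c * B x x.
Proof.
elim: s => [|s IH] H.
  move=> x; have := H x; rewrite expn0 /= expr1 => hx.
  rewrite -(@ler_pXn2r _ 2) ?nnegrE ?mulr_ge0 ?(psd_ge0 HB) //.
  rewrite real_normK ?num_real //; apply: le_trans (psd_CS _ _) _.
  have := ler_wpM2l (psd_ge0 HB x) hx; rewrite exprMn; lra.
apply: IH => x; set k := (2 ^ s)%N in H *.
have Bx := psd_ge0 HB (iter k T x).
rewrite -(@ler_pXn2r _ 2) ?nnegrE ?mulr_ge0 ?exprn_ge0 ?(psd_ge0 HB) //.
rewrite {1}psd_iter_sym -iterD addnn -mul2n -expnS.
apply: le_trans (psd_CS _ _) _.
have := ler_wpM2l (psd_ge0 HB x) (H x).
have -> : (c ^+ 2) ^+ (2 ^ s.+1) = ((c ^+ 2) ^+ k) ^+ 2.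
  by rewrite expnS mulnC exprM.
by rewrite -/k exprMn; lra.
Qed.

End PowerIteration.

End PsdForm.

(** * Kernels acting on vector-valued functions *)

Lemma sum_tuple_cons (R : nmodType) (T : finType) n (F : n.+1.-tuple T -> R) :
  \sum_t F t = \sum_x \sum_(t : n.-tuple T) F [tuple of x :: t].
Proof.
rewrite pair_bigA (reindex (fun u : T * n.-tuple T => [tuple of u.1 :: u.2])) //=.
exists (fun t => (thead t, [tuple of behead t])) => [[x t] _|t _] /=.
  by congr (_, _); apply: val_inj.
by rewrite -tuple_eta.
Qed.

Lemma ffact_le_expn J p : (J ^_ p <= J ^ p)%N.
Proof.
elim: p => [|p IH]; first by rewrite expn0 ffactn0.
by rewrite ffactnSr expnSr leq_mul // leq_subr.
Qed.

(** A birthday bound, multiplied out to stay in the naturals: among the [J ^ p] words, the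
    proportion with a repeated letter is at most [p ^ 2 / J]. *)
Lemma expn_le_ffact J p : (J ^ p * J <= J * J ^_ p + p ^ 2 * J ^ p)%N.
Proof.
elim: p => [|p IH]; first by rewrite !expn0 ffactn0; lia.
have h : (J ^_ p * J <= J ^_ p * (J - p) + p * J ^_ p)%N by nia.
have h2 := ffact_le_expn J p.
rewrite ffactnSr !(expnSr J).
move: (J ^ p)%N (J ^_ p)%N (J - p)%N h h2 IH => x y z h h2 IH.
have h3 := leq_mul IH (leqnn J); have h4 := leq_mul h (leqnn J).
have h5 : (p * y * J <= p * x * J)%N by rewrite leq_mul // leq_mul.
have -> : (p.+1 ^ 2 * (x * J) = p ^ 2 * x * J + p * x * J + (p * x * J + x * J))%N.
  by rewrite -addn1; ring.
lia.
Qed.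

Lemma card_uniq_ord_tuples J p :
  #|[pred w : p.-tuple 'I_J | uniq w]| = (J ^_ p)%N.
Proof.
rewrite -[J in RHS]card_ord -(card_uniq_tuples _ predT) cardsE.
by apply: eq_card => w; rewrite unfold_in /= [in RHS]unfold_in /= all_predT.
Qed.

Section Kernel.
Variables (R : realFieldType) (V : finType).
Implicit Types X Y : V -> V -> R.

Definition kmul X Y x z : R := \sum_y X x y * Y y z.
Definition kone (x y : V) : R := (x == y)%:R.
Definition frob X : R := \sum_x \sum_y X x y ^+ 2.
Definition kprod (s : seq (V -> V -> R)) := foldr kmul kone s.

Lemma frob_ge0 X : 0 <= frob X.
Proof. by do 2!apply: sumr_ge0 => ? _; rewrite sqr_ge0. Qed.

Variables (E : lmodType R) (B : E -> E -> R).
Hypothesis HB : psd_form B.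

Definition fdot (f g : {ffun V -> E}) : R := \sum_x B (f x) (g x).

Lemma fdot_psd : psd_form fdot.
Proof.
split=> [f g|f g h|a f g|f].
- by apply: eq_bigr => x _; rewrite (psdC HB).
- by rewrite -big_split; apply: eq_bigr => x _; rewrite ffunE (psdDl HB).
- by rewrite /fdot mulr_sumr; apply: eq_bigr => x _; rewrite ffunE (psdZl HB).
- by apply: sumr_ge0 => x _; apply: psd_ge0 HB _.
Qed.

(** This is [X] tensored with the identity of [E]; scalar bounds on [X] thus hold uniformly in
    [E]. *)
Definition kact X (f : {ffun V -> E}) : {ffun V -> E} :=
  [ffun x => \sum_y X x y *: f y].

Fact kact_linear X : linear (kact X).
Proof.
move=> a f g; apply/ffunP => x; rewrite !ffunE scaler_sumr -big_split /=.
by apply: eq_bigr => y _; rewrite !ffunE scalerDr !scalerA mulrC.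
Qed.
HB.instance Definition _ X := GRing.isLinear.Build R _ _ _ (kact X) (@kact_linear X).

Lemma kact_mul X Y f : kact (kmul X Y) f = kact X (kact Y f).
Proof.
apply/ffunP => x; rewrite !ffunE.
under [RHS]eq_bigr => y _ do rewrite ffunE scaler_sumr.
rewrite exchange_big /=; apply: eq_bigr => z _.
by rewrite scaler_suml; apply: eq_bigr => y _; rewrite scalerA.
Qed.

Lemma kact1 f : kact kone f = f.
Proof.
apply/ffunP => x; rewrite ffunE (bigD1 x) //= /kone eqxx scale1r big1 ?addr0 //.
by move=> y; rewrite eq_sym => /negPf ->; rewrite scale0r.
Qed.

Lemma kact_prod s f : kact (kprod s) f = foldr kact f s.
Proof. by elim: s => [|X s IH] /=; rewrite ?kact1 // kact_mul IH. Qed.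

Lemma kact_sym X : (forall x y, X x y = X y x) ->
  forall f g, fdot (kact X f) g = fdot f (kact X g).
Proof.
move=> sX f g; rewrite /fdot.
under eq_bigr => x _ do rewrite ffunE (psd_suml HB).
under [RHS]eq_bigr => x _ do rewrite ffunE (psd_sumr HB).
rewrite exchange_big /=; apply: eq_bigr => y _; apply: eq_bigr => x _.
by rewrite (psdZl HB) (psdZr HB) sX.
Qed.

Lemma kact_frob X f : fdot (kact X f) (kact X f) <= frob X * fdot f f.
Proof.
rewrite /frob mulr_suml; apply: ler_sum => x _.
by rewrite ffunE; apply: psd_sq_suml2.
Qed.

(** Schur test. The row bound controls the weights in Cauchy-Schwarz; by symmetry it is also a
    column bound, which controls the sum over [x] after the exchange. *)
Lemma kact_schur X K : (forall x y, X x y = X y x) ->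
  (forall x, \sum_y `|X x y| <= K) ->
  forall f, fdot (kact X f) (kact X f) <= K ^+ 2 * fdot f f.
Proof.
move=> sX rX f.
have E0 x : 0 <= B (f x) (f x) by apply: psd_ge0 HB _.
apply: (@le_trans _ _ (\sum_x K * \sum_y `|X x y| * B (f y) (f y))).
  apply: ler_sum => x _; rewrite ffunE.
  apply: le_trans (psd_sq_suml1 HB _ _ _) _; apply: ler_wpM2r => //.
  by apply: sumr_ge0 => y _; apply: mulr_ge0.
rewrite -mulr_sumr exchange_big /= expr2 -mulrA.
(* The sign of [K] is read off from any row, so the empty vertex set is treated apart. *)
have [x0 _|v0] := pickP (@predT V); last first.
  by rewrite /fdot !big1 ?mulr0 // => x; have := v0 x.
have K0 : 0 <= K by apply: le_trans (rX x0); apply: sumr_ge0.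
apply: ler_wpM2l => //; rewrite mulr_sumr; apply: ler_sum => y _.
rewrite -mulr_suml; apply: ler_wpM2r => //.
by under eq_bigr => x _ do rewrite sX.
Qed.

Section Average.
Variables (J : nat) (X : 'I_J -> V -> V -> R).
Hypothesis J0 : (0 < J)%N.

Definition kavg x y : R := J%:R^-1 * \sum_j X j x y.

Lemma kact_avg f : kact kavg f = J%:R^-1 *: \sum_j kact (X j) f.
Proof.
apply/ffunP => x; rewrite !ffunE sum_ffunE.
under [in RHS]eq_bigr => j _ do rewrite ffunE.
rewrite exchange_big /= scaler_sumr; apply: eq_bigr => y _.
by rewrite /kavg -scalerA scaler_suml.
Qed.

(** Convexity of the squared norm, applied once per factor, so averaging costs nothing. The operator
    [A] absorbs the factors already expanded; without it the induction would not pass. *)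
Lemma kavg_iter (A : {linear {ffun V -> E} -> {ffun V -> E}}) p f :
  fdot (A (iter p (kact kavg) f)) (A (iter p (kact kavg) f)) <=
  J%:R^-1 ^+ p * \sum_(w : p.-tuple 'I_J)
     fdot (A (foldr kact f (map X w))) (A (foldr kact f (map X w))).
Proof.
have J0' : (0 : R) < J%:R by rewrite ltr0n.
elim: p A => [|p IH] A.
  by rewrite expr0 mul1r (bigD1 [tuple]) //= lerDl sumr_ge0 // => ? _;
     apply: psd_ge0 fdot_psd _.
rewrite iterS kact_avg linearZ linear_sum (psd_sqZ fdot_psd).
apply: le_trans (ler_wpM2l (sqr_ge0 _) (psd_sq_sum fdot_psd _ _)) _.
have -> : #|[pred i : 'I_J | true]| = J by rewrite (@eq_card _ _ predT) // card_ord.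
have -> z : J%:R^-1 ^+ 2 * (J%:R * z) = J%:R^-1 * z :> R by field; rewrite gt_eqF.
rewrite exprS -mulrA; apply: ler_wpM2l; first by rewrite invr_ge0 ltW.
rewrite sum_tuple_cons mulr_sumr; apply: ler_sum => j _.
exact: (IH (A \o kact (X j))).
Qed.

(** The length [p] is a power of two because [psd_sym_bound] halves it at each use of
    Cauchy-Schwarz. The factor [p ^ 2 / J] comes from [expn_le_ffact]. *)
Lemma kavg_form_bound K phi c s : let p := (2 ^ s)%N in
  (forall j x y, X j x y = X j y x) ->
  (forall j x, \sum_y `|X j x y| <= K) ->
  (forall w : p.-tuple 'I_J, uniq w -> frob (kprod (map X w)) <= phi) ->
  0 <= c -> 0 <= phi ->
  (p%:R ^+ 2 / J%:R) * (K ^+ 2) ^+ p + phi <= (c ^+ 2) ^+ p ->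
  forall f, `|fdot f (kact kavg f)| <= c * fdot f f.
Proof.
move=> p sX rX uX c0 phi0 hc.
have J0' : (0 : R) < J%:R by rewrite ltr0n.
have sT x y : kavg x y = kavg y x.
  by rewrite /kavg; congr (_ * _); apply: eq_bigr => j _.
apply: (psd_sym_bound fdot_psd (kact_sym sT) c0 (s := s)) => f; rewrite -/p.
have f0 := psd_ge0 fdot_psd f.
apply: le_trans (kavg_iter idfun p f) _ => /=.
have fold_le (w : seq 'I_J) : fdot (foldr kact f (map X w)) (foldr kact f (map X w))
    <= (K ^+ 2) ^+ size w * fdot f f.
  elim: w => [|j w IH] /=; first by rewrite expr0 mul1r.
  apply: le_trans (kact_schur (sX j) (rX j) _) _.
  by rewrite (exprS (K ^+ 2)) -mulrA; apply: ler_wpM2l IH; rewrite sqr_ge0.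
rewrite (bigID (fun w : p.-tuple 'I_J => uniq w)) /=.
have h1 : \sum_(w : p.-tuple 'I_J | uniq w)
    fdot (foldr kact f (map X w)) (foldr kact f (map X w))
      <= (J ^_ p)%:R * (phi * fdot f f).
  apply: (@le_trans _ _ (\sum_(w : p.-tuple 'I_J | uniq w) phi * fdot f f)).
    apply: ler_sum => w uw; rewrite -kact_prod.
    apply: le_trans (kact_frob _ _) _; apply: ler_wpM2r => //; exact: uX.
  rewrite sumr_const -(mulr_natl (phi * _)) ler_wpM2r ?mulr_ge0 //.
  by rewrite ler_nat card_uniq_ord_tuples.
have h2 : \sum_(w : p.-tuple 'I_J | ~~ uniq w)
    fdot (foldr kact f (map X w)) (foldr kact f (map X w))
      <= (J ^ p - J ^_ p)%:R * ((K ^+ 2) ^+ p * fdot f f).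
  apply: (@le_trans _ _ (\sum_(w : p.-tuple 'I_J | ~~ uniq w) (K ^+ 2) ^+ p * fdot f f)).
    by apply: ler_sum => w _; have := fold_le w; rewrite size_tuple.
  rewrite sumr_const -(mulr_natl (_ ^+ _ * _)) ler_wpM2r ?mulr_ge0 ?(exprn_ge0 _ (sqr_ge0 _)) //.
  rewrite ler_nat; have := cardC [pred w : p.-tuple 'I_J | uniq w].
  by rewrite card_uniq_ord_tuples card_tuple card_ord => <-; rewrite addKn.
have Jp0 : 0 < (J%:R : R) ^+ p by rewrite exprn_gt0.
rewrite exprVn ler_pdivrMl //.
apply: le_trans (lerD h1 h2) _.
have e1 : (J ^_ p)%:R <= (J%:R : R) ^+ p.
  by rewrite -natrX ler_nat ffact_le_expn.
have e2 : (J ^ p - J ^_ p)%:R * J%:R <= p%:R ^+ 2 * (J%:R : R) ^+ p.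
  by rewrite -!natrX -!natrM ler_nat mulnBl; have := expn_le_ffact J p; lia.
have K0 : 0 <= (K ^+ 2) ^+ p by rewrite exprn_ge0 // sqr_ge0.
apply: (@le_trans _ _ (J%:R ^+ p * ((p%:R ^+ 2 / J%:R * (K ^+ 2) ^+ p + phi) * fdot f f))).
  rewrite (mulrDl _ _ (fdot f f)) mulrDr addrC; apply: lerD.
    have e3 : (J ^ p - J ^_ p)%:R <= p%:R ^+ 2 / J%:R * (J%:R : R) ^+ p.
      by rewrite mulrAC ler_pdivlMr.
    have := ler_wpM2r (mulr_ge0 K0 f0) e3; lra.
  by rewrite ler_wpM2r ?mulr_ge0.
by rewrite ler_pM2l // ler_wpM2r.
Qed.

End Average.
End Kernel.

(** * Expectations over finite probability spaces *)

Section Expectation.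
Variables (R : realFieldType) (T : finType).
Implicit Types (F G : T -> R).

Definition expect F : R := #|T|%:R^-1 * \sum_x F x.

Lemma expect_ge0 F : (forall x, 0 <= F x) -> 0 <= expect F.
Proof. by move=> F0; rewrite mulr_ge0 ?invr_ge0 // sumr_ge0. Qed.

Lemma eq_expect F G : F =1 G -> expect F = expect G.
Proof. by move=> FG; congr (_ * _); apply: eq_bigr. Qed.

Lemma le_expect F G : (forall x, F x <= G x) -> expect F <= expect G.
Proof. by move=> FG; rewrite ler_wpM2l ?invr_ge0 // ler_sum. Qed.

Lemma expectD F G : expect (fun x => F x + G x) = expect F + expect G.
Proof. by rewrite /expect big_split mulrDr. Qed.

Lemma expectZ a F : expect (fun x => a * F x) = a * expect F.
Proof. by rewrite /expect -mulr_sumr mulrCA. Qed.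

Lemma expectB F G : expect (fun x => F x - G x) = expect F - expect G.
Proof. by rewrite /expect sumrB mulrBr. Qed.

Lemma expect_sum (I : Type) (r : seq I) (P : pred I) (F : I -> T -> R) :
  expect (fun x => \sum_(i <- r | P i) F i x) = \sum_(i <- r | P i) expect (F i).
Proof. by rewrite /expect exchange_big mulr_sumr. Qed.

Hypothesis T0 : (0 < #|T|)%N.

Lemma expect_cst a : expect (fun=> a) = a.
Proof.
rewrite /expect sumr_const -(mulr_natl a) mulrA mulVf ?mul1r //.
by rewrite pnatr_eq0 -lt0n.
Qed.

Lemma expect_var_le F : expect (fun x => (F x - expect F) ^+ 2) <= expect (fun x => F x ^+ 2).
Proof.
have -> : expect (fun x => (F x - expect F) ^+ 2) =
    expect (fun x => F x ^+ 2) - expect F ^+ 2.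
  rewrite (eq_expect (G := fun x => (F x ^+ 2 - (2 * expect F) * F x) + expect F ^+ 2)).
    by rewrite expectD expectB expectZ expect_cst; ring.
  by move=> x /=; ring.
by rewrite lerBlDr lerDl sqr_ge0.
Qed.

Definition prob (P : pred T) : R := expect (fun x => (P x)%:R).

Lemma probE P : prob P = #|[pred x | P x]|%:R / #|T|%:R.
Proof.
rewrite /prob /expect mulrC; congr (_ / _).
rewrite -sum1_card natr_sum [RHS]big_mkcond; apply: eq_bigr => x _.
by rewrite inE; case: (P x).
Qed.

Lemma prob_union (I : finType) (D P : pred T) (Q : I -> pred T) :
  (forall x, D x -> P x \/ exists i, Q i x) -> prob D <= prob P + \sum_i prob (Q i).
Proof.
move=> DQ; rewrite -expect_sum -expectD; apply: le_expect => x.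
have S0 : 0 <= \sum_i (Q i x)%:R :> R by apply: sumr_ge0.
case: (D x) (DQ x) => [/(_ isT)[->|[i Qi]]|_]; first by rewrite lerDl.
- rewrite (bigD1 i) //= Qi addrCA lerDl addr_ge0 // sumr_ge0 //.
- by rewrite addr_ge0.
Qed.

Lemma markov_ineq (F : T -> R) a : (forall x, 0 <= F x) -> 0 < a ->
  prob (fun x => a < F x) <= expect F / a.
Proof.
move=> F0 a0; rewrite mulrC -expectZ; apply: le_expect => x.
case: ltP => [aF|_]; last by rewrite mulr_ge0 ?invr_ge0 // ltW.
by rewrite ler_pdivlMl // mulr1 ltW.
Qed.

End Expectation.

Section Resampling.
Variables (R : realFieldType) (I Om : finType).

Definition upd (w : {ffun I -> Om}) t x : {ffun I -> Om} :=
  [ffun i => if i == t then x else w i].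

(** Stands in for independence and Fubini: redrawing one coordinate keeps the law, so a factor
    depending on coordinate [t] alone can be averaged with all the others frozen. *)
Lemma expect_resample t (F : {ffun I -> Om} -> R) : (0 < #|Om|)%N ->
  expect F = expect (fun w => expect (fun x => F (upd w t x))).
Proof.
move=> Om0; rewrite {1}/expect; congr (_ * _).
rewrite /expect -mulr_sumr pair_bigA /=.
(* Exchanging [w t] with [x] is an involution. *)
rewrite (reindex (fun u : {ffun I -> Om} * Om => (upd u.1 t u.2, u.1 t))) /=.
  rewrite (eq_bigr (fun u : {ffun I -> Om} * Om => F u.1)) => [|[w x] _] /=.
    rewrite -(pair_bigA _ (fun w x => F w)) /= mulr_sumr; apply: eq_bigr => w _.
    rewrite sumr_const -(mulr_natl (F w)) mulrA mulVf ?mul1r //.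
    by rewrite pnatr_eq0 -lt0n.
  congr F; apply/ffunP => i; rewrite !ffunE; case: eqP => // ->.
  by [].
exists (fun u : {ffun I -> Om} * Om => (upd u.1 t u.2, u.1 t)) => [] [w x] _ /=;
  rewrite ffunE eqxx; congr (_, _); apply/ffunP => i; rewrite !ffunE;
  by case: eqP => // ->.
Qed.

End Resampling.

(** * Second moments of products of independent centered batches *)

Section RandomMatrix.
Variables (R : realFieldType) (I Om V : finType) (M : Om -> V -> V -> R).
Variables (D rho : R).
Hypotheses (Om0 : (0 < #|Om|)%N) (M0 : forall r x y, 0 <= M r x y).
Hypotheses (MD : forall r x, \sum_y M r x y <= D)
  (Mrho : forall y, expect (fun r => \sum_x M r x y) <= rho).
Variables (J N : nat) (Bt : 'I_J -> {set I}).
Hypotheses (N0 : (0 < N)%N) (BtN : forall j, #|Bt j| = N)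
  (Btd : forall j k t, j != k -> t \in Bt j -> t \notin Bt k).

Definition mean_kernel x y : R := expect (fun r => M r x y).
Definition batch_kernel (w : {ffun I -> Om}) j x y : R :=
  N%:R^-1 * \sum_(t in Bt j) M (w t) x y.
Definition centered_batch w j x y : R := batch_kernel w j x y - mean_kernel x y.

Let Y r (A : V -> V -> R) x z : R := kmul (fun x y => M r x y - mean_kernel x y) A x z.

Lemma centered_batchE w j x y :
  centered_batch w j x y = N%:R^-1 * \sum_(t in Bt j) (M (w t) x y - mean_kernel x y).
Proof.
rewrite /centered_batch /batch_kernel sumrB sumr_const BtN mulrBr; congr (_ - _).
by rewrite -(mulr_natl (mean_kernel x y)) mulrA mulVf ?mul1r // pnatr_eq0 -lt0n.
Qed.

Lemma mean_Y A x z : expect (fun r => Y r A x z) = 0.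
Proof.
rewrite /Y /kmul expect_sum big1 // => y _.
rewrite (eq_expect (G := fun r => A y z * (M r x y - mean_kernel x y))).
  by rewrite expectZ expectB (expect_cst Om0) subrr mulr0.
by move=> r; rewrite mulrC.
Qed.

(** The variance is at most the second moment, which removes the centering. Cauchy-Schwarz with
    weights [M r x y] then costs a row sum [D], and summing over [x] leaves an expected column sum,
    at most [rho]. *)
Lemma expect_frob_Y A :
  \sum_x \sum_z expect (fun r => Y r A x z ^+ 2) <= D * rho * frob A.
Proof.
apply: (@le_trans _ _ (\sum_x \sum_z expect (fun r => (kmul (M r) A x z) ^+ 2))).
  apply: ler_sum => x _; apply: ler_sum => z _.
  apply: le_trans (expect_var_le Om0 _); rewrite le_eqVlt; apply/orP; left; apply/eqP.
  apply: eq_expect => r; congr (_ ^+ 2).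
  rewrite /Y /kmul expect_sum -sumrB; apply: eq_bigr => y _.
  rewrite mulrBl; congr (_ - _).
  rewrite /mean_kernel mulrC -expectZ; apply: eq_expect => r' ; exact: mulrC.
apply: (@le_trans _ _ (\sum_x \sum_z expect (fun r => D * \sum_y M r x y * A y z ^+ 2))).
  apply: ler_sum => x _; apply: ler_sum => z _; apply: le_expect => r.
  have psdR : psd_form (fun u v : R^o => u * v : R).
    split=> [u v|u v s|a u v|u]; [exact: mulrC|exact: mulrDl| |].
      by rewrite /GRing.scale /= mulrA.
    by rewrite -expr2 sqr_ge0.
  have := psd_sq_suml1 psdR predT (M r x) (fun y => A y z : R^o).
  rewrite -expr2 => /le_trans; apply.
  under [X in X * _ <= _]eq_bigr => y _ do rewrite ger0_norm //.
  under [X in _ * X <= _]eq_bigr => y _ do rewrite ger0_norm // -expr2.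
  by apply: ler_wpM2r (MD r x); apply: sumr_ge0 => y _; rewrite mulr_ge0 ?sqr_ge0.
have -> : \sum_x \sum_z expect (fun r => D * \sum_y M r x y * A y z ^+ 2) =
  D * \sum_y \sum_z A y z ^+ 2 * expect (fun r => \sum_x M r x y).
  under eq_bigr => x _. under eq_bigr => z _ do rewrite expectZ expect_sum. over.
  under eq_bigr => x _. rewrite -mulr_sumr. over.
  rewrite -mulr_sumr; congr (_ * _).
  under [RHS]eq_bigr => y _. under eq_bigr => z _ do rewrite expect_sum mulr_sumr. over.
  rewrite [RHS]exchange_big /=.
  under [RHS]eq_bigr => z _ do rewrite exchange_big /=.
  rewrite [RHS]exchange_big /=; apply: eq_bigr => x _; apply: eq_bigr => z _.
  apply: eq_bigr => y _; rewrite -expectZ; apply: eq_expect => r; exact: mulrC.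
have [v _|v0] := pickP (@predT V); last first.
  by rewrite big1 ?mulr0 /frob ?big1 ?mulr0 // => x; have := v0 x.
have D0 : 0 <= D.
  have [r _] : exists r : Om, true by case/card_gt0P: Om0 => r _; exists r.
  by apply: le_trans (MD r v); apply: sumr_ge0.
rewrite -mulrA; apply: ler_wpM2l => //.
rewrite /frob mulr_sumr; apply: ler_sum => y _; rewrite mulr_sumr; apply: ler_sum => z _.
by rewrite mulrC ler_wpM2r ?sqr_ge0.
Qed.

(** [A] does not see batch [j]. Redrawing coordinate [t] kills the cross terms with [u != t], since
    [Y] has mean zero; the [N] diagonal terms against [N ^- 2] leave the gain [1 / N]. *)
Lemma expect_frob_step j (A : {ffun I -> Om} -> V -> V -> R) :
  (forall w t r x y, t \in Bt j -> A (upd w t r) x y = A w x y) ->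
  expect (fun w => frob (kmul (centered_batch w j) (A w))) <=
    (D * rho / N%:R) * expect (fun w => frob (A w)).
Proof.
move=> indA.
have N0' : (0 : R) < N%:R by rewrite ltr0n.
have YA w t r r' x z : t \in Bt j -> Y r' (A (upd w t r)) x z = Y r' (A w) x z.
  by move=> tj; apply: eq_bigr => y _; rewrite indA.
have E1 w x z : kmul (centered_batch w j) (A w) x z =
    N%:R^-1 * \sum_(t in Bt j) Y (w t) (A w) x z.
  rewrite /kmul; under eq_bigr => y _ do rewrite centered_batchE -mulrA mulr_suml.
  by rewrite -mulr_sumr exchange_big.
have E2 x z : expect (fun w => kmul (centered_batch w j) (A w) x z ^+ 2) =
   N%:R^-1 ^+ 2 * \sum_(t in Bt j) expect (fun w => expect (fun r => Y r (A w) x z ^+ 2)).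
  rewrite (eq_expect (G := fun w : {ffun I -> Om} => N%:R^-1 ^+ 2 * \sum_(t in Bt j) \sum_(u in Bt j)
     (Y (w t) (A w) x z * Y (w u) (A w) x z))); last first.
    move=> w; rewrite E1 exprMn; congr (_ * _); rewrite expr2 mulr_suml.
    by apply: eq_bigr => t _; rewrite mulr_sumr.
  rewrite expectZ expect_sum; congr (_ * _); apply: eq_bigr => t tj.
  rewrite expect_sum (bigD1 t) //= big1 ?addr0 => [|u /andP[uj ut]].
    rewrite (expect_resample t _ Om0); apply: eq_expect => w; apply: eq_expect => r.
    by rewrite !ffunE eqxx !YA // expr2.
  rewrite (expect_resample t _ Om0).
  rewrite (eq_expect (G := fun=> 0)); first by rewrite /expect big1_eq mulr0.
  move=> w.
  rewrite (eq_expect (G := fun r => Y (w u) (A w) x z * Y r (A w) x z)).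
    by rewrite expectZ mean_Y mulr0.
  by move=> r; rewrite !ffunE eqxx (negPf ut) !YA // mulrC.
rewrite /frob expect_sum.
under eq_bigr => x _. rewrite expect_sum. under eq_bigr => z _ do rewrite E2 sumr_const BtN -(mulr_natl (expect _)). over.
have -> (c : R) (G : V -> V -> R) : \sum_x \sum_z c * (N%:R * G x z) = (c * N%:R) * \sum_x \sum_z G x z.
  rewrite mulr_sumr; apply: eq_bigr => x _; rewrite mulr_sumr; apply: eq_bigr => z _.
  by rewrite mulrA.
have -> : N%:R^-1 ^+ 2 * N%:R = N%:R^-1 :> R by field; rewrite gt_eqF.
rewrite (mulrC (D * rho)) -mulrA ler_wpM2l ?invr_ge0 ?(ltW N0') // -expectZ.
have -> : \sum_x \sum_z expect (fun w => expect (fun r => Y r (A w) x z ^+ 2)) =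
   expect (fun w => \sum_x \sum_z expect (fun r => Y r (A w) x z ^+ 2)).
  by rewrite expect_sum; apply: eq_bigr => x _; rewrite expect_sum.
by apply: le_expect => w; apply: expect_frob_Y.
Qed.

(** Factors are peeled off by [expect_frob_step] down to the identity kernel, for which [frob] is
    [#|V|]. *)
Lemma expect_frob_prod (s : seq 'I_J) : uniq s -> 0 <= D * rho ->
  expect (fun w : {ffun I -> Om} => frob (kprod (map (centered_batch w) s))) <=
    (D * rho / N%:R) ^+ size s * #|V|%:R.
Proof.
move=> + Dr; have k0 : 0 <= D * rho / N%:R by rewrite mulr_ge0 // invr_ge0.
elim: s => [_|j s IH /= /andP[js us]].
  rewrite expr0 mul1r /= expect_cst; last first.
    by rewrite card_ffun expn_gt0 Om0.
  rewrite /frob -sum1_card natr_sum; apply: ler_sum => x _.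
  rewrite (bigD1 x) //= /kone eqxx big1 ?addr0 ?expr1n // => y.
  by rewrite eq_sym => /negPf ->; rewrite expr0n.
apply: le_trans (expect_frob_step _) _; last first.
  by rewrite exprS -[X in _ <= X]mulrA ler_wpM2l // IH.
(* As [j] does not occur in the tail and batches are disjoint, redrawing a coordinate of batch [j]
   leaves the tail product unchanged. *)
move=> w t r x y tj; rewrite {IH us}; elim: s js x y => //= k s IH.
rewrite inE negb_or => /andP[jk js] x y; apply: eq_bigr => z _; rewrite IH //.
congr (_ * _); rewrite /centered_batch /batch_kernel; congr (_ * _ - _).
apply: eq_bigr => u uk; rewrite ffunE; case: eqP => // ut.
by move: uk; rewrite ut (negPf (Btd jk tj)).
Qed.

End RandomMatrix.

(** * Chernoff's bound for counts in a batch *)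

Section Chernoff.
Variables (R : realType).

(** From [exp (- s) >= 1 - s]. Negative [s] is included, so that one estimate serves both tails. *)
Lemma expR_le_quad (s : R) : s <= 2^-1 -> expR s <= 1 + s + 2 * s ^+ 2.
Proof.
move=> s1.
have h : 0 < 1 - s by lra.
have h2 := expR_ge1Dx (- s).
have : expR s <= (1 - s)^-1.
  by rewrite -[s in expR s]opprK expRN lef_pV2 ?posrE ?expR_gt0.
move/le_trans; apply; rewrite -[X in X <= _]mul1r ler_pdivrMr //.
have -> : (1 + s + 2 * s ^+ 2) * (1 - s) = 1 + s ^+ 2 * (1 - 2 * s) by ring.
by rewrite lerDl mulr_ge0 ?sqr_ge0 //; lra.
Qed.

(** From [exp (t / p) >= t / p]. It trades the exponential for a power, so that the Chernoff terms
    get the same shape as the moment terms. *)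
Lemma expRN_le (t : R) p : 0 < t -> (0 < p)%N -> expR (- t) <= (p%:R / t) ^+ p.
Proof.
move=> t0 p0; have p0' : (0 : R) < p%:R by rewrite ltr0n.
have -> : - t = p%:R * - (t / p%:R) by field; rewrite gt_eqF.
rewrite expRM_natl lerXn2r ?nnegrE ?expR_ge0 ?divr_ge0 ?(ltW t0) ?(ltW p0') //.
rewrite expRN -[p%:R / t]invf_div lef_pV2 ?posrE ?expR_gt0 ?divr_gt0 //.
by apply: le_trans (expR_ge1Dx _); rewrite lerDr.
Qed.

Variables (I Om : finType) (Z : pred Om) (Bt : {set I}).
Hypothesis Om0 : (0 < #|Om|)%N.

Let pz : R := prob R Z.
Let count (w : {ffun I -> Om}) : R := \sum_(t in Bt) (Z (w t))%:R.

(** The integrand is a product over independent coordinates, so its expectation factors by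
    distributivity; each nontrivial factor [1 + pz * (expR s - 1)] is below the exponential. *)
Lemma mgf_le s : expect (fun w => expR (s * count w)) <=
  expR (#|Bt|%:R * pz * (expR s - 1)).
Proof.
pose F t x : R := if t \in Bt then expR (s * (Z x)%:R) else 1.
have -> : expect (fun w => expR (s * count w)) =
    expect (fun w : {ffun I -> Om} => \prod_t F t (w t)).
  apply: eq_expect => w; rewrite /count mulr_sumr expR_sum big_mkcond.
  by apply: eq_bigr => t _; rewrite /F.
rewrite /expect -(bigA_distr_bigA F) /= card_ffun natrX -exprVn.
have -> : #|Om|%:R^-1 ^+ #|I| * \prod_t \sum_x F t x = \prod_t expect (F t) :> R.
  by rewrite -(prodr_const I) -big_split.
have EF t : expect (F t) = if t \in Bt then 1 + pz * (expR s - 1) else 1.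
  rewrite /F; case: ifP => _; last exact: expect_cst Om0 _.
  rewrite (eq_expect (G := fun x => 1 + (expR s - 1) * (Z x)%:R)).
    by rewrite expectD (expect_cst Om0) expectZ [X in _ + X]mulrC.
  by move=> x; case: (Z x); rewrite ?mulr1 ?mulr0 ?expR0 ?addr0 // addrC subrK.
have pz0 : 0 <= pz by apply: expect_ge0.
have pz1 : pz <= 1.
  rewrite -(expect_cst Om0 1); apply: le_expect => x; by case: (Z x).
rewrite -mulrA expRM_natl -prodr_const [X in _ <= X]big_mkcond /=.
apply: ler_prod => t _; rewrite EF; case: ifP => _; last by rewrite ler01 lexx.
rewrite expR_ge1Dx andbT.
have := expR_ge0 s; have : pz * expR s >= 0 by rewrite mulr_ge0 ?expR_ge0.
lra.
Qed.

Lemma chernoff_deviation (dl : R) : 0 < dl <= 1 -> 0 < #|Bt|%:R * pz ->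
  prob R (fun w : {ffun I -> Om} =>
     dl * (#|Bt|%:R * pz) < `|count w - #|Bt|%:R * pz|)
   <= 2 * expR (- (dl ^+ 2 * (#|Bt|%:R * pz) / 8)).
Proof.
set mu := #|Bt|%:R * pz; move=> /andP[dl0 dl1] mu0.
(* Used with [s = dl / 4] and [s = - dl / 4]: the deviation gains [dl ^+ 2 / 4] in the exponent, the
   quadratic error [2 * s ^+ 2] gives back half of it. *)
have tail s (P : pred {ffun I -> Om}) : s <= 2^-1 -> 
    (forall w, P w -> s * mu + dl ^+ 2 / 4 * mu <= s * count w) -> 
    s ^+ 2 = dl ^+ 2 / 16 ->
    prob R P <= expR (- (dl ^+ 2 * mu / 8)).
  move=> s1 hP hs.
  apply: (@le_trans _ _ (expect (fun w => expR (- (s * mu + dl ^+ 2 / 4 * mu)) * expR (s * count w)))).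
    apply: le_expect => w; case: (boolP (P w)) => [/hP hw|_]; last first.
      by rewrite mulr_ge0 ?expR_ge0.
    by rewrite -expRD -[X in X <= _]expR0 ler_expR; lra.
  rewrite expectZ; apply: le_trans (ler_wpM2l (expR_ge0 _) (mgf_le s)) _.
  rewrite -expRD ler_expR -/mu.
  have := ler_wpM2l (ltW mu0) (expR_le_quad s1); rewrite hs; lra.
pose P1 w := (1 + dl) * mu < count w.
pose P2 w := count w < (1 - dl) * mu.
apply: (@le_trans _ _ (prob R P1 + prob R P2)).
  rewrite -expectD; apply: le_expect => w; rewrite -natrD ler_nat /P1 /P2.
  case: (ltP ((1 + dl) * mu) _) => h2; first by case: (_ < `|_|).
  case: (ltP _ ((1 - dl) * mu)) => h3; first by case: (_ < `|_|).
  have -> // : dl * mu < `|count w - mu| = false.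
  by apply/negbTE; rewrite -leNgt ler_norml; apply/andP; split; lra.
have -> : 2 * expR (- (dl ^+ 2 * mu / 8)) =
  expR (- (dl ^+ 2 * mu / 8)) + expR (- (dl ^+ 2 * mu / 8)) by ring.
apply: lerD.
  apply: (tail (dl / 4)); [lra| |by field] => w; rewrite /P1 => /ltW h.
  have := ler_wpM2l (ltW dl0) h; lra.
apply: (tail (- (dl / 4))); [lra| |by field] => w; rewrite /P2 => /ltW h.
have := ler_wpM2l (ltW dl0) h; lra.
Qed.

End Chernoff.

(** * Counting reduced words *)

Section TupleSums.
Variables (U : nmodType) (L : finType).
Implicit Types F : seq L -> U.

(** The summand lives on plain sequences, so that words can be cut and concatenated without casts
    between tuple types. *)
Definition tsum b F : U := \sum_(t : b.-tuple L) F (tval t).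

Lemma tsum0 F : tsum 0 F = F [::].
Proof.
rewrite /tsum (bigD1 [tuple]) //= big1 ?addr0 // => t.
by move=> /eqP[]; exact: tuple0.
Qed.

Lemma tsumS b F : tsum b.+1 F = \sum_x tsum b (fun w => F (x :: w)).
Proof. by rewrite /tsum sum_tuple_cons. Qed.

Lemma eq_tsum b F G : (forall w, size w = b -> F w = G w) -> tsum b F = tsum b G.
Proof. by move=> FG; apply: eq_bigr => t _; rewrite FG ?size_tuple. Qed.

Lemma tsum_cat a b F : tsum (a + b) F = tsum a (fun u => tsum b (fun v => F (u ++ v))).
Proof.
elim: a F => [|a IH] F; first by rewrite tsum0.
by rewrite addSn !tsumS; apply: eq_bigr => x _; rewrite IH.
Qed.

Lemma tsum_sum (I : finType) (P : pred I) b (F : I -> seq L -> U) :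
  tsum b (fun w => \sum_(i | P i) F i w) = \sum_(i | P i) tsum b (F i).
Proof. exact: exchange_big. Qed.

Lemma tsumD b F G : tsum b (fun w => F w + G w) = tsum b F + tsum b G.
Proof. exact: big_split. Qed.

Lemma exchange_tsum a b (F : seq L -> seq L -> U) :
  tsum a (fun u => tsum b (F u)) = tsum b (fun v => tsum a (F^~ v)).
Proof. exact: exchange_big. Qed.

Lemma tsum_rot b s F : tsum b (fun w => F (rot s w)) = tsum b F.
Proof.
rewrite /tsum [RHS](reindex (fun t : b.-tuple L => [tuple of rot s t])) //=.
exists (fun t : b.-tuple L => [tuple of rotr s t]) => t _; apply: val_inj => /=.
  exact: rotK.
exact: rotrK.
Qed.

End TupleSums.

Section RealTupleSums.
Variables (R : realFieldType) (L : finType).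
Implicit Types F : seq L -> R.

Lemma le_tsum b F G : (forall w, size w = b -> F w <= G w) -> tsum b F <= tsum b G.
Proof. by move=> FG; apply: ler_sum => t _; rewrite FG ?size_tuple. Qed.

Lemma tsum_ge0 b F : (forall w, size w = b -> 0 <= F w) -> 0 <= tsum b F.
Proof. by move=> F0; apply: sumr_ge0 => t _; rewrite F0 ?size_tuple. Qed.

Lemma tsumZ b a F : tsum b (fun w => a * F w) = a * tsum b F.
Proof. by rewrite /tsum mulr_sumr. Qed.

End RealTupleSums.

Section ReducedWords.
Variables (R : realFieldType) (n : nat).
Hypothesis n0 : (0 < n)%N.
Notation L := (letter n).

Definition noncancel (x y : L) : bool := x != linv y.
Definition reduced (w : word n) : bool := sorted noncancel w.

Local Notation m := ((2 * n)%:R : R).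
Local Notation Q := ((2 * n - 1)%:R : R).

Lemma mQ : m = Q + 1. Proof. by rewrite natrB ?subrK // muln_gt0. Qed.
Lemma Q_ge1 : 1 <= Q. Proof. by rewrite ler1n; lia. Qed.
Lemma Q_gt0 : 0 < Q. Proof. exact: lt_le_trans ltr01 Q_ge1. Qed.
Lemma m_gt0 : 0 < m. Proof. by rewrite mQ addr_gt0 // Q_gt0. Qed.

Lemma noncancel_sym x y : noncancel x y = noncancel y x.
Proof. by rewrite /noncancel -(inj_eq (can_inj (@linvK n))) linvK eq_sym. Qed.

Lemma sum_noncancel (F : L -> R) x :
  \sum_y (noncancel x y)%:R * F y = \sum_y F y - F (linv x).
Proof.
rewrite [X in _ = X - _](bigD1 (linv x)) //= (bigD1 (linv x)) //=.
rewrite {1}/noncancel linvK eqxx mul0r add0r [RHS]addrC addKr.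
apply: eq_bigr => y yx; suff -> : noncancel x y by rewrite mul1r.
by rewrite noncancel_sym.
Qed.

Lemma card_letter : #|{: L}|%:R = m.
Proof. by rewrite card_prod card_ord card_bool mulnC. Qed.

Lemma sum1_letter : \sum_(y : L) (1 : R) = m.
Proof. by rewrite sumr_const card_letter. Qed.

(** The [(x, y)] entry of the [(c+1)]-th power of the non-backtracking matrix on letters. *)
Definition cnt c x y : R := tsum c (fun w => (path noncancel x (rcons w y))%:R).

Lemma cntS c x y : cnt c.+1 x y = \sum_z cnt c z y - cnt c (linv x) y.
Proof.
rewrite -(sum_noncancel (fun z => cnt c z y)) /cnt tsumS; apply: eq_bigr => z _.
by rewrite -tsumZ; apply: eq_tsum => w _ /=; rewrite -natrM mulnb.
Qed.

Lemma sum_cnt c y : \sum_z cnt c z y = Q ^+ c.+1.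
Proof.
elim: c => [|c IH].
  under eq_bigr => z _ do rewrite /cnt tsum0 /= andbT noncancel_sym -[_%:R]mulr1.
  by rewrite (sum_noncancel (fun=> 1)) sum1_letter mQ expr1 addrK.
under eq_bigr => z _ do rewrite cntS IH.
rewrite sumrB sumr_const -(mulr_natl (Q ^+ _)) card_letter.
have -> : \sum_z cnt c (linv z) y = Q ^+ c.+1.
  by rewrite -IH [RHS](reindex_inj (can_inj (@linvK n))).
rewrite mQ.
by rewrite [in RHS]exprS; ring.
Qed.

(* By [cntS] the error [cnt c x y - Q ^+ c.+1 / m] only changes sign with [c]. *)
Lemma cnt_bound c x y : `|cnt c x y - Q ^+ c.+1 / m| <= 1.
Proof.
have m0 := m_gt0; have Q0 := Q_gt0.
elim: c x => [|c IH] x.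
  rewrite /cnt tsum0 /= andbT expr1 mQ; case: (noncancel x y); rewrite ler_norml /=.
    have -> : 1 - Q / (Q + 1) = 1 / (Q + 1) by field; rewrite -mQ gt_eqF.
    rewrite ler_pdivrMr -?mQ // mQ; apply/andP; split; last lra.
    by apply: (@le_trans _ _ 0); [lra | rewrite divr_ge0 //; lra].
  rewrite sub0r lerN2 lerNl; rewrite ler_pdivrMr -?mQ // mQ; apply/andP; split; first lra.
  by apply: (@le_trans _ _ 0); [lra | rewrite divr_ge0 //; lra].
have -> : cnt c.+1 x y - Q ^+ c.+2 / m = - (cnt c (linv x) y - Q ^+ c.+1 / m).
  rewrite cntS sum_cnt (exprS Q c.+1) mQ; field; by rewrite -mQ gt_eqF.
by rewrite normrN.
Qed.

Lemma tsum_path b x : tsum b (fun w => (path noncancel x w)%:R) = Q ^+ b :> R.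
Proof.
elim: b x => [|b IH] x; first by rewrite tsum0.
rewrite tsumS exprSr.
have -> : \sum_y tsum b (fun w => (path noncancel x (y :: w))%:R) =
  \sum_y (noncancel x y)%:R * Q ^+ b :> R.
  apply: eq_bigr => y _; rewrite -(IH y) -tsumZ; apply: eq_tsum => w _ /=.
  by rewrite -natrM mulnb.
rewrite (sum_noncancel (fun=> Q ^+ b)) -[Q ^+ b in X in X - _]mulr1 -mulr_sumr sum1_letter mQ; ring.
Qed.

(** The number of reduced words of length [b] for [b > 0]; at [b = 0] the truncated predecessor
    gives [m] in place of 1. *)
Definition nred b : R := m * Q ^+ b.-1.

Lemma nred_gt0 b : 0 < nred b.
Proof. by rewrite mulr_gt0 ?m_gt0 ?exprn_gt0 ?Q_gt0. Qed.

Lemma tsum_reduced b : (0 < b)%N -> tsum b (fun w => (reduced w)%:R) = nred b :> R.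
Proof.
case: b => // b _; rewrite tsumS.
under eq_bigr => x _ do rewrite /reduced /= tsum_path -[Q ^+ b]mul1r.
by rewrite -mulr_suml sum1_letter.
Qed.

End ReducedWords.

(** * The law of a window of a random cyclically reduced word *)

Section Windows.
Variables (R : realFieldType) (n l : nat).
Hypothesis n0 : (0 < n)%N.
Notation L := (letter n).
Notation Om := (cr_word n l).

Lemma sum_cr_word (F : word n -> R) :
  \sum_(r : Om) F (val r) = tsum l (fun w => (cyclically_reduced w)%:R * F w).
Proof.
have <- : \sum_(t : l.-tuple L | cyclically_reduced t) F t = \sum_(r : Om) F (val r).
  exact: (big_sub (fun t : l.-tuple L => cyclically_reduced t) (fun t => F t)).
rewrite big_mkcond; apply: eq_bigr => t _; 
by case: ifP => _; rewrite ?mul1r ?mul0r.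
Qed.

Lemma cyclically_reduced_cat x (z y : word n) :
  cyclically_reduced ((x :: z) ++ y) =
  reduced (x :: z) && path (@noncancel n) (last x z) (rcons y x).
Proof. by rewrite /cyclically_reduced /= rcons_cat cat_path. Qed.

(** Cyclic reducedness is invariant under rotation, so the window may be put first. The number of
    ways to complete it around the circle depends only on its last and first letters. *)
Lemma sum_window s b c (F : word n -> R) (x0 : L) : l = (b + c)%N -> (0 < b)%N ->
  \sum_(r : Om) F (take b (rot s (val r))) =
  tsum b (fun z => (reduced z)%:R * (cnt R c (last x0 z) (head x0 z) * F z)).
Proof.
move=> lE b0; rewrite (sum_cr_word (fun w => F (take b (rot s w)))).
have -> : tsum l (fun w => (cyclically_reduced w)%:R * F (take b (rot s w))) =
          tsum l (fun w => (cyclically_reduced (rot s w))%:R * F (take b (rot s w))).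
  by apply: eq_tsum => w _; rewrite /cyclically_reduced rot_cycle.
rewrite (tsum_rot l s (fun w => (cyclically_reduced w)%:R * F (take b w))) lE tsum_cat.
apply: eq_tsum => z zb; rewrite /cnt.
case: z zb => [|x z] zb; first by rewrite -zb in b0.
rewrite [X in _ = _ * X]mulrC mulrA -tsumZ.
apply: eq_tsum => y _; rewrite cyclically_reduced_cat take_size_cat //=.
by rewrite mulrAC -natrM mulnb.
Qed.

End Windows.

Section Equidistribution.
Variables (R : realFieldType) (n l : nat).
Hypothesis n0 : (0 < n)%N.
Notation L := (letter n).
Notation Om := (cr_word n l).

Local Notation m := ((2 * n)%:R : R).
Local Notation Q := ((2 * n - 1)%:R : R).

(** The count is the trace of the [l]-th power of the non-backtracking matrix, and each of the [m]
    diagonal entries is within 1 of [Q ^+ l / m]. It is obtained by summing over windows of length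
    one. *)
Lemma card_cr_word_bound : (0 < l)%N -> `|#|Om|%:R - Q ^+ l| <= m.
Proof.
move=> l0; have x0 : L := (Ordinal n0, false).
have m0 := m_gt0 R n0.
have -> : #|Om|%:R = \sum_(x : L) cnt R l.-1 x x :> R.
  have E1 : l = (1 + l.-1)%N by rewrite add1n prednK.
  have := @sum_window R n l 0 1 l.-1 (fun=> 1) x0 E1 isT; rewrite sumr_const => ->.
  rewrite tsumS; apply: eq_bigr => x _.
  by rewrite tsum0 /= mul1r mulr1.
have -> : Q ^+ l = \sum_(x : L) Q ^+ l / m.
  by rewrite sumr_const -(mulr_natl (_ / _)) card_letter mulrC divfK // gt_eqF.
rewrite -sumrB -[X in _ <= X](sum1_letter R n); apply: le_trans (ler_norm_sum _ _ _) _.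
apply: ler_sum => x _; rewrite -[in Q ^+ l](prednK l0); exact: cnt_bound.
Qed.

Section Window.
Variables (b c : nat) (eta : R).
Hypotheses (lE : l = (b + c)%N) (b0 : (0 < b)%N).
Hypotheses (eta0 : 0 < eta <= 1) (hc : 4 * m <= eta * Q ^+ c.+1).

(** [hc] turns the additive error 1 of [cnt_bound] into a relative error: both the number of
    completions and the total count are known up to a small fraction of [eta]. *)
Lemma window_weight (x y : L) :
  `|cnt R c x y * nred R n b - #|Om|%:R| <= eta * #|Om|%:R /\ (0 : R) < #|Om|%:R.
Proof.
have l0 : (0 < l)%N by lia.
have m0 := m_gt0 R n0; have Q1 := Q_ge1 R n0; have /andP[e0 e1] := eta0.
have := card_cr_word_bound l0; rewrite ler_norml => /andP[h1 h2].
have := cnt_bound R n0 c x y; rewrite ler_norml => /andP[h3 h4].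
have Qb : 1 <= Q ^+ b.-1 by rewrite exprn_ege1.
have QE : Q ^+ l = Q ^+ b.-1 * Q ^+ c.+1.
  by rewrite -exprD; congr (_ ^+ _); lia.
have W0 := nred_gt0 R n0 b.
have hW : 4 * nred R n b <= eta * Q ^+ l.
  rewrite QE /nred; have := ler_wpM2r (le_trans ler01 Qb) hc; lra.
have mW : m <= nred R n b.
  by have := ler_wpM2l (ltW m0) Qb; rewrite mulr1.
have QW : (Q ^+ c.+1 / m) * nred R n b = Q ^+ l.
  by rewrite QE /nred mulrA divfK ?gt_eqF // mulrC.
have Ql0 : 0 <= Q ^+ l by rewrite exprn_ge0 //; lra.
have e2 : eta * Q ^+ l <= Q ^+ l by have := ler_wpM2r Ql0 e1; rewrite mul1r.
have c0 : (0 : R) < #|Om|%:R by lra.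
split=> //.
have h5 := ler_wpM2r (ltW W0) h3; have h6 := ler_wpM2r (ltW W0) h4.
have h7 := ler_wpM2l (ltW e0) h1.
have h8 : eta * m <= m by have := ler_wpM2r (ltW m0) e1; rewrite mul1r.
rewrite ler_norml; apply/andP; split; lra.
Qed.

(** The law of the window has density within [eta] of 1 with respect to the uniform law on reduced
    words, whence an error measured by the mean of [|F|]. *)
Lemma window_expect s (F : word n -> R) :
  `|expect (fun r : Om => F (take b (rot s (val r)))) -
     (nred R n b)^-1 * tsum b (fun z => (reduced z)%:R * F z)|
  <= eta * ((nred R n b)^-1 * tsum b (fun z => (reduced z)%:R * `|F z|)).
Proof.
have x0 : L := (Ordinal n0, false).
have W0 := nred_gt0 R n0 b.
have [_ c0] := window_weight x0 x0.
rewrite /expect (sum_window s F x0 lE b0) -!tsumZ /tsum -sumrB.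
apply: le_trans (ler_norm_sum _ _ _) _; apply: ler_sum => z _.
case: (reduced z); last by rewrite !mul0r !mulr0 subrr normr0.
rewrite !mul1r; set x := last _ _; set y := head _ _.
have [h _] := window_weight x y.
have -> : #|Om|%:R^-1 * (cnt R c x y * F z) - (nred R n b)^-1 * F z =
   ((cnt R c x y * nred R n b - #|Om|%:R) / (#|Om|%:R * nred R n b)) * F z.
  by field; rewrite !gt_eqF.
rewrite normrM mulrA ler_wpM2r // normrM normfV [X in _ / X]ger0_norm; last first.
  by rewrite mulr_ge0 // ltW.
rewrite ler_pdivrMr; last exact: mulr_gt0 c0 W0.
have -> : eta / nred R n b * (#|Om|%:R * nred R n b) = eta * #|Om|%:R.
  by field; rewrite gt_eqF.
by [].
Qed.

End Window.

End Equidistribution.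

Section PairSums.
Variables (R : realFieldType) (n : nat).
Hypothesis n0 : (0 < n)%N.
Notation L := (letter n).
Local Notation Q := ((2 * n - 1)%:R : R).

Lemma size_winv (w : word n) : size (winv w) = size w.
Proof. by rewrite /winv size_rev size_map. Qed.

Lemma reduced_winv (w : word n) : reduced (winv w) = reduced w.
Proof.
rewrite /reduced /winv rev_sorted sorted_map; apply: eq_sorted => x y /=.
by rewrite noncancel_sym /noncancel linvK (inv_eq (@linvK n)).
Qed.

Lemma tsum_winv (U : nmodType) b (F : word n -> U) : tsum b (fun w => F (winv w)) = tsum b F.
Proof.
pose iv (t : b.-tuple L) := [tuple of rev (map (@linv n) t)].
have ivK : involutive iv by move=> t; apply: val_inj; exact: winvK.
by rewrite /tsum [RHS](reindex_inj (can_inj ivK)).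
Qed.

Variable x0 : L.
Implicit Types (u v : word n).

Lemma reduced_cat u v : (0 < size u)%N -> (0 < size v)%N ->
  reduced (u ++ v) = reduced u && reduced v && noncancel (last x0 u) (head x0 v).
Proof.
case: u => // x u _; case: v => // y v _.
by rewrite /reduced /= cat_path /= -andbA; congr (_ && _); rewrite andbC.
Qed.

(** Inverting the first part turns the absence of cancellation at the cut into the condition that
    two first letters differ: this is where the multipartite structure comes from. *)
Lemma pair_tsum (U : lmodType R) a b (G : word n -> word n -> U) : (0 < a)%N -> (0 < b)%N ->
  tsum (a + b) (fun z => (reduced z)%:R *: G (winv (take a z)) (drop a z)) =
  tsum a (fun u => tsum b (fun v =>
    (reduced u && reduced v && (head x0 u != head x0 v))%:R *: G u v)).
Proof.
move=> a0 b0; rewrite tsum_cat -[RHS]tsum_winv.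
apply: eq_tsum => u ua; apply: eq_tsum => v vb; rewrite take_size_cat // drop_size_cat //.
rewrite reduced_cat ?size_winv ?ua ?vb // reduced_winv.
case: u ua => [|x u] ua; first by rewrite -ua in a0.
case: v vb => [|y v] vb; first by rewrite -vb in b0.
have -> : head x0 (winv (x :: u)) = linv (last x u).
  by rewrite /winv lastI map_rcons rev_rcons.
by rewrite /= /noncancel (inv_eq (@linvK n)).
Qed.

Lemma tsum_head_neq a x : (0 < a)%N ->
  tsum a (fun u => (reduced u && (x != head x0 u))%:R) = Q ^+ a :> R.
Proof.
move=> a0; rewrite -(tsum_path R n0 a (linv x)); apply: eq_tsum => u ua.
case: u ua => [|y u] ua; first by rewrite -ua in a0.
by rewrite /= andbC /noncancel (inj_eq (can_inj (@linvK n))).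
Qed.

Lemma tsum_head_eq a x : (0 < a)%N ->
  tsum a (fun u => (reduced u && (head x0 u == x))%:R) = Q ^+ a.-1 :> R.
Proof.
case: a => // a _; rewrite tsumS (bigD1 x) //= big1 ?addr0 => [|y /negPf yx].
  rewrite -(tsum_path R n0 a x); apply: eq_tsum => u _.
  by rewrite eqxx andbT.
apply: big1 => t _; by rewrite yx andbF.
Qed.

Lemma pair_marginal_l a b (g : word n -> R) : (0 < a)%N -> (0 < b)%N ->
  tsum a (fun u => tsum b (fun v =>
    (reduced u && reduced v && (head x0 u != head x0 v))%:R * g u)) =
  Q ^+ b * tsum a (fun u => (reduced u)%:R * g u).
Proof.
move=> a0 b0; rewrite -tsumZ; apply: eq_tsum => u _.
rewrite -(tsum_head_neq (head x0 u) b0) mulrC -tsumZ; apply: eq_tsum => v _.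
by rewrite -andbA -mulnb natrM; ring.
Qed.

Lemma pair_marginal_r a b (g : word n -> R) : (0 < a)%N -> (0 < b)%N ->
  tsum a (fun u => tsum b (fun v =>
    (reduced u && reduced v && (head x0 u != head x0 v))%:R * g v)) =
  Q ^+ a * tsum b (fun v => (reduced v)%:R * g v).
Proof.
move=> a0 b0; rewrite exchange_tsum -(pair_marginal_l _ b0 a0).
apply: eq_tsum => v _; apply: eq_tsum => u _.
by rewrite eq_sym (andbC (reduced u)).
Qed.

End PairSums.

(** * The link of the deterministic model *)

(** Algebra of [base_inequality] on atoms. [al] and [be] count words with a given first letter, so
    [m * al] and [m * be] count all words; [ff], [fg], [gg] pair the total sums of [f] and [g], [P]
    pairs the parts with a common first letter, [SA] and [SB] are the sums of squares. *)
Lemma base_inequality_scalar (R : realFieldType) (m Q al be SA SB P ff fg gg : R) :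
  0 < m -> 0 < Q -> m = Q + 1 -> 0 < al -> 0 < be ->
  be ^+ 2 * ff + 2 * (be * (al * fg)) + al ^+ 2 * gg <=
    m * (be ^+ 2 * (al * SA) + 2 * al * be * P + al ^+ 2 * (be * SB)) ->
  2 * ((m * Q * (al * be))^-1 * (fg - P)) <=
  2 * ((m * al)^-1 * ((m * be)^-1 * fg)) + Q^-1 * ((m * al)^-1 * SA + (m * be)^-1 * SB
    - (m * al)^-1 ^+ 2 * ff - (m * be)^-1 ^+ 2 * gg).
Proof.
move=> m0 Q0 mE al0 be0 key.
have -> : 2 * ((m * Q * (al * be))^-1 * (fg - P)) =
  2 * ((m * al)^-1 * ((m * be)^-1 * fg)) +
  (2 * al * be * fg - m * (2 * al * be * P)) / (m ^+ 2 * Q * al ^+ 2 * be ^+ 2).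
  have QE : Q = m - 1 by rewrite mE addrK.
  have Qn0 : m - 1 != 0 by rewrite -QE gt_eqF.
  by rewrite QE; field; rewrite Qn0 !gt_eqF.
rewrite lerD2l.
have -> : Q^-1 * ((m * al)^-1 * SA + (m * be)^-1 * SB
    - (m * al)^-1 ^+ 2 * ff - (m * be)^-1 ^+ 2 * gg) =
   (m * (be ^+ 2 * (al * SA) + al ^+ 2 * (be * SB)) - be ^+ 2 * ff - al ^+ 2 * gg)
    / (m ^+ 2 * Q * al ^+ 2 * be ^+ 2).
  by field; rewrite !gt_eqF.
have D0 : 0 < m ^+ 2 * Q * al ^+ 2 * be ^+ 2 by rewrite !mulr_gt0 ?exprn_gt0.
by rewrite ler_pM2r ?invr_gt0 //; lra.
Qed.

Section BaseInequality.
Variables (R : realFieldType) (n : nat) (E : lmodType R) (B : E -> E -> R).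
Hypotheses (n0 : (0 < n)%N) (HB : psd_form B).
Notation L := (letter n).
Local Notation m := ((2 * n)%:R : R).
Local Notation Q := ((2 * n - 1)%:R : R).
Implicit Types f g : word n -> E.

Definition avg_vec f a : E :=
  (nred R n a)^-1 *: tsum a (fun w => (reduced w)%:R *: f w).
Definition avg_real (F : word n -> R) a : R :=
  (nred R n a)^-1 * tsum a (fun w => (reduced w)%:R * F w).
Definition avg_sq f a : R := avg_real (fun w => B (f w) (f w)) a.

Lemma psd_tsuml a (F : word n -> E) y : B (tsum a F) y = tsum a (fun w => B (F w) y).
Proof. exact: psd_suml. Qed.

Lemma psd_tsumr a (F : word n -> E) y : B y (tsum a F) = tsum a (fun w => B y (F w)).
Proof. exact: psd_sumr. Qed.

Lemma avg_sq_ge0 f b : 0 <= avg_sq f b.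
Proof.
rewrite mulr_ge0 ?invr_ge0 ?(ltW (nred_gt0 R n0 _)) // tsum_ge0 // => z _.
by rewrite mulr_ge0 ?(psd_ge0 HB).
Qed.

Lemma avg_vec_sq_le f b : (0 < b)%N -> B (avg_vec f b) (avg_vec f b) <= avg_sq f b.
Proof.
move=> b0; rewrite /avg_vec (psd_sqZ HB) /avg_sq /avg_real expr2 -mulrA.
rewrite ler_pM2l ?invr_gt0 ?nred_gt0 // ler_pdivrMl ?nred_gt0 //.
rewrite -(tsum_reduced R n0 b0); apply: le_trans (psd_sq_suml1 HB _ _ _) _.
rewrite le_eqVlt; apply/orP; left; apply/eqP.
by congr (_ * _); apply: eq_bigr => t _; rewrite normr_nat.
Qed.

Variable x0 : L.

Lemma sum_head_split f a : (0 < a)%N ->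
  tsum a (fun w => (reduced w)%:R *: f w) =
  \sum_x tsum a (fun w => (reduced w && (head x0 w == x))%:R *: f w).
Proof.
move=> a0; rewrite -tsum_sum; apply: eq_tsum => w _.
rewrite (bigD1 (head x0 w)) //= eqxx andbT big1 ?addr0 // => x.
by rewrite eq_sym => /negPf ->; rewrite andbF scale0r.
Qed.

Lemma pair_split f g a b : (0 < a)%N -> (0 < b)%N ->
  tsum (a + b) (fun z => (reduced z)%:R * B (f (winv (take a z))) (g (drop a z))) =
  B (tsum a (fun w => (reduced w)%:R *: f w)) (tsum b (fun w => (reduced w)%:R *: g w))
  - \sum_x B (tsum a (fun w => (reduced w && (head x0 w == x))%:R *: f w))
             (tsum b (fun w => (reduced w && (head x0 w == x))%:R *: g w)).
Proof.
move=> a0 b0.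
have := @pair_tsum R n x0 R^o a b (fun u v => B (f u) (g v)) a0 b0.
rewrite /GRing.scale /= => ->.
have -> : \sum_x B (tsum a (fun w => (reduced w && (head x0 w == x))%:R *: f w))
             (tsum b (fun w => (reduced w && (head x0 w == x))%:R *: g w)) =
  tsum a (fun u => tsum b (fun v => \sum_x
    (reduced u && (head x0 u == x))%:R * ((reduced v && (head x0 v == x))%:R * B (f u) (g v)))).
  under eq_bigr => x _ do rewrite psd_tsuml.
  rewrite -tsum_sum; apply: eq_tsum => u _.
  under eq_bigr => x _ do rewrite psd_tsumr.
  rewrite -tsum_sum; apply: eq_tsum => v _; apply: eq_bigr => x _.
  by rewrite (psdZl HB) (psdZr HB).
rewrite psd_tsuml /tsum -sumrB; apply: eq_bigr => u _.
rewrite (psd_sumr HB) -sumrB; apply: eq_bigr => v _.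
rewrite (psdZl HB) (psdZr HB) (bigD1 (head x0 u)) //= eqxx andbT big1 => [|x]; last first.
  by rewrite eq_sym => /negPf ->; rewrite andbF mul0r.
rewrite addr0 (eq_sym (head x0 v)).
by case: (reduced u); case: (reduced v); case: (head x0 u == head x0 v);
  rewrite /= ?mul1r ?mul0r ?subr0 ?subrr.
Qed.

Lemma sum_head_sq f a : (0 < a)%N ->
  \sum_x B (tsum a (fun w => (reduced w && (head x0 w == x))%:R *: f w))
           (tsum a (fun w => (reduced w && (head x0 w == x))%:R *: f w))
  <= Q ^+ a.-1 * tsum a (fun w => (reduced w)%:R * B (f w) (f w)).
Proof.
move=> a0.
have -> : tsum a (fun w => (reduced w)%:R * B (f w) (f w)) =
   \sum_x tsum a (fun w => (reduced w && (head x0 w == x))%:R * B (f w) (f w)).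
  rewrite -tsum_sum; apply: eq_tsum => w _.
  rewrite (bigD1 (head x0 w)) //= eqxx andbT big1 ?addr0 // => x.
  by rewrite eq_sym => /negPf ->; rewrite andbF mul0r.
rewrite mulr_sumr; apply: ler_sum => x _.
apply: le_trans (psd_sq_suml1 HB _ _ _) _.
rewrite -(tsum_head_eq R n0 x0 x a0) /tsum le_eqVlt; apply/orP; left; apply/eqP.
by congr (_ * _); apply: eq_bigr => w _; rewrite normr_nat.
Qed.

(* The link of the base model is a complete multipartite graph on the [m] first
   letters; its nontrivial eigenvalues are [0] and [-1/Q]. *)
Lemma base_inequality f g a b : (0 < a)%N -> (0 < b)%N ->
  2 * avg_real (fun z => B (f (winv (take a z))) (g (drop a z))) (a + b) <=
  2 * B (avg_vec f a) (avg_vec g b) + Q^-1 * (avg_sq f a + avg_sq g b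
   - B (avg_vec f a) (avg_vec f a) - B (avg_vec g b) (avg_vec g b)).
Proof.
move=> a0 b0.
pose F x := tsum a (fun w => (reduced w && (head x0 w == x))%:R *: f w).
pose G x := tsum b (fun w => (reduced w && (head x0 w == x))%:R *: g w).
have m0 := m_gt0 R n0; have Q0 := Q_gt0 R n0; have mE := mQ R n0.
have ha0 : 0 < Q ^+ a.-1 by rewrite exprn_gt0.
have hb0 : 0 < Q ^+ b.-1 by rewrite exprn_gt0.
have WE : nred R n (a + b) = m * Q * (Q ^+ a.-1 * Q ^+ b.-1).
  by rewrite /nred -!mulrA -exprD -exprS; congr (_ * _ ^+ _); lia.
rewrite {1}/avg_real pair_split // -/(F _) -/(G _).
have FE : tsum a (fun w => (reduced w)%:R *: f w) = \sum_x F x by exact: sum_head_split.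
have GE : tsum b (fun w => (reduced w)%:R *: g w) = \sum_x G x by exact: sum_head_split.
have hF := sum_head_sq f a0; have hG := sum_head_sq g b0.
rewrite -/(F _) in hF; rewrite -/(G _) in hG.
set SA := tsum a _ in hF; set SB := tsum b _ in hG.
rewrite /avg_vec /avg_sq /avg_real -/SA -/SB FE GE.
set fs := \sum_x F x; set gs := \sum_x G x.
set P := \sum_x B (F x) (G x).
set al := Q ^+ a.-1 in ha0 hF WE *; set be := Q ^+ b.-1 in hb0 hG WE *.
(* Cauchy-Schwarz over the [m] first letters. Expanded, it bounds [P] from below, as required
   because [pair_split] subtracts [P]; the weights compensate the different class sizes. *)
have key : B (be *: fs + al *: gs) (be *: fs + al *: gs) <=
   m * (be ^+ 2 * (al * SA) + 2 * al * be * P + al ^+ 2 * (be * SB)).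
  have := psd_sq_sum HB predT (fun x => be *: F x + al *: G x).
  rewrite big_split -!scaler_sumr -/fs -/gs card_letter.
  move/le_trans; apply; rewrite ler_pM2l //.
  under eq_bigr => x _ do rewrite (psd_sqD HB) !(psd_sqZ HB) (psdZl HB) (psdZr HB).
  rewrite !big_split /= -!mulr_sumr -/P.
  have := ler_wpM2l (sqr_ge0 be) hF; have := ler_wpM2l (sqr_ge0 al) hG; lra.
rewrite (psd_sqD HB) !(psd_sqZ HB) !(psdZl HB) !(psdZr HB) in key *.
rewrite WE /nred -/al -/be; exact: base_inequality_scalar.
Qed.

End BaseInequality.

(** * Links of random relators *)

Section Link.
Variables (R : realFieldType) (n : nat).
Variables (p q s : nat).
Notation l := (p + q + s)%N.
Notation Om := (cr_word n l).

Definition window (sb : nat * nat) (w : word n) : word n := take sb.2 (rot sb.1 w).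

Definition windows : seq (nat * nat) := [:: (0, p); (p, q); (p + q, s)]%N.

Definition edges (w : word n) : seq (word n * word n) :=
  [:: (winv (window (0, p)%N w), window (p, q) w);
      (winv (window (p, q) w), window (p + q, s)%N w);
      (winv (window (p + q, s)%N w), window (0, p)%N w)].

Lemma windows_cat (u v w : word n) : size u = p -> size v = q -> size w = s ->
  [/\ window (0, p)%N (u ++ v ++ w) = u, window (p, q) (u ++ v ++ w) = v &
      window (p + q, s)%N (u ++ v ++ w) = w] /\
  [/\ window (0, p + q)%N (u ++ v ++ w) = u ++ v,
      window (p, q + s)%N (u ++ v ++ w) = v ++ w &
      window (p + q, s + p)%N (u ++ v ++ w) = w ++ u].
Proof.
move=> up vq ws; rewrite /window /=.
have r0 : rot 0 (u ++ v ++ w) = (u ++ v) ++ w by rewrite rot0 catA.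
have r1 : rot p (u ++ v ++ w) = (v ++ w) ++ u by rewrite -up rot_size_cat.
have r2 : rot (p + q) (u ++ v ++ w) = (w ++ u) ++ v.
  by rewrite catA -up -vq -size_cat rot_size_cat catA.
by rewrite r0 r1 r2; split; split; rewrite -?catA ?(take_size_cat _ up)
  ?(take_size_cat _ vq) ?(take_size_cat _ ws) // catA take_size_cat // size_cat ?up ?vq ?ws.
Qed.

Lemma split3 (w : word n) : size w = l ->
  exists u v t, [/\ w = u ++ v ++ t, size u = p, size v = q & size t = s].
Proof.
move=> wl; exists (take p w), (take q (drop p w)), (drop q (drop p w)).
rewrite !cat_take_drop size_take_min size_take_min !size_drop wl.
by split=> //; lia.
Qed.

(** The vertices are words, each enumerated once, and not a disjoint union of three classes: the
    lengths [p], [q], [s] may coincide. *)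
Variables (V : finType) (vw : V -> word n).
Hypotheses (vw_inj : injective vw)
  (vwP : forall x, reduced (vw x) && (size (vw x) \in [:: p; q; s]))
  (vw_onto : forall w, reduced w -> size w \in [:: p; q; s] -> exists x, vw x = w).

Definition link_kernel (w : word n) (x y : V) : R :=
  \sum_(e <- edges w) (((vw x == e.1) && (vw y == e.2))%:R +
                       ((vw x == e.2) && (vw y == e.1))%:R).

Lemma link_kernel_ge0 w x y : 0 <= link_kernel w x y.
Proof. by apply: sumr_ge0 => e _; rewrite addr_ge0. Qed.

Lemma link_kernel_sym w x y : link_kernel w x y = link_kernel w y x.
Proof.
by apply: eq_bigr => e _; rewrite addrC; congr (_%:R + _%:R); rewrite andbC.
Qed.

Definition incidence (w z : word n) : R :=
  \sum_(sb <- windows) ((window sb w == z)%:R + (window sb w == winv z)%:R).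

Lemma sum_vw_le1 (z : word n) : \sum_y (vw y == z)%:R <= 1 :> R.
Proof.
case: (pickP (fun y => vw y == z)) => [y0 /eqP <-|nz]; last first.
  by rewrite big1 // => y _; rewrite nz.
rewrite (bigD1 y0) //= eqxx big1 ?addr0 // => y; rewrite (inj_eq vw_inj).
by move/negPf ->.
Qed.

Lemma link_kernel_row w x : \sum_y link_kernel w x y <= incidence w (vw x).
Proof.
rewrite exchange_big /=.
apply: (@le_trans _ _ (\sum_(e <- edges w) ((vw x == e.1)%:R + (vw x == e.2)%:R))).
  apply: ler_sum => e _; rewrite big_split /=.
  have h z z' : \sum_y ((vw x == z) && (vw y == z'))%:R <= (vw x == z)%:R :> R.
    under eq_bigr => y _ do rewrite -mulnb natrM.
    by rewrite -mulr_sumr -[X in _ <= X]mulr1 ler_wpM2l // sum_vw_le1.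
  by apply: lerD; apply: h.
rewrite /incidence /edges /windows !big_cons !big_nil /=.
have e z : (vw x == winv z) = (z == winv (vw x)).
  by rewrite eq_sym (inv_eq (@winvK n)).
rewrite !e (eq_sym (vw x)) (eq_sym (vw x) (window (p + q, s)%N w)) (eq_sym (vw x) (window (0, p)%N w)).
by lra.
Qed.

(** Three windows and their inverses. This deterministic bound is the [D] of the moment computation,
    where [mean_row] provides [rho]. *)
Lemma link_kernel_row6 w x : \sum_y link_kernel w x y <= 6.
Proof.
apply: le_trans (link_kernel_row w x) _.
rewrite /incidence /windows !big_cons !big_nil /=.
have h (b : bool) : b%:R <= 1 :> R by case: b.
have := (h (window (0, p)%N w == vw x), h (window (0, p)%N w == winv (vw x)),
   h (window (p, q)%N w == vw x), h (window (p, q)%N w == winv (vw x)),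
   h (window (p + q, s)%N w == vw x), h (window (p + q, s)%N w == winv (vw x))).
move=> [[[[[]]]]]; lra.
Qed.

Lemma sum_vw (U : lmodType R) (F : word n -> U) (z : word n) :
  reduced z -> size z \in [:: p; q; s] -> \sum_x (vw x == z)%:R *: F (vw x) = F z.
Proof.
move=> rz sz; have [x0 <-] := vw_onto rz sz.
rewrite (bigD1 x0) //= eqxx scale1r big1 ?addr0 // => y; rewrite (inj_eq vw_inj).
by move/negPf ->; rewrite scale0r.
Qed.

(** Only an inequality: if two lengths coincide, the right side counts the same words twice. *)
Lemma sum_V_le (F : word n -> R) : (forall z, 0 <= F z) ->
  \sum_x F (vw x) <= tsum p (fun w => (reduced w)%:R * F w)
    + tsum q (fun w => (reduced w)%:R * F w) + tsum s (fun w => (reduced w)%:R * F w).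
Proof.
move=> F0.
have inc a : \sum_(x | size (vw x) == a) F (vw x) <= tsum a (fun w => (reduced w)%:R * F w).
  apply: (@le_trans _ _ (\sum_x tsum a (fun w => (vw x == w)%:R * ((reduced w)%:R * F w)))).
    rewrite big_mkcond; apply: ler_sum => x _; case: ifP => [sx|_]; last first.
      by apply: tsum_ge0 => w _; rewrite !mulr_ge0.
    rewrite /tsum (bigD1 (Tuple sx)) //= eqxx mul1r.
    have /andP[-> _] := vwP x; rewrite mul1r lerDl sumr_ge0 // => t _.
    by rewrite !mulr_ge0.
  rewrite -tsum_sum; apply: le_tsum => w _; rewrite -mulr_suml.
  have wF : 0 <= (reduced w)%:R * F w by rewrite mulr_ge0.
  rewrite -[X in _ <= X]mul1r ler_wpM2r //.
  exact: sum_vw_le1.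
apply: le_trans (lerD (lerD (inc p) (inc q)) (inc s)).
rewrite [X in _ <= X + _ + _]big_mkcond [X in _ <= _ + X + _]big_mkcond.
rewrite [X in _ <= _ + _ + X]big_mkcond -!big_split /=; apply: ler_sum => x _.
have /andP[_] := vwP x; rewrite !inE => /or3P[]/eqP ->; rewrite eqxx;
  do 2![case: ifP => _]; rewrite ?addr0 ?add0r ?lerDl ?lerDr ?addr_ge0 //.
Qed.

Section Form.
Variables (E : lmodType R) (B : E -> E -> R).
Hypothesis HB : psd_form B.
Variable f : word n -> E.
Let g : {ffun V -> E} := [ffun x => f (vw x)].

Lemma fdot_kact (X : V -> V -> R) :
  fdot B g (kact X g) = \sum_x \sum_y X x y * B (g x) (g y).
Proof.
apply: eq_bigr => x _; rewrite [kact _ _ _]ffunE (psd_sumr HB); apply: eq_bigr => y _.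
by rewrite (psdZr HB).
Qed.

Definition edge_form (w : word n) : R := \sum_(e <- edges w) 2 * B (f e.1) (f e.2).

Lemma link_kernel_form w : (forall e, e \in edges w ->
    [&& reduced e.1, size e.1 \in [:: p; q; s], reduced e.2 & size e.2 \in [:: p; q; s]]) ->
  fdot B g (kact (link_kernel w) g) = edge_form w.
Proof.
move=> hw; rewrite fdot_kact /link_kernel /edge_form.
under eq_bigr => x _. under eq_bigr => y _ do rewrite mulr_suml. over.
under eq_bigr => x _ do rewrite exchange_big.
rewrite exchange_big /= big_seq [RHS]big_seq; apply: eq_bigr => e /hw /and4P[r1 s1 r2 s2].
have h z z' : reduced z -> size z \in [:: p; q; s] -> reduced z' -> size z' \in [:: p; q; s] ->
    \sum_x \sum_y ((vw x == z) && (vw y == z'))%:R * B (g x) (g y) = B (f z) (f z').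
  move=> rz sz rz' sz'; rewrite -(sum_vw f rz sz) (psd_suml HB); apply: eq_bigr => x _.
  rewrite -(sum_vw f rz' sz') (psd_sumr HB); apply: eq_bigr => y _.
  by rewrite (psdZl HB) (psdZr HB) !ffunE mulrA -natrM mulnb.
transitivity (B (f e.1) (f e.2) + B (f e.2) (f e.1)); last by rewrite (psdC HB (f e.2)); ring.
rewrite -(h _ _ r1 s1 r2 s2) -(h _ _ r2 s2 r1 s1) -big_split; apply: eq_bigr => x _.
by rewrite -big_split; apply: eq_bigr => y _; rewrite mulrDl.
Qed.

End Form.

Lemma cr_window (r : Om) sb : reduced (window sb (val r)).
Proof.
have := valP r; rewrite /= /cyclically_reduced -(rot_cycle sb.1) /window.
case: (rot sb.1 _) => [|x w]; first by case: sb.2.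
case: sb.2 => //= k; rewrite -cats1 cat_path => /andP[h _].
by move: h; rewrite -{1}(cat_take_drop k w) cat_path => /andP[].
Qed.

End Link.

(** An isometric action of the free group, given on words; triviality of the relators is a separate
    hypothesis wherever it is used. *)
Record word_rep (R : realFieldType) (n : nat) (E : lmodType R) (B : E -> E -> R)
    (pi : word n -> E -> E) : Prop := WordRep {
  wrD : forall w x y, pi w (x + y) = pi w x + pi w y;
  wrZ : forall w a x, pi w (a *: x) = a *: pi w x;
  wr_nil : forall x, pi [::] x = x;
  wr_cat : forall u v x, pi (u ++ v) x = pi u (pi v x);
  wr_inv : forall w x, pi (winv w) (pi w x) = x;
  wr_iso : forall w x y, B (pi w x) (pi w y) = B x y }.

Section WordRep.
Variables (R : realFieldType) (n : nat) (E : lmodType R) (B : E -> E -> R).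
Variables (pi : word n -> E -> E).
Hypotheses (HB : psd_form B) (Hpi : word_rep B pi).
Implicit Types (u v w : word n).

Definition displacement (x : E) w : E := pi w x - x.

Lemma wrN w x : pi w (- x) = - pi w x.
Proof. by rewrite -scaleN1r (wrZ Hpi) scaleN1r. Qed.

Lemma wrB w x y : pi w (x - y) = pi w x - pi w y.
Proof. by rewrite (wrD Hpi) wrN. Qed.

Lemma wr_invr w x : pi w (pi (winv w) x) = x.
Proof. by rewrite -{1}(winvK w) (wr_inv Hpi). Qed.

Lemma psd_opp x : B (- x) (- x) = B x x.
Proof. by rewrite (psdNl HB) (psdNr HB) opprK. Qed.

Lemma displacement_winv x w :
  B (displacement x (winv w)) (displacement x (winv w)) =
  B (displacement x w) (displacement x w).
Proof.
by rewrite -(wr_iso Hpi w) /displacement wrB wr_invr -psd_opp opprB.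
Qed.

Lemma wr_trivial_rot u v : (forall x, pi (u ++ v) x = x) -> forall x, pi (v ++ u) x = x.
Proof.
move=> uv x; rewrite -{1}(wr_invr v x) (wr_cat Hpi) -(wr_cat Hpi u).
by rewrite uv wr_invr.
Qed.

Lemma triangle_identity x u v w : (forall y, pi (u ++ v ++ w) y = y) ->
  2 * B (displacement x (winv u)) (displacement x v) =
  B (displacement x u) (displacement x u) + B (displacement x v) (displacement x v)
  - B (displacement x w) (displacement x w).
Proof.
move=> uvw.
have wuv : forall y, pi (w ++ u ++ v) y = y by apply: wr_trivial_rot; rewrite -catA.
suff h : B (displacement x w) (displacement x w) =
  B (displacement x (winv u) - displacement x v) (displacement x (winv u) - displacement x v).
  by rewrite h (psd_sqB HB (displacement x (winv u))) displacement_winv; ring.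
have -> : displacement x (winv u) - displacement x v = pi (winv u) x - pi v x.
  by rewrite /displacement opprB addrA subrK.
rewrite -[RHS](wr_iso Hpi u) -[RHS](wr_iso Hpi w) !wrB wr_invr.
by rewrite -!(wr_cat Hpi) -catA wuv.
Qed.

Variables (p q s : nat).

(** In the sum of the three triangle identities each square occurs twice with sign plus and once
    with sign minus. *)
Lemma edge_form_relator x (r : word n) : size r = (p + q + s)%N ->
  (forall y, pi r y = y) ->
  edge_form p q s B (displacement x) r =
  \sum_(sb <- windows p q s)
     B (displacement x (window sb r)) (displacement x (window sb r)).
Proof.
move=> rl rid; have [u [v [w [rE up vq ws]]]] := split3 rl.
have [[h1 h2 h3] _] := windows_cat up vq ws; rewrite -rE in h1 h2 h3.
rewrite /edge_form /edges /windows !big_cons !big_nil h1 h2 h3 !addr0 /=.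
rewrite rE in rid.
have rid2 : forall y, pi (v ++ w ++ u) y = y.
  by move=> y; rewrite catA; apply: wr_trivial_rot rid y.
have rid3 : forall y, pi (w ++ u ++ v) y = y.
  by move=> y; rewrite catA; apply: wr_trivial_rot rid2 y.
rewrite (triangle_identity x rid) (triangle_identity x rid2) (triangle_identity x rid3).
ring.
Qed.

End WordRep.

Section MeanEdgeForm.
Variables (R : realFieldType) (n : nat) (E : lmodType R) (B : E -> E -> R).
Hypotheses (n0 : (0 < n)%N) (HB : psd_form B).
Local Notation m := ((2 * n)%:R : R).
Local Notation Q := ((2 * n - 1)%:R : R).
Variable f : word n -> E.

Let G a z := B (f (winv (take a z))) (f (drop a z)).

Let scale_inv (x y t : R) : 0 < y -> x^-1 * t = (x * y)^-1 * (y * t).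
Proof. by move=> y0; rewrite invfM -mulrA mulKf ?gt_eqF. Qed.

(** Both parts of a uniform reduced word of length [a + b] are uniform, so [psd_amgm] on each pair
    averages to the two means. *)
Lemma avg_real_pair_le a b : (0 < a)%N -> (0 < b)%N ->
  2 * avg_real (fun z => `|G a z|) (a + b) <= avg_sq B f a + avg_sq B f b.
Proof.
move=> a0 b0; have x0 : letter n := (Ordinal n0, false).
have W0 := nred_gt0 R n0 (a + b).
have Q0 := Q_gt0 R n0; have m0 := m_gt0 R n0.
have WE1 : nred R n (a + b) = nred R n a * Q ^+ b.
  by rewrite /nred -mulrA -exprD; congr (_ * _ ^+ _); lia.
have WE2 : nred R n (a + b) = nred R n b * Q ^+ a.
  by rewrite /nred -mulrA -exprD; congr (_ * _ ^+ _); lia.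
have -> : avg_sq B f a = (nred R n (a + b))^-1 *
    tsum (a + b) (fun z => (reduced z)%:R * B (f (winv (take a z))) (f (winv (take a z)))).
  have := @pair_tsum R n x0 R^o a b (fun u v => B (f u) (f u)) a0 b0.
  rewrite /GRing.scale /= => ->.
  rewrite (pair_marginal_l n0 x0 (fun u => B (f u) (f u)) a0 b0) WE1 /avg_sq /avg_real.
  exact/scale_inv/exprn_gt0.
have -> : avg_sq B f b = (nred R n (a + b))^-1 *
    tsum (a + b) (fun z => (reduced z)%:R * B (f (drop a z)) (f (drop a z))).
  have := @pair_tsum R n x0 R^o a b (fun u v => B (f v) (f v)) a0 b0.
  rewrite /GRing.scale /= => ->.
  rewrite (pair_marginal_r n0 x0 (fun u => B (f u) (f u)) a0 b0) WE2 /avg_sq /avg_real.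
  exact/scale_inv/exprn_gt0.
rewrite /avg_real -mulrDr mulrCA ler_pM2l ?invr_gt0 //.
rewrite -tsumZ -tsumD; apply: le_tsum => z _; rewrite -mulrDr mulrCA.
by apply: ler_wpM2l => //; apply: psd_amgm HB _ _.
Qed.

Section Expect.
Variables (l st a b c : nat) (dl : R).
Hypotheses (a0 : (0 < a)%N) (b0 : (0 < b)%N) (lE : l = (a + b + c)%N).
Hypotheses (dl1 : 0 < dl <= 1) (hc : 4 * m <= dl * Q ^+ c.+1).

Lemma expect_pair_le :
  2 * expect (fun r : cr_word n l => G a (take (a + b) (rot st (val r)))) <=
  2 * B (avg_vec f a) (avg_vec f b) + Q^-1 * (avg_sq B f a + avg_sq B f b
   - B (avg_vec f a) (avg_vec f a) - B (avg_vec f b) (avg_vec f b))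
  + dl * (avg_sq B f a + avg_sq B f b).
Proof.
have x0 : letter n := (Ordinal n0, false).
have h1 := base_inequality n0 HB x0 f f a0 b0.
have h2 := avg_real_pair_le a0 b0.
have ab0 : (0 < a + b)%N by lia.
have := window_expect n0 lE ab0 dl1 hc st (G a).
rewrite -/(avg_real _ _) -/(avg_real _ _) ler_norml => /andP[_ h3].
have /andP[d0 _] := dl1; have := ler_wpM2l (ltW d0) h2.
rewrite /G in h1 h3 *; lra.
Qed.

End Expect.

End MeanEdgeForm.

(* [dl] is the relative error allowed in every comparison with the mean model; the
   last step needs [2 / Q + 3 * dl < (1 - dl) ^+ 2] with [3 <= Q]. *)
Section SpectralGap.
Variables (R : realFieldType) (n p q s : nat).
Hypotheses (n2 : (1 < n)%N) (p0 : (0 < p)%N) (q0 : (0 < q)%N) (s0 : (0 < s)%N).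
Local Notation m := ((2 * n)%:R : R).
Local Notation Q := ((2 * n - 1)%:R : R).
Notation l := (p + q + s)%N.
Notation Om := (cr_word n l).
Local Notation dl := (50%:R^-1 : R).

Variables (V : finType) (vw : V -> word n).
Hypotheses (vw_inj : injective vw)
  (vwP : forall x, reduced (vw x) && (size (vw x) \in [:: p; q; s]))
  (vw_onto : forall w, reduced w -> size w \in [:: p; q; s] -> exists x, vw x = w).

(** [Lm] bounds the number of reduced words of each of the three lengths, [kp] the uniform
    probability of a single one. *)
Variables (Lm kp : R).
Hypothesis nredP : forall b, b \in [:: p; q; s] ->
  [/\ nred R n b <= Lm, (nred R n b)^-1 <= kp & 4 * m <= dl * Q ^+ b.+1].

Let M (r : Om) := link_kernel R p q s vw (val r).

Definition window_prob sb z : R := prob R (fun r : Om => window sb (val r) == z).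

Let n0 : (0 < n)%N := ltnW n2.

Let dl01 : 0 < dl <= 1. Proof. by apply/andP; split; lra. Qed.

(** The rest of the relator outside a window contains another window, hence is long enough for
    equidistribution. *)
Lemma windowsP sb : sb \in windows p q s ->
  sb.2 \in [:: p; q; s] /\
  exists c, [/\ l = (sb.2 + c)%N, (0 < sb.2)%N & 4 * m <= dl * Q ^+ c.+1].
Proof.
have mono b c : b \in [:: p; q; s] -> (b <= c)%N -> 4 * m <= dl * Q ^+ c.+1.
  move=> /nredP[_ _ /le_trans h] bc; apply: h; rewrite ler_wpM2l ?invr_ge0 //.
  by rewrite ler_weXn2l ?Q_ge1.
rewrite !inE => /or3P[]/eqP -> /=; rewrite !eqxx ?orbT; split=> //.
- exists (q + s)%N; split; rewrite ?addnA //.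
  by apply: (mono s); rewrite ?inE ?eqxx ?orbT // leq_addl.
- exists (p + s)%N; split; [lia|by []|].
  by apply: (mono s); rewrite ?inE ?eqxx ?orbT // leq_addl.
- exists (p + q)%N; split; [lia|by []|].
  by apply: (mono q); rewrite ?inE ?eqxx ?orbT // leq_addl.
Qed.

Lemma window_avg sb (F : word n -> R) : sb \in windows p q s ->
  `|expect (fun r : Om => F (window sb (val r))) - avg_real F sb.2|
    <= dl * avg_real (fun z => `|F z|) sb.2.
Proof.
move=> /windowsP[_ [c [lE b0 hc]]].
exact: (window_expect n0 lE b0 dl01 hc sb.1 F).
Qed.

Lemma window_prob_le sb z : sb \in windows p q s -> window_prob sb z <= (1 + dl) * kp.
Proof.
move=> sbw; have [sb2 _] := windowsP sbw; have [_ hk _] := nredP sb2.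
have := window_avg (fun w => (w == z)%:R) sbw; rewrite ler_norml => /andP[_].
have -> : avg_real (fun w => `|(w == z)%:R|) sb.2 = avg_real (fun w => (w == z)%:R : R) sb.2.
  by congr (_ * _); apply: eq_tsum => w _; rewrite normr_nat.
have : avg_real (fun w => (w == z)%:R : R) sb.2 <= kp.
  apply: le_trans hk; rewrite /avg_real -[X in _ <= X]mulr1 ler_pM2l ?invr_gt0 ?nred_gt0 //.
  case: (eqVneq (size z) sb.2) => [/eqP sz|sz].
    rewrite /tsum (bigD1 (Tuple sz)) //= big1 ?addr0 => [|t tz].
      by rewrite -natrM mulnb; case: (_ && _).
    by rewrite -val_eqE /= in tz; rewrite (negPf tz) mulr0.
  rewrite /tsum big1 // => t _; case: eqP => [tz|_]; last by rewrite mulr0.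
  by move: sz; rewrite -tz size_tuple eqxx.
have d0 : (0 : R) < dl by rewrite invr_gt0.
rewrite /window_prob /prob => h1 h2; have := ler_wpM2l (ltW d0) h1; lra.
Qed.

Let V_winv x : exists y, vw y = winv (vw x).
Proof.
have /andP[rx sx] := vwP x; apply: vw_onto; first by rewrite reduced_winv.
by rewrite size_winv.
Qed.

Let kp0 : 0 <= kp.
Proof.
have pin : p \in [:: p; q; s] by rewrite inE eqxx.
have [_ h _] := nredP pin; apply: le_trans h.
by rewrite invr_ge0 ltW // nred_gt0.
Qed.

Lemma expect_incidence z : expect (fun r : Om => incidence R p q s (val r) z) <= 12 * kp.
Proof.
rewrite /incidence expect_sum.
apply: (@le_trans _ _ (\sum_(sb <- windows p q s) 4 * kp)).
  rewrite big_seq [X in _ <= X]big_seq; apply: ler_sum => sb sbw; rewrite expectD.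
  have h1 := window_prob_le z sbw; have h2 := window_prob_le (winv z) sbw.
  by apply: le_trans (lerD h1 h2) _; have := kp0; lra.
by rewrite /windows !big_cons big_nil; lra.
Qed.

Lemma mean_row y : expect (fun r => \sum_x M r x y) <= 12 * kp.
Proof.
apply: le_trans (expect_incidence (vw y)); apply: le_expect => r.
under eq_bigr => x _ do rewrite /M link_kernel_sym.
exact: link_kernel_row.
Qed.

Variables (I : finType) (J N : nat) (Bt : 'I_J -> {set I}).
Hypotheses (J0 : (0 < J)%N) (N0 : (0 < N)%N).

Definition concentrated (w : {ffun I -> Om}) : Prop :=
  forall sb, sb \in windows p q s -> forall j z,
    `|\sum_(t in Bt j) (window sb (val (w t)) == vw z)%:R - N%:R * window_prob sb (vw z)|
      <= dl * (N%:R * window_prob sb (vw z)).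

Section Good.
Variable w : {ffun I -> Om}.
Hypothesis conc : concentrated w.

Let N0' : (0 : R) < N%:R. Proof. by rewrite ltr0n. Qed.

Lemma count_le sb j x : sb \in windows p q s ->
  N%:R^-1 * \sum_(t in Bt j) (window sb (val (w t)) == vw x)%:R <= 2 * kp.
Proof.
move=> sbw; rewrite ler_pdivrMl //.
have := conc sbw j x; rewrite ler_norml => /andP[_].
have := window_prob_le (vw x) sbw; set c := \sum_(t in _) _.
move=> h1 h2; have h3 := ler_wpM2l (ltW N0') h1.
have d0 : (0 : R) < dl by rewrite invr_gt0.
have h4 := mulr_ge0 (ltW N0') kp0.
lra.
Qed.

(** Three windows, two orientations, and a frequency of at most [2 * kp] each. The inverse of a
    vertex is a vertex, so concentration applies to both orientations. *)
Lemma batch_row j x : \sum_y batch_kernel M N Bt w j x y <= 12 * kp.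
Proof.
rewrite /batch_kernel -mulr_sumr exchange_big /=.
apply: (@le_trans _ _ (N%:R^-1 * \sum_(t in Bt j) incidence R p q s (val (w t)) (vw x))).
  by rewrite ler_pM2l ?invr_gt0 //; apply: ler_sum => t _; apply: link_kernel_row.
rewrite /incidence exchange_big /= mulr_sumr.
apply: (@le_trans _ _ (\sum_(sb <- windows p q s) 4 * kp)).
  rewrite big_seq [X in _ <= X]big_seq; apply: ler_sum => sb sbw.
  rewrite big_split mulrDr /=; have [y <-] := V_winv x.
  have := (count_le j x sbw, count_le j y sbw) => -[]; lra.
by rewrite /windows !big_cons big_nil; lra.
Qed.

Lemma centered_row j x : \sum_y `|centered_batch M N Bt w j x y| <= 24 * kp.
Proof.
apply: (@le_trans _ _ (\sum_y (batch_kernel M N Bt w j x y + mean_kernel M x y))).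
  apply: ler_sum => y _; apply: le_trans (ler_normB _ _) _.
  rewrite !ger0_norm //.
    by apply: expect_ge0 => r; apply: link_kernel_ge0.
  by rewrite mulr_ge0 ?invr_ge0 // sumr_ge0 // => t _; apply: link_kernel_ge0.
rewrite big_split /= -expect_sum.
have := batch_row j x.
have : expect (fun r => \sum_y M r x y) <= 12 * kp.
  apply: le_trans (mean_row x); apply: le_expect => r.
  by apply: ler_sum => y _; rewrite /M link_kernel_sym.
lra.
Qed.

Lemma centered_sym j x y : centered_batch M N Bt w j x y = centered_batch M N Bt w j y x.
Proof.
rewrite /centered_batch /batch_kernel /mean_kernel; congr (_ * _ - _ * _).
  by apply: eq_bigr => t _; apply: link_kernel_sym.
by apply: eq_bigr => t _; apply: link_kernel_sym.
Qed.

Variables (E : lmodType R) (B : E -> E -> R) (pi : word n -> E -> E).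
Hypotheses (HB : psd_form B) (Hpi : word_rep B pi).

Definition energy x : R :=
  avg_sq B (displacement pi x) p + avg_sq B (displacement pi x) q
  + avg_sq B (displacement pi x) s.

Definition drift x : E :=
  avg_vec (displacement pi x) p + avg_vec (displacement pi x) q
  + avg_vec (displacement pi x) s.

Section Vector.
Variable x : E.
Let f := displacement pi x.
Let g : {ffun V -> E} := [ffun z => f (vw z)].
Let sq z := B (f z) (f z).

(** One factor [1 - dl] pays for replacing the batch by its expectation, the other for replacing the
    law of the window by the uniform law. *)
Lemma batch_sq_ge j sb : sb \in windows p q s ->
  (1 - dl) ^+ 2 * avg_sq B f sb.2 <=
  N%:R^-1 * \sum_(t in Bt j) sq (window sb (val (w t))).
Proof.
move=> sbw; have [sb2 [c [lE b0 hc]]] := windowsP sbw.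
have swin (r : Om) : size (window sb (val r)) = sb.2.
  by rewrite /window size_takel // size_rot size_tuple lE leq_addr.
have E1 (r : Om) : sq (window sb (val r)) = \sum_z (vw z == window sb (val r))%:R * sq (vw z).
  have := @sum_vw R n p q s V vw vw_inj vw_onto R^o sq (window sb (val r)).
  by move=> -> //; rewrite ?cr_window // swin.
have sq0 z : 0 <= sq z by apply: psd_ge0 HB _.
have h1 : (1 - dl) * avg_sq B f sb.2 <= expect (fun r : Om => sq (window sb (val r))).
  have := window_avg sq sbw; rewrite ler_norml => /andP[+ _].
  have -> : avg_real (fun z => `|sq z|) sb.2 = avg_sq B f sb.2.
    by congr (_ * _); apply: eq_tsum => z _; rewrite ger0_norm.
  rewrite -/(avg_sq B f sb.2); lra.
have h2 : (1 - dl) * expect (fun r : Om => sq (window sb (val r))) <=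
   N%:R^-1 * \sum_(t in Bt j) sq (window sb (val (w t))).
  rewrite (eq_expect E1) expect_sum.
  under [X in _ <= _ * X]eq_bigr => t _ do rewrite E1.
  rewrite exchange_big /= !mulr_sumr; apply: ler_sum => z _.
  rewrite -[X in _ <= _ * X]mulr_suml.
  have -> : expect (fun r : Om => (vw z == window sb (val r))%:R * sq (vw z)) =
      window_prob sb (vw z) * sq (vw z).
    rewrite mulrC -expectZ; apply: eq_expect => r; by rewrite mulrC eq_sym.
  have := conc sbw j z; move: (window_prob sb (vw z)) => wp.
  rewrite ler_norml => /andP[h _].
  have {}h : (1 - dl) * wp <= N%:R^-1 * \sum_(t in Bt j) (vw z == window sb (val (w t)))%:R.
    rewrite ler_pdivlMl //.
    have -> : \sum_(i in Bt j) (vw z == window sb (val (w i)))%:R =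
       \sum_(t in Bt j) (window sb (val (w t)) == vw z)%:R :> R.
      by apply: eq_bigr => t _; rewrite eq_sym.
    by move: h; set cc := \sum_(t in _) _; lra.
  by have := ler_wpM2r (sq0 (vw z)) h; rewrite -!mulrA.
have d0 : 0 <= 1 - dl by lra.
apply: le_trans h2; have := ler_wpM2l d0 h1; lra.
Qed.

Lemma edges_ok (r : Om) e : e \in edges p q s (val r) ->
  [&& reduced e.1, size e.1 \in [:: p; q; s], reduced e.2 & size e.2 \in [:: p; q; s]].
Proof.
have hw sb : sb \in windows p q s -> reduced (window sb (val r)) /\
    size (window sb (val r)) \in [:: p; q; s].
  move=> sbw; have [sb2 [c [lE b0 hc]]] := windowsP sbw; split; first exact: cr_window.
  by rewrite /window size_takel // size_rot size_tuple lE leq_addr.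
have [r1 s1] : reduced (window (0, p)%N (val r)) /\ size (window (0, p)%N (val r)) \in [:: p; q; s].
  by apply: hw; rewrite !inE eqxx.
have [r2 s2] : reduced (window (p, q)%N (val r)) /\ size (window (p, q)%N (val r)) \in [:: p; q; s].
  by apply: hw; rewrite !inE eqxx orbT.
have [r3 s3] : reduced (window (p + q, s)%N (val r)) /\ size (window (p + q, s)%N (val r)) \in [:: p; q; s].
  by apply: hw; rewrite !inE eqxx !orbT.
suff /allP/(_ e) : all (fun e => [&& reduced e.1, size e.1 \in [:: p; q; s], reduced e.2 &
   size e.2 \in [:: p; q; s]]) (edges p q s (val r)) by [].
by rewrite /edges /= !reduced_winv !size_winv r1 r2 r3 s1 s2 s3.
Qed.

Let P := mean_kernel M.
Let T := kavg (centered_batch M N Bt w).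

(** Sum of [expect_pair_le] over the three pairs of classes. The cross terms make up the square of
    [drift] minus the three squares, and each class belongs to two pairs, whence the factors 2. *)
Lemma mean_form_le : fdot B g (kact P g) <=
  B (drift x) (drift x) - (B (avg_vec f p) (avg_vec f p) + B (avg_vec f q) (avg_vec f q)
     + B (avg_vec f s) (avg_vec f s))
  + 2 * Q^-1 * (energy x - (B (avg_vec f p) (avg_vec f p) + B (avg_vec f q) (avg_vec f q)
     + B (avg_vec f s) (avg_vec f s)))
  + 2 * dl * energy x.
Proof.
have pin : p \in [:: p; q; s] by rewrite inE eqxx.
have qin : q \in [:: p; q; s] by rewrite !inE eqxx orbT.
have sin : s \in [:: p; q; s] by rewrite !inE eqxx !orbT.
have -> : fdot B g (kact P g) = expect (fun r : Om => edge_form p q s B f (val r)).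
  rewrite fdot_kact //.
  under [RHS]eq_expect => r do rewrite -(link_kernel_form vw_inj vw_onto HB f (@edges_ok r)) fdot_kact //.
  rewrite expect_sum; apply: eq_bigr => y _; rewrite expect_sum; apply: eq_bigr => z _.
  rewrite /P /mean_kernel mulrC -expectZ; apply: eq_expect => r; by rewrite mulrC.
have l1 : l = (p + q + s)%N by [].
have l2 : l = (q + s + p)%N by lia.
have l3 : l = (s + p + q)%N by lia.
have [_ _ hp] := nredP pin; have [_ _ hq] := nredP qin; have [_ _ hs] := nredP sin.
have e1 := expect_pair_le n0 HB f 0 p0 q0 l1 dl01 hs.
have e2 := expect_pair_le n0 HB f p q0 s0 l2 dl01 hp.
have e3 := expect_pair_le n0 HB f (p + q) s0 p0 l3 dl01 hq.
have -> : expect (fun r : Om => edge_form p q s B f (val r)) =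
  2 * expect (fun r : Om => B (f (winv (take p (take (p + q) (rot 0 (val r))))))
                              (f (drop p (take (p + q) (rot 0 (val r)))))) +
  2 * expect (fun r : Om => B (f (winv (take q (take (q + s) (rot p (val r))))))
                              (f (drop q (take (q + s) (rot p (val r)))))) +
  2 * expect (fun r : Om => B (f (winv (take s (take (s + p) (rot (p + q) (val r))))))
                              (f (drop s (take (s + p) (rot (p + q) (val r)))))).
  rewrite -!expectZ -!expectD; apply: eq_expect => r.
  have [u [v [z [rE up vq zs]]]] := split3 (size_tuple (val r)).
  have [[h1 h2 h3] [h4 h5 h6]] := windows_cat up vq zs.
  rewrite -rE in h1 h2 h3 h4 h5 h6.
  rewrite /edge_form /edges !big_cons big_nil h1 h2 h3 addr0 /=.
  rewrite /window /= in h4 h5 h6; rewrite h4 h5 h6.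
  by rewrite !take_size_cat // !drop_size_cat // addrA.
rewrite /drift -/f !(psd_sqD HB) (psdDl HB) /energy -/f.
rewrite (psdC HB (avg_vec f s) (avg_vec f p)) in e3; lra.
Qed.

Hypothesis triv : forall j t, t \in Bt j -> forall y, pi (val (w t)) y = y.

Lemma batch_form_ge j : (1 - dl) ^+ 2 * energy x <= fdot B g (kact (batch_kernel M N Bt w j) g).
Proof.
have -> : fdot B g (kact (batch_kernel M N Bt w j) g) =
   N%:R^-1 * \sum_(t in Bt j) fdot B g (kact (M (w t)) g).
  rewrite fdot_kact //; under [in RHS]eq_bigr => t _ do rewrite fdot_kact //.
  rewrite [in RHS]exchange_big /= mulr_sumr; apply: eq_bigr => y _.
  rewrite [in RHS]exchange_big /= mulr_sumr; apply: eq_bigr => z _.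
  by rewrite /batch_kernel -mulrA mulr_suml.
have -> : \sum_(t in Bt j) fdot B g (kact (M (w t)) g) =
   \sum_(sb <- windows p q s) \sum_(t in Bt j) sq (window sb (val (w t))).
  rewrite [RHS]exchange_big /=; apply: eq_bigr => t tj.
  rewrite (link_kernel_form vw_inj vw_onto HB f (@edges_ok (w t))).
  by rewrite (edge_form_relator HB Hpi) ?size_tuple //; exact: triv tj.
have hsb sb := @batch_sq_ge j sb.
have := (hsb (0, p)%N, hsb (p, q)%N, hsb (p + q, s)%N).
rewrite /energy -/f /windows !big_cons big_nil !inE !eqxx !orbT /= addr0 !mulrDr.
move=> [[/(_ isT) h1 /(_ isT) h2] /(_ isT) h3].
by rewrite addrA; apply: lerD h3; apply: lerD h1 h2.
Qed.

Variables (phi : R) (k : nat).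
Hypotheses (frobT : forall v : (2 ^ k).-tuple 'I_J, uniq v ->
    frob (kprod (map (centered_batch M N Bt w) v)) <= phi)
  (phi0 : 0 <= phi).
Hypothesis hpar : ((2 ^ k)%N%:R ^+ 2 / J%:R) * ((24 * kp) ^+ 2) ^+ (2 ^ k) + phi
    <= ((dl / Lm) ^+ 2) ^+ (2 ^ k).

(** The unnormalized square norm of [g] is at most [Lm * energy x], so an operator norm of [dl / Lm]
    is the right target for the random part. *)
Lemma fluctuation_le : fdot B g (kact T g) <= dl * energy x.
Proof.
have pin : p \in [:: p; q; s] by rewrite inE eqxx.
have qin : q \in [:: p; q; s] by rewrite !inE eqxx orbT.
have sin : s \in [:: p; q; s] by rewrite !inE eqxx !orbT.
have Lm0 : 0 < Lm by have [h _ _] := nredP pin; apply: lt_le_trans h; apply: nred_gt0.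
have d0 : (0 : R) < dl by rewrite invr_gt0.
have c0 : 0 <= dl / Lm by rewrite divr_ge0 // ltW.
have := kavg_form_bound HB J0 (@centered_sym) (@centered_row) frobT c0 phi0 hpar g.
move/(le_trans (ler_norm _))/le_trans; apply.
have -> : dl * energy x = dl / Lm * (Lm * energy x) by field; rewrite gt_eqF.
apply: ler_wpM2l => //.
have -> : fdot B g g = \sum_z sq (vw z) by apply: eq_bigr => z _; rewrite !ffunE.
have sq0 z : 0 <= sq z by apply: psd_ge0 HB _.
apply: le_trans (sum_V_le vw_inj vwP sq0) _.
have ts b : b \in [:: p; q; s] -> tsum b (fun z => (reduced z)%:R * sq z) <= Lm * avg_sq B f b.
  move=> /nredP[h _ _].
  have -> : tsum b (fun z => (reduced z)%:R * sq z) = nred R n b * avg_sq B f b.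
    by rewrite /avg_sq /avg_real mulVKf // gt_eqF // nred_gt0.
  by rewrite ler_wpM2r // (avg_sq_ge0 n0 HB).
rewrite /energy !mulrDr; apply: lerD (ts _ sin); exact: lerD (ts _ pin) (ts _ qin).
Qed.

Theorem energy_le_drift : energy x <= 2 * B (drift x) (drift x).
Proof.
have h1 := mean_form_le; have h2 := fluctuation_le.
have J0' : (0 : R) < J%:R by rewrite ltr0n.
have h3 : (1 - dl) ^+ 2 * energy x <= fdot B g (kact T g) + fdot B g (kact P g).
  have -> : fdot B g (kact T g) + fdot B g (kact P g) =
    J%:R^-1 * \sum_j fdot B g (kact (batch_kernel M N Bt w j) g).
    rewrite !fdot_kact //; under [in RHS]eq_bigr => t _ do rewrite fdot_kact //.
    rewrite [in RHS]exchange_big /= mulr_sumr -big_split; apply: eq_bigr => y _.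
    rewrite [in RHS]exchange_big /= mulr_sumr -big_split; apply: eq_bigr => z _ /=.
    rewrite -mulrDl -mulr_suml mulrA; congr (_ * _).
    rewrite /T /kavg /centered_batch sumrB sumr_const card_ord mulrBr.
    by rewrite -(mulr_natl (mean_kernel M y z)) mulKf ?gt_eqF // subrK.
  rewrite ler_pdivlMl // mulr_natl -[J in _ *+ J]card_ord -sumr_const.
  by apply: ler_sum => j _; apply: batch_form_ge.
have Q3 : 3 <= Q by rewrite ler_nat; lia.
have Qi : Q^-1 <= 3^-1 by rewrite lef_pV2 ?posrE //; lra.
set Z := B (avg_vec f p) _ + _ + _ in h1.
(* With [Z >= D / 3] and [1 / Q <= 1 / 3] the three estimates give [(0.9604 - 0.06 - 2/3) * S <= D -
   5/3 * Z <= 4/9 * D], hence [S <= 2 * D]. *)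
have hZ : B (drift x) (drift x) <= 3 * Z.
  have amgm a b : 2 * B a b <= B a a + B b b.
    by apply: le_trans (psd_amgm HB a b); rewrite ler_pM2l // ler_norm.
  have := (amgm (avg_vec f p) (avg_vec f q), amgm (avg_vec f p) (avg_vec f s),
           amgm (avg_vec f q) (avg_vec f s)).
  rewrite /drift -/f !(psd_sqD HB) (psdDl HB) /Z => -[[]]; lra.
have S0 : 0 <= energy x by rewrite !addr_ge0 ?(avg_sq_ge0 n0 HB).
have SZ : Z <= energy x.
  by rewrite /Z /energy !lerD // (avg_vec_sq_le n0 HB).
have SZ0 : 0 <= energy x - Z by rewrite subr_ge0.
have := ler_wpM2r SZ0 Qi.
move: h1 h2 h3 hZ S0 SZ; set S := energy x; set D := B (drift x) _.
set F1 := fdot _ _ _; set F2 := fdot _ _ _ => h1 h2 h3 hZ S0 SZ hQ.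
nra.
Qed.

End Vector.
End Good.
End SpectralGap.

(** * From the spectral gap to invariant vectors *)

Section FormNorm.
Variables (R : rcfType) (E : lmodType R) (B : E -> E -> R).
Hypothesis HB : psd_form B.

Definition fnorm x := Num.sqrt (B x x).

Lemma fnorm_ge0 x : 0 <= fnorm x. Proof. exact: sqrtr_ge0. Qed.

Lemma fnorm_sq x : fnorm x ^+ 2 = B x x.
Proof. by rewrite sqr_sqrtr // (psd_ge0 HB). Qed.

Lemma fnorm_le x a : 0 <= a -> (fnorm x <= a) = (B x x <= a ^+ 2).
Proof. by move=> a0; rewrite -fnorm_sq ler_pXn2r // nnegrE fnorm_ge0. Qed.

Lemma fnormD x y : fnorm (x + y) <= fnorm x + fnorm y.
Proof.
rewrite fnorm_le ?addr_ge0 ?fnorm_ge0 // (psd_sqD HB) sqrrD !fnorm_sq lerD2r lerD2l.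
rewrite -[X in _ <= X]mulr_natl ler_pM2l //; apply: le_trans (ler_norm _) _.
rewrite -(@ler_pXn2r _ 2) ?nnegrE ?mulr_ge0 ?fnorm_ge0 //.
by rewrite real_normK ?num_real // exprMn !fnorm_sq psd_CS.
Qed.

Lemma fnormN x : fnorm (- x) = fnorm x.
Proof. by rewrite /fnorm (psdNl HB) (psdNr HB) opprK. Qed.

Lemma fnormBC x y : fnorm (x - y) = fnorm (y - x).
Proof. by rewrite -fnormN opprB. Qed.

Lemma fnorm_tri z x y : fnorm (x - y) <= fnorm (x - z) + fnorm (z - y).
Proof. by rewrite (_ : x - y = (x - z) + (z - y)) ?fnormD // addrA subrK. Qed.

End FormNorm.

Definition definite_form (R : rcfType) (E : lmodType R) (B : E -> E -> R) :=
  forall x, B x x = 0 -> x = 0.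

Definition complete_form (R : rcfType) (E : lmodType R) (B : E -> E -> R) :=
  forall u : nat -> E,
    (forall e, 0 < e -> exists k, forall j, fnorm B (u (k + j)%N - u k) <= e) ->
    exists v, forall e, 0 < e -> exists k, forall j, fnorm B (u (k + j)%N - v) <= e.

(** * Gradient descent for the energy *)

Section Contraction.
Variables (R : realFieldType) (n p q s : nat).
Hypotheses (n0 : (0 < n)%N) (p0 : (0 < p)%N) (q0 : (0 < q)%N) (s0 : (0 < s)%N).
Variables (E : lmodType R) (B : E -> E -> R) (pi : word n -> E -> E).
Hypotheses (HB : psd_form B) (Hpi : word_rep B pi).
Local Notation energy := (energy p q s B pi).
Local Notation drift := (drift p q s pi).
Local Notation disp := (displacement pi).

Let pairing x z b := avg_real (fun w => B (disp x w) (disp z w)) b.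

Lemma avg_real_cst b (a : R) : (0 < b)%N -> avg_real (fun _ : word n => a) b = a.
Proof.
move=> b0; rewrite /avg_real.
have -> : tsum b (fun w : word n => (reduced w)%:R * a) = a * tsum b (fun w : word n => (reduced w)%:R).
  by rewrite -tsumZ; apply: eq_tsum => w _; rewrite mulrC.
by rewrite tsum_reduced // mulrCA mulVf ?mulr1 // gt_eqF // nred_gt0.
Qed.

(** A discrete Green formula: expanding the product and using that the inverse of a uniform reduced
    word is again uniform, both mixed terms equal the same average. *)
Lemma pairingE x z b : (0 < b)%N -> pairing x z b = - 2 * B (avg_vec (disp x) b) z.
Proof.
move=> b0.
pose av (F : word n -> R) := avg_real F b.
have avD F G : av (fun w => F w + G w) = av F + av G.
  rewrite /av /avg_real -mulrDr -tsumD; congr (_ * _); apply: eq_tsum => w _.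
  by rewrite mulrDr.
have e1 : B (avg_vec (disp x) b) z = av (fun w => B (disp x w) z).
  rewrite /avg_vec (psdZl HB) (psd_tsuml HB) /av /avg_real; congr (_ * _).
  by apply: eq_tsum => w _; rewrite (psdZl HB).
have e2 : av (fun w => B (disp x w) z) = av (fun w => B (disp x (winv w)) z).
  rewrite /av /avg_real -tsum_winv; congr (_ * _); apply: eq_tsum => w _.
  by rewrite reduced_winv.
have e3 : pairing x z b = av (fun w => - (B (disp x w) z + B (disp x (winv w)) z)).
  rewrite /pairing /av; congr (_ * _); apply: eq_tsum => w _; congr (_ * _).
  have h : B x (pi w z) = B (pi (winv w) x) z.
    by rewrite -[RHS](wr_iso Hpi w) (wr_invr Hpi).
  rewrite /displacement !(psdDl HB, psdDr HB, psdNl HB, psdNr HB) (wr_iso Hpi) h.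
  ring.
have avN F : av (fun w => - F w) = - av F.
  rewrite /av /avg_real -mulrN; congr (_ * _); rewrite -mulN1r -tsumZ.
  by apply: eq_tsum => w _; ring.
by rewrite e3 avN avD -e2 e1; ring.
Qed.

Lemma avg_sq_lin x z t b :
  avg_sq B (disp (x + t *: z)) b = avg_sq B (disp x) b + 2 * t * pairing x z b
    + t ^+ 2 * avg_sq B (disp z) b.
Proof.
rewrite /avg_sq /pairing /avg_real (mulrCA (2 * t)) (mulrCA (t ^+ 2)) -!mulrDr; congr (_ * _).
rewrite -!tsumZ -!tsumD; apply: eq_tsum => w _.
have -> : disp (x + t *: z) w = disp x w + t *: disp z w.
  rewrite /displacement (wrD Hpi) (wrZ Hpi) scalerBr opprD addrACA.
  by [].
by rewrite (psd_sqD HB) (psd_sqZ HB) (psdZr HB); ring.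
Qed.

Lemma avg_sq_le4 z b : (0 < b)%N -> avg_sq B (disp z) b <= 4 * B z z.
Proof.
move=> b0; rewrite -[X in _ <= X](avg_real_cst _ b0) /avg_sq /avg_real.
rewrite ler_wpM2l ?invr_ge0 ?(ltW (nred_gt0 R n0 b)) //.
apply: le_tsum => w _; apply: ler_wpM2l => //.
rewrite /displacement (psd_sqB HB) (wr_iso Hpi).
have := psd_amgm HB (pi w z) z; rewrite (wr_iso Hpi) => h.
have := ler_norm (- B (pi w z) z); rewrite normrN; lra.
Qed.

Lemma drift_sq_le x : B (drift x) (drift x) <= 3 * energy x.
Proof.
have amgm a b : 2 * B a b <= B a a + B b b.
  by apply: le_trans (psd_amgm HB a b); rewrite ler_pM2l // ler_norm.
have := (avg_vec_sq_le n0 HB (disp x) p0, avg_vec_sq_le n0 HB (disp x) q0, avg_vec_sq_le n0 HB (disp x) s0).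
have := (amgm (avg_vec (disp x) p) (avg_vec (disp x) q),
         amgm (avg_vec (disp x) p) (avg_vec (disp x) s),
         amgm (avg_vec (disp x) q) (avg_vec (disp x) s)).
rewrite /drift /energy !(psd_sqD HB) (psdDl HB) => -[[h1 h2] h3] -[[h4 h5] h6]; lra.
Qed.

(** A descent step: the gradient of the energy at [x] is [-4] times [drift x]. A step of size [t]
    changes the energy by at most [(12 * t ^+ 2 - 4 * t) * B (drift x) (drift x)], which is least at
    [t = 1 / 6]. *)
Definition relax x := x + 6%:R^-1 *: drift x.

Hypothesis gap : forall x, energy x <= 2 * B (drift x) (drift x).

Lemma energy_relax x : energy (relax x) <= 5 / 6 * energy x.
Proof.
have h := gap x; set y := drift x in h *.
have -> : energy (relax x) = energy x - 4 * 6%:R^-1 * B y y + 6%:R^-1 ^+ 2 * energy y.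
  rewrite /energy /relax -/y !avg_sq_lin !pairingE //.
  have -> : B y y = B (avg_vec (disp x) p) y + B (avg_vec (disp x) q) y + B (avg_vec (disp x) s) y.
    by rewrite {1}/y /drift !(psdDl HB).
  ring.
have h2 : energy y <= 12 * B y y.
  have := (avg_sq_le4 y p0, avg_sq_le4 y q0, avg_sq_le4 y s0) => -[[]].
  by rewrite /energy; lra.
lra.
Qed.

Lemma relax_dist x : B (relax x - x) (relax x - x) <= energy x / 12.
Proof.
rewrite /relax addrC addKr (psd_sqZ HB); have := drift_sq_le x; lra.
Qed.

Lemma displacement_le_energy x w : reduced w -> size w \in [:: p; q; s] ->
  B (disp x w) (disp x w) <= nred R n (size w) * energy x.
Proof.
move=> rw sw.
have h := avg_sq_ge0 n0 HB (disp x).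
apply: (@le_trans _ _ (nred R n (size w) * avg_sq B (disp x) (size w))).
  rewrite /avg_sq /avg_real mulVKf ?gt_eqF ?nred_gt0 //.
  rewrite /tsum (bigD1 (in_tuple w)) //= rw mul1r lerDl sumr_ge0 // => z _.
  by rewrite mulr_ge0 ?(psd_ge0 HB).
rewrite ler_pM2l ?nred_gt0 // /energy.
have := (h p, h q, h s) => -[[]].
by move: sw; rewrite !inE => /or3P[]/eqP -> h1 h2 h3; lra.
Qed.

End Contraction.

Section InvariantVector.
Variables (R : realType) (n p q s : nat).
Hypotheses (n2 : (1 < n)%N) (p0 : (0 < p)%N) (q0 : (0 < q)%N) (s0 : (0 < s)%N).
Variables (E : lmodType R) (B : E -> E -> R) (pi : word n -> E -> E).
Hypotheses (HB : psd_form B) (Hpi : word_rep B pi).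
Hypotheses (Bdef : definite_form B) (Bcomp : complete_form B).
Local Notation energy := (energy p q s B pi).
Local Notation drift := (drift p q s pi).
Local Notation disp := (displacement pi).
Hypothesis gap : forall x, energy x <= 2 * B (drift x) (drift x).
Local Notation nrm := (fnorm B).
(** A rational number with [r ^+ 2 >= 5 / 6], the contraction factor of the energy; [25 / 2] below
    is the geometric sum [1 / (1 - r)]. *)
Local Notation r := (23%:R / 25%:R : R).

Let n0 : (0 < n)%N := ltnW n2.

Lemma geometric_small (a e : R) : 0 <= a -> 0 < e -> exists k, forall j, r ^+ (k + j) * a <= e.
Proof.
move=> a0 e0.
have : (fun k => r ^+ k) @ \oo --> (0 : R).
  by apply: cvg_expr; rewrite ger0_norm; lra.
have e1 : 0 < e / (a + 1) by rewrite divr_gt0 // ltr_wpDl.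
move=> /cvgr_dist_lt/(_ _ e1)[k _ hk]; exists k => j.
have := hk (k + j)%N (leq_addr _ _); rewrite /= sub0r normrN ger0_norm; last first.
  by rewrite exprn_ge0 //; lra.
rewrite ltr_pdivlMr ?ltr_wpDl // => /ltW.
have : 0 <= r ^+ (k + j) by rewrite exprn_ge0 //; lra.
by rewrite mulrDr; lra.
Qed.

Lemma fnorm_pi w x : nrm (pi w x) = nrm x.
Proof. by rewrite /fnorm (wr_iso Hpi). Qed.

Section Limit.
Variables (x : E) (sg : R).
Hypotheses (sg0 : 0 <= sg) (hx : energy x <= 12 * sg ^+ 2).
Let u k := iter k (relax p q s pi) x.

Lemma energy_iter k : energy (u k) <= 12 * (r ^+ k * sg) ^+ 2.
Proof.
elim: k => [|k IH]; first by rewrite expr0 mul1r.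
rewrite /u iterS -/(u k).
apply: le_trans (energy_relax n0 p0 q0 s0 HB Hpi gap (u k)) _.
rewrite (exprS r k); have := ler_wpM2l (_ : 0 <= 5 / 6 :> R) IH => h.
apply: le_trans (h _) _; first lra.
have : 0 <= (r ^+ k * sg) ^+ 2 by rewrite sqr_ge0.
have -> : (r * r ^+ k * sg) ^+ 2 = r ^+ 2 * (r ^+ k * sg) ^+ 2 by ring.
lra.
Qed.

Lemma iter_dist k j : nrm (u (k + j)%N - u k) <= r ^+ k * (25%:R / 2 * sg) * (1 - r ^+ j).
Proof.
elim: j => [|j IH].
  by rewrite addn0 subrr expr0 subrr mulr0 /fnorm (psd0l HB) sqrtr0.
apply: le_trans (fnorm_tri HB (u (k + j)%N) _ _) _; rewrite addrC.
have h : nrm (u (k + j.+1)%N - u (k + j)%N) <= r ^+ (k + j) * sg.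
  have rs : 0 <= r ^+ (k + j) * sg by rewrite mulr_ge0 // exprn_ge0 //; lra.
  rewrite fnorm_le // addnS /u iterS -/(u (k + j)).
  apply: le_trans (relax_dist n0 p0 q0 s0 pi HB _) _.
  have := energy_iter (k + j); lra.
apply: le_trans (lerD IH h) _; rewrite exprD exprS; lra.
Qed.

(** The energy of the iterates tends to 0 and controls each single displacement up to the fixed
    factor [nred R n (size w)]. *)
Lemma limit_vector : exists v, nrm (v - x) <= 25%:R / 2 * sg /\
  forall w, reduced w -> size w \in [:: p; q; s] -> pi w v = v.
Proof.
have C0 : 0 <= 25%:R / 2 * sg by rewrite mulr_ge0 //; lra.
have dist k j : nrm (u (k + j)%N - u k) <= r ^+ k * (25%:R / 2 * sg).
  apply: le_trans (iter_dist k j) _; rewrite -[X in _ <= X]mulr1.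
  have rk : 0 <= r ^+ k by rewrite exprn_ge0 //; lra.
  have rj : 0 <= r ^+ j by rewrite exprn_ge0 //; lra.
  by rewrite ler_wpM2l ?mulr_ge0 //; lra.
have [e e0|v hv] := Bcomp (u := u).
  have [k hk] := geometric_small C0 e0; exists k => j.
  by apply: le_trans (dist k j) _; have := hk 0; rewrite addn0.
exists v; split.
  apply/ler_addgt0Pr => e e0; have [k hk] := hv e e0.
  apply: le_trans (fnorm_tri HB (u k) _ _) _; rewrite addrC.
  have := dist 0 k; rewrite expr0 mul1r add0n => h; apply: lerD h _.
  by rewrite fnormBC //; have := hk 0; rewrite addn0.
move=> w rw sw; apply/eqP; rewrite -subr_eq0; apply/eqP/Bdef.
suff : nrm (disp v w) <= 0.
  by rewrite fnorm_le // expr0n => h; apply/eqP; rewrite eq_le h (psd_ge0 HB).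
apply/ler_addgt0Pr => e e0; rewrite add0r.
have e3 : 0 < e / 3 by rewrite divr_gt0.
have [k hk] := hv _ e3.
set K := Num.sqrt (12 * nred R n (size w)) * sg.
have K0 : 0 <= K by rewrite mulr_ge0 ?sqrtr_ge0.
have [k' hk'] := geometric_small K0 e3.
set j := (k + k')%N.
have h1 : nrm (u j - v) <= e / 3 by apply: hk.
have h2 : nrm (disp (u j) w) <= e / 3.
  apply: le_trans (_ : r ^+ j * K <= _); last by rewrite /j addnC.
  have rj : 0 <= r ^+ j by rewrite exprn_ge0 //; lra.
  rewrite fnorm_le ?mulr_ge0 //.
  apply: le_trans (displacement_le_energy n0 pi HB (u j) rw sw) _.
  have W0 := nred_gt0 R n0 (size w).
  have := ler_wpM2l (ltW W0) (energy_iter j).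
  have -> : (r ^+ j * K) ^+ 2 = 12 * nred R n (size w) * (r ^+ j * sg) ^+ 2.
    rewrite /K !exprMn sqr_sqrtr ?mulr_ge0 // ?(ltW W0) //; ring.
  lra.
have -> : disp v w = pi w (v - u j) + disp (u j) w + (u j - v).
  by rewrite /displacement (wrB Hpi) !addrA !subrK.
apply: le_trans (fnormD HB _ _) _.
have := fnormD HB (pi w (v - u j)) (disp (u j) w); rewrite fnorm_pi fnormBC //.
lra.
Qed.

End Limit.

Lemma displacement_word_le x e w : (forall y, nrm (disp x [:: y]) <= e) ->
  nrm (disp x w) <= (size w)%:R * e.
Proof.
move=> he; elim: w => [|y w IH].
  by rewrite mul0r /displacement (wr_nil Hpi) subrr /fnorm (psd0l HB) sqrtr0.
have -> : disp x (y :: w) = pi [:: y] (disp x w) + disp x [:: y].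
  by rewrite /displacement -cat1s (wr_cat Hpi) (wrB Hpi) addrA subrK.
apply: le_trans (fnormD HB _ _) _; rewrite fnorm_pi /= -addn1 natrD mulrDl mul1r.
exact: lerD.
Qed.

Lemma exists_letter (a b : letter n) : exists y, noncancel y a /\ noncancel y b.
Proof.
have : (0 < #|(~: [set linv a; linv b])%SET|)%N.
  have := finset.cardsC [set linv a; linv b]%SET.
  by rewrite cards2 card_prod card_ord card_bool; case: (_ != _); lia.
move=> /card_gt0P[y]; rewrite !inE negb_or => /andP[ya yb]; by exists y.
Qed.

Lemma noncancel_refl (y : letter n) : noncancel y y.
Proof. by case: y => i b; rewrite /noncancel /linv xpair_eqE eqxx /=; case: b. Qed.

(* [z a] and [z b] are both reduced of length [p] for a suitable [z]. *)
Lemma letters_agree v : (forall w, reduced w -> size w = p -> pi w v = v) ->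
  forall a b : letter n, pi [:: a] v = pi [:: b] v.
Proof.
move=> hv a b; have [y [ya yb]] := exists_letter a b.
have red c : noncancel y c -> reduced (rcons (nseq p.-1 y) c).
  move=> yc; rewrite /reduced; case: (p.-1) => [|k] //=.
  rewrite rcons_path; apply/andP; split; last first.
    by elim: k => //= k ->.
  by elim: k => //= k ->; rewrite noncancel_refl.
have h c : noncancel y c -> pi (nseq p.-1 y) (pi [:: c] v) = v.
  move=> yc; rewrite -(wr_cat Hpi) cats1 hv ?red //.
  by rewrite size_rcons size_nseq prednK.
rewrite -[LHS](wr_inv Hpi (nseq p.-1 y)) -[RHS](wr_inv Hpi (nseq p.-1 y)).
by rewrite !h.
Qed.

Theorem invariant_vector x : x != 0 ->
  (forall y, nrm (disp x [:: y]) <= nrm x / (100 * (p + q + s)%:R)) ->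
  exists v, v != 0 /\ forall y, pi [:: y] v = v.
Proof.
move=> x0 hx.
have nx0 : 0 < nrm x.
  rewrite lt_neqAle fnorm_ge0 andbT eq_sym; apply: contraNneq x0 => h.
  by apply/eqP/Bdef; rewrite -(fnorm_sq HB) h expr0n.
set sg := nrm x / 100.
have l1 : (1 : R) <= (p + q + s)%:R by rewrite ler1n; lia.
have sg0 : 0 <= sg by rewrite divr_ge0 // ltW.
have hw b w : b \in [:: p; q; s] -> size w = b -> nrm (disp x w) <= sg.
  move=> bin sw; apply: le_trans (displacement_word_le w hx) _.
  have hb : ((size w)%:R : R) <= (p + q + s)%:R.
    by rewrite ler_nat sw; move: bin; rewrite !inE => /or3P[]/eqP ->; lia.
  have -> : sg = (p + q + s)%:R * (nrm x / (100 * (p + q + s)%:R)).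
    rewrite /sg invfM mulrCA; congr (_ * _); rewrite mulrCA mulfV ?mulr1 //.
    by rewrite gt_eqF // (lt_le_trans ltr01).
  by rewrite ler_wpM2r // divr_ge0 ?(ltW nx0) // mulr_ge0.
have hA b : b \in [:: p; q; s] -> (0 < b)%N -> avg_sq B (disp x) b <= sg ^+ 2.
  move=> bin b0; rewrite -[X in _ <= X](avg_real_cst n0 _ b0) /avg_sq /avg_real.
  rewrite ler_wpM2l ?invr_ge0 ?(ltW (nred_gt0 R n0 b)) //.
  apply: le_tsum => w sw; apply: ler_wpM2l => //.
  by rewrite -fnorm_le //; exact: hw bin sw.
have hE : energy x <= 12 * sg ^+ 2.
  have := (hA p, hA q, hA s); rewrite !inE !eqxx !orbT => -[[/(_ isT p0) h1 /(_ isT q0) h2] /(_ isT s0) h3].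
  by rewrite /energy; have := sqr_ge0 sg; lra.
have [v [dv hv]] := limit_vector sg0 hE.
have agree := @letters_agree v (fun w rw sw => hv w rw (etrans (congr1 (mem [:: p; q; s]) sw) (mem_head _ _))).
pose y0 : letter n := (Ordinal n0, false).
(* The stabilizer of [v] may be the subgroup of index two of words of even
   length, hence the symmetrization. *)
exists (v + pi [:: y0] v); split; last first.
  move=> y; rewrite (wrD Hpi) addrC (agree y y0); congr (_ + _).
  rewrite (agree y0 (linv y)) -(wr_cat Hpi) /=.
  by rewrite -[RHS](wr_invr Hpi [:: y]) -(wr_cat Hpi).
(* [v] is within [25 / 2 * sg], an eighth of the norm of [x], from [x]. If the symmetrized vector
   vanished, [2 *: x] would be a sum of two vectors of that size and one of norm at most [sg]. *)
apply: contraTneq nx0 => v0; rewrite -leNgt.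
have e1 : 2 *: x = (x - v) + pi [:: y0] (x - v) - disp x [:: y0] + (v + pi [:: y0] v).
  rewrite /displacement (wrB Hpi) opprB scaler_nat mulr2n.
  set a := pi _ x; set b := pi _ v.
  rewrite -(addrA (x - v)); have -> : a - b + (x - a) = x - b by rewrite addrC addrA subrK.
  by rewrite (addrACA x) -opprD subrK.
have h2 : nrm (2 *: x) = 2 * nrm x.
  apply/eqP; rewrite -(@eqrXn2 _ 2) ?mulr_ge0 ?fnorm_ge0 // exprMn !fnorm_sq // (psd_sqZ HB).
  by [].
have : nrm (2 *: x) <= nrm (x - v) + nrm (x - v) + nrm (disp x [:: y0]).
  rewrite e1 v0 addr0; apply: le_trans (fnormD HB _ _) _; rewrite fnormN // lerD2r.
  by apply: le_trans (fnormD HB _ _) _; rewrite fnorm_pi.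
have hy0 : nrm (disp x [:: y0]) <= sg.
  apply: le_trans (hx y0) _; rewrite /sg; apply: ler_wpM2l; first exact: fnorm_ge0.
  have L0 : (0 : R) < 100 * (p + q + s)%:R by rewrite mulr_gt0 // (lt_le_trans ltr01).
  by rewrite lef_pV2 ?posrE // ler_peMr.
rewrite h2 (fnormBC HB x v) /sg in dv hy0 *; lra.
Qed.

End InvariantVector.

(** * Hilbert spaces as real form spaces *)

(* Restriction of scalars to [R]: an alias carrying the second module structure. *)
Definition realified (R : rcfType) (H : lmodType R[i]) : Type := H.

Section Realified.
Variables (R : rcfType) (H : lmodType R[i]).

HB.instance Definition _ := GRing.Zmodule.on (realified H).

Definition real_scale (a : R) (v : realified H) : realified H := a%:C *: (v : H).

Fact real_scaleA a b v : real_scale a (real_scale b v) = real_scale (a * b) v.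
Proof. by rewrite /real_scale scalerA rmorphM. Qed.
Fact real_scale1 : left_id 1 real_scale.
Proof. by move=> v; rewrite /real_scale rmorph1 scale1r. Qed.
Fact real_scaleDr : right_distributive real_scale +%R.
Proof. by move=> a u v; rewrite /real_scale scalerDr. Qed.
Fact real_scaleDl v : {morph real_scale^~ v : a b / a + b}.
Proof. by move=> a b; rewrite /real_scale rmorphD scalerDl. Qed.

HB.instance Definition _ := GRing.Zmodule_isLmodule.Build R (realified H)
  real_scaleA real_scale1 real_scaleDr real_scaleDl.

End Realified.

Section Hilbert.
Variables (R : realType) (H : completeNormedModType R[i]) (ip : {dot H for Num.conj}).
Hypothesis Hip : hilbert_product ip.

Definition re_form (u v : realified H) : R := complex.Re (ip (u : H) (v : H)).

Lemma norm_real (v : H) : `|v| = (complex.Re `|v|)%:C.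
Proof. by rewrite complexRe; apply/esym/Creal_ReP; rewrite normr_real. Qed.

Lemma re_form_norm (v : H) : re_form v v = (complex.Re `|v|) ^+ 2.
Proof. by rewrite /re_form Hip norm_real -rmorphXn. Qed.

Lemma re_form_psd : psd_form re_form.
Proof.
split=> [u v|u v w|a u v|v].
- rewrite /re_form (hermC ip) expr0 mul1r.
  by apply: (@complexI R); rewrite !complexRe Re_conj.
- by rewrite /re_form linearDl /= raddfD.
- rewrite /re_form [X in ip X _]/(a%:C *: (u : H)) linearZl_LR /=.
  by case: (ip _ _) => x y /=; rewrite mul0r subr0.
- by rewrite re_form_norm sqr_ge0.
Qed.

Lemma fnorm_re_form (v : H) : `|v| = (fnorm re_form v)%:C.
Proof.
rewrite /fnorm re_form_norm sqrtr_sqr [LHS]norm_real; congr (_%:C).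
by rewrite ger0_norm // -lecR -norm_real rmorph0 normr_ge0.
Qed.

Lemma re_form_definite : definite_form re_form.
Proof.
move=> v; rewrite re_form_norm => /eqP; rewrite sqrf_eq0 => /eqP h.
by apply/eqP; rewrite -normr_eq0 norm_real h.
Qed.

Lemma re_form_complete : complete_form re_form.
Proof.
move=> u hu.
have : cauchy (u @ \oo).
  apply: cauchy_exP => eps eps0.
  have epsE : eps = (complex.Re eps)%:C.
    by rewrite complexRe; apply/esym/Creal_ReP; rewrite gtr0_real.
  have e0 : 0 < complex.Re eps / 2 by rewrite divr_gt0 // -ltcR -epsE.
  have [k hk] := hu _ e0; exists (u k); exists k => // j /= kj.
  rewrite -ball_normE /= distrC fnorm_re_form epsE ltcR.
  have := hk (j - k)%N; rewrite subnKC // => /le_lt_trans; apply.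
  by rewrite ltr_pdivrMr // ltr_pMr ?ltr1n // -ltcR -epsE.
move=> /cauchy_cvg/cvg_ex[v uv]; exists v => e e0.
have e0' : 0 < e%:C by rewrite ltcR.
have /cvgr_distC_lt/(_ _ e0')[k _ hk] := uv; exists k => j.
have := hk (k + j)%N (leq_addr _ _); rewrite /= fnorm_re_form ltcR; exact: ltW.
Qed.

End Hilbert.

Section PresentedRep.
Variables (R : realType) (n : nat) (rels : seq (word n)).
Notation G := (presented rels).
Variables (H : completeNormedModType R[i]) (ip : {dot H for Num.conj}).
Variable (pi : G -> {linear H -> H}).
Hypotheses (Hip : hilbert_product ip) (Hpi : unitary_rep ip pi).

Definition pres_rep (w : word n) (v : realified H) : realified H :=
  pi (pres_class rels w) v.

Lemma pres_classM u v : pres_class rels (u ++ v) = (pres_class rels u * pres_class rels v)%g.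
Proof. by rewrite -pres_mulE. Qed.

Lemma pres_rep_rep : word_rep (re_form ip) pres_rep.
Proof.
have [pi1 piM piI] := Hpi.
split=> [w x y|w a x|x|u v x|w x|w x y].
- exact: raddfD.
- exact: (linearZ_LR (pi (pres_class rels w)) a%:C x).
- exact: pi1.
- by rewrite /pres_rep pres_classM piM.
- rewrite /pres_rep -piM -pres_classM.
  have -> : pres_class rels (winv w ++ w) = 1%g by apply/pres_classP/pres_catVw.
  exact: pi1.
- by rewrite /re_form /pres_rep piI.
Qed.

Lemma pres_rep_relator r : r \in rels -> forall y, pres_rep r y = y.
Proof.
move=> rr y; rewrite /pres_rep.
have -> : pres_class rels r = 1%g by apply/pres_classP/pres_rel.
by have [pi1 _ _] := Hpi; exact: pi1.
Qed.

Lemma letters_invariant v : (forall y, pres_rep [:: y] v = v) -> forall g, pi g v = v.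
Proof.
move=> hv g; rewrite -[g]reprK -/(pres_class _ _).
elim: (repr g) => [|y w IH]; first by have [pi1 _ _] := Hpi; exact: pi1.
rewrite -cat1s pres_classM; have [_ -> _] := Hpi.
by rewrite IH; exact: hv.
Qed.

End PresentedRep.

(** The Kazhdan set is the set of letters, and [eps] is the tolerance of [invariant_vector]; it may
    shrink with the relator length, since property (T) is asked of each group separately. *)
Theorem property_T_of_gap (R : realType) (n p q s : nat) (rels : seq (word n)) :
  (1 < n)%N -> (0 < p)%N -> (0 < q)%N -> (0 < s)%N ->
  (forall (E : lmodType R) (B : E -> E -> R) (pi : word n -> E -> E),
     psd_form B -> word_rep B pi -> (forall r, r \in rels -> forall y, pi r y = y) ->
     forall x, energy p q s B pi x <= 2 * B (drift p q s pi x) (drift p q s pi x)) ->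
  property_T R (presented rels).
Proof.
move=> n2 p0 q0 s0 gap.
set eps : R := (100 * (p + q + s)%:R)^-1.
have eps0 : 0 < eps by rewrite invr_gt0 mulr_gt0 // ltr0n; lia.
exists [seq pres_class rels [:: y] | y <- enum {: letter n}], eps; split=> //.
move=> H ip pi Hip Hpi [v [v0 hv]].
have HB := re_form_psd Hip; have Hr := pres_rep_rep Hpi.
have [|w [w0 hw]] := invariant_vector n2 p0 q0 s0 HB Hr (re_form_definite Hip)
    (re_form_complete Hip) (gap _ _ _ HB Hr (pres_rep_relator Hpi)) v0.
  move=> y; have := hv (pres_class rels [:: y]) (map_f _ (mem_enum _ y)).
  rewrite (fnorm_re_form Hip) (fnorm_re_form Hip v) -rmorphM ltcR /eps mulrC.
  exact: ltW.
exists w; split=> //; exact: letters_invariant Hpi _ hw.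
Qed.

(** * The probability of failure *)

Section Vertices.
Variables (n p q s : nat).

Definition vertex : finType :=
  {x : (p + q + s).-bseq (letter n) |
    reduced (x : word n) && (size (x : word n) \in [:: p; q; s])}.

Definition vertex_word (x : vertex) : word n := bseqval (val x).

Lemma vertex_word_inj : injective vertex_word.
Proof. by move=> x y h; apply/val_inj/val_inj. Qed.

Lemma vertex_wordP x : reduced (vertex_word x) && (size (vertex_word x) \in [:: p; q; s]).
Proof. exact: (valP x). Qed.

Lemma vertex_word_onto w : reduced w -> size w \in [:: p; q; s] -> exists x, vertex_word x = w.
Proof.
move=> rw sw; have wl : (size w <= p + q + s)%N.
  by move: sw; rewrite !inE => /or3P[]/eqP ->; lia.
have h : reduced (Bseq wl : word n) && (size (Bseq wl : word n) \in [:: p; q; s]).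
  by rewrite /= rw.
by exists (exist _ (Bseq wl) h).
Qed.

End Vertices.

Section Batches.
Variables (K J N : nat).
Hypothesis JN : (J * N <= K)%N.

(** Consecutive blocks; indices from [J * N] on lie in no block. *)
Definition batch (j : 'I_J) : {set 'I_K} := [set t : 'I_K | (j * N <= t < j.+1 * N)%N]%SET.

Lemma card_batch j : #|batch j| = N.
Proof.
rewrite -sum1_card.
have h2 : (j.+1 * N <= K)%N by apply: leq_trans JN; rewrite leq_mul2r ltn_ord orbT.
transitivity (\sum_(j * N <= t < j.+1 * N) 1)%N; last first.
  by rewrite sum_nat_const_nat mulSn addnK muln1.
rewrite (big_nat_widen _ _ _ _ _ h2) (big_nat_widenl _ 0) // big_mkord.
by apply: eq_bigl => t; rewrite inE andbC.
Qed.

Lemma batch_disjoint j k t : j != k -> t \in batch j -> t \notin batch k.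
Proof.
rewrite !inE => jk /andP[h1 h2]; apply/negP => /andP[h3 h4].
case/eqP: jk; apply: val_inj => /=.
have a1 : (j < k.+1)%N by rewrite -(ltn_pmul2r (m := N)); [apply: leq_ltn_trans h1 h4|nia].
have a2 : (k < j.+1)%N by rewrite -(ltn_pmul2r (m := N)); [apply: leq_ltn_trans h3 h2|nia].
by apply/eqP; rewrite eqn_leq -ltnS a1 -ltnS a2.
Qed.

End Batches.

Lemma expect_tuple (R : realFieldType) (T : finType) K (F : {ffun 'I_K -> T} -> R) :
  expect (fun t : K.-tuple T => F [ffun i => tnth t i]) = expect F.
Proof.
rewrite /expect card_tuple card_ffun card_ord; congr (_ * _).
rewrite [RHS](reindex (fun t : K.-tuple T => [ffun i => tnth t i])) //=.
exists (fun w : {ffun 'I_K -> T} => [tuple w i | i < K]) => [t _|w _].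
  by apply: eq_from_tnth => i; rewrite tnth_mktuple ffunE.
by apply/ffunP => i; rewrite ffunE tnth_mktuple.
Qed.

Lemma sqr_exprMn (R : comNzRingType) (x y : R) k :
  ((x * y) ^+ 2) ^+ k = x ^+ (2 * k) * (y ^+ 2) ^+ k.
Proof. by rewrite [(x * y) ^+ 2]exprMn [(_ * _) ^+ k]exprMn (exprM x). Qed.

Section FailureProbability.
Variables (R : realType) (n p q s : nat) (d : R).
Hypotheses (n2 : (1 < n)%N) (p0 : (0 < p)%N).
Hypotheses (qp : q \in [:: p; p.+1]) (sp : s \in [:: p; p.+1]).
Local Notation m := ((2 * n)%:R : R).
Local Notation Q := ((2 * n - 1)%:R : R).
Local Notation l := (p + q + s)%N.
Local Notation Om := (cr_word n l).
Local Notation dl := (50%:R^-1 : R).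
Local Notation Lm := (nred R n p.+1).
Local Notation kp := (nred R n p)^-1.
Hypothesis p_large : 200 * m <= Q ^+ p.+1.

Variables k J : nat.
Local Notation K0 := (2 ^ k)%N.
(** Since [24 * kp = 1200 * Q * (dl / Lm)], this keeps the contribution of words with a repetition
    below half of [((dl / Lm) ^+ 2) ^+ K0]; the other half is [phi]. The condition does not involve
    [l]. *)
Hypotheses (J0 : (0 < J)%N) (J_large : 2 * K0%:R ^+ 2 * (1200 * Q) ^+ (2 * K0) <= J%:R).
Local Notation K := (num_relators n l d).
Definition batch_size : nat := (K %/ J)%N.
Local Notation N := batch_size.
Hypothesis N0 : (0 < N)%N.

Let n0 : (0 < n)%N := ltnW n2.
Let q0 : (0 < q)%N. Proof. by move: qp; rewrite !inE => /orP[]/eqP ->. Qed.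
Let s0 : (0 < s)%N. Proof. by move: sp; rewrite !inE => /orP[]/eqP ->. Qed.
Let JN : (J * N <= K)%N. Proof. by rewrite mulnC leq_trunc_div. Qed.
Let Bt := @batch K J N.
Let Q0 : 0 < Q := Q_gt0 R n0.
Let Q1 : 1 <= Q := Q_ge1 R n0.
Let m0 : 0 < m := m_gt0 R n0.
Let Lm0 : 0 < Lm := nred_gt0 R n0 p.+1.

Let LmE : Lm = Q * nred R n p.
Proof. by rewrite /nred /= -{1}(prednK p0) exprS; ring. Qed.

Let kpE : kp = Q / Lm.
Proof. by rewrite LmE -[RHS]invf_div (mulrC Q) mulfK ?gt_eqF. Qed.

Let nredP b : b \in [:: p; q; s] ->
  [/\ nred R n b <= Lm, (nred R n b)^-1 <= kp & 4 * m <= dl * Q ^+ b.+1].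
Proof.
move=> hb; have {hb} : b \in [:: p; p.+1].
  by move: hb; rewrite 2!in_cons mem_seq1 => /or3P[/eqP->|/eqP->|/eqP->] //; rewrite inE eqxx.
have W0 := nred_gt0 R n0 p.
have pl : nred R n p <= Lm by rewrite LmE ler_peMl // ltW.
have hp : 4 * m <= dl * Q ^+ p.+1 by rewrite ler_pdivlMl //; move: p_large; lra.
rewrite !inE => /orP[]/eqP ->; split=> //.
  by rewrite lef_pV2 ?posrE.
apply: le_trans hp _; rewrite ler_wpM2l ?invr_ge0 //.
by rewrite ler_weXn2l.
Qed.

Let M (r : Om) := link_kernel R p q s (@vertex_word n p q s) (val r).
Let V := vertex n p q s.

Lemma card_vertex_le : #|V|%:R <= 3 * Lm.
Proof.
have -> : #|V|%:R = \sum_(x : V) 1 :> R by rewrite sumr_const.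
apply: le_trans (sum_V_le (@vertex_word_inj n p q s) (@vertex_wordP n p q s) (F := fun=> 1) _) _ => //.
have h b : (0 < b)%N -> tsum b (fun w : word n => (reduced w)%:R * 1) = nred R n b.
  by move=> b0; rewrite -(tsum_reduced R n0 b0); apply: eq_tsum => w _; rewrite mulr1.
rewrite !h //.
have [|h1 _ _] := @nredP p; first by rewrite inE eqxx.
have [|h2 _ _] := @nredP q; first by rewrite !inE eqxx orbT.
have [|h3 _ _] := @nredP s; first by rewrite !inE eqxx !orbT.
lra.
Qed.

Let Om0 : (0 < #|Om|)%N.
Proof.
have sin : s \in [:: p; q; s] by rewrite !inE eqxx !orbT.
have [_ _ hs] := nredP sin.
have dl1 : 0 < dl <= 1 by apply/andP; split; lra.
have x0 : letter n := (Ordinal n0, false).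
have pq0 : (0 < p + q)%N by rewrite addn_gt0 p0.
have [_] := window_weight n0 (erefl l) pq0 dl1 hs x0 x0.
by rewrite ltr0n.
Qed.

Let phi : R := ((dl / Lm) ^+ 2) ^+ K0 / 2.

Let good (w : {ffun 'I_K -> Om}) : Prop :=
  concentrated R (@vertex_word n p q s) N Bt w /\
  forall v : K0.-tuple 'I_J, uniq v -> frob (kprod (map (centered_batch M N Bt w) v)) <= phi.

Lemma good_property_T (t : K.-tuple Om) : good [ffun i => tnth t i] ->
  property_T R (gromov_group t).
Proof.
move=> [conc frb]; apply: property_T_of_gap n2 p0 q0 s0 _ => E B pi HB Hpi triv x.
have hpar : (K0%:R ^+ 2 / J%:R) * ((24 * kp) ^+ 2) ^+ K0 + phi <= ((dl / Lm) ^+ 2) ^+ K0.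
  rewrite kpE.
  have -> : 24 * (Q / Lm) = (1200 * Q) * (dl / Lm) by field; rewrite gt_eqF.
  have -> : ((1200 * Q * (dl / Lm)) ^+ 2) ^+ K0 = (1200 * Q) ^+ (2 * K0) * ((dl / Lm) ^+ 2) ^+ K0.
    exact: sqr_exprMn.
  have e : K0%:R ^+ 2 / J%:R * (1200 * Q) ^+ (2 * K0) <= 2^-1.
    rewrite mulrAC ler_pdivrMr ?ltr0n //; move: J_large.
    by move: (_ ^+ (2 * K0)) (K0%:R ^+ 2) => a b; lra.
  have Y0 : 0 <= ((dl / Lm) ^+ 2) ^+ K0 by rewrite exprn_ge0 // sqr_ge0.
  rewrite mulrA /phi; have := ler_wpM2r Y0 e.
  by move: (_ * (1200 * Q) ^+ _) (_ ^+ K0) => a b; lra.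
have phi0 : 0 <= phi by rewrite /phi divr_ge0 // exprn_ge0 // sqr_ge0.
have tr : forall j i, i \in Bt j -> forall y, pi (val ([ffun i => tnth t i] i : Om)) y = y.
  move=> j i ij y; apply: triv; rewrite ffunE; apply/mapP; exists (tnth t i) => //.
  exact: mem_tnth.
have H := @energy_le_drift R n p q s n2 p0 q0 s0 V (@vertex_word n p q s)
  (@vertex_word_inj n p q s) (@vertex_wordP n p q s)
  (@vertex_word_onto n p q s) Lm kp nredP 'I_K J N Bt J0 N0 _ conc E B pi HB Hpi x.
have H2 := H tr phi k.
have H3 := H2 frb.
have H4 := H3 phi0.
exact: (H4 hpar).
Qed.

Let dev (i : 'I_3 * 'I_J * V) (w : {ffun 'I_K -> Om}) : bool :=
  let sb := nth (0, 0)%N (windows p q s) i.1.1 in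
  let pr := N%:R * window_prob R p q s sb (vertex_word i.2) in
  dl * pr < `|\sum_(t in Bt i.1.2) (window sb (val (w t)) == vertex_word i.2)%:R - pr|.

Lemma window_prob_ge sb (z : V) : sb \in windows p q s -> size (vertex_word z) = sb.2 ->
  (2 * Lm)^-1 <= window_prob R p q s sb (vertex_word z).
Proof.
move=> sbw sz; have [sb2 _] := windowsP n2 p0 q0 s0 nredP sbw.
have [hL _ _] := nredP sb2.
have W0 := nred_gt0 R n0 sb.2.
have := window_avg n2 p0 q0 s0 nredP (fun w => (w == vertex_word z)%:R) sbw.
rewrite ler_norml => /andP[+ _].
have -> : avg_real (fun w => `|(w == vertex_word z)%:R|) sb.2 =
          avg_real (fun w => (w == vertex_word z)%:R : R) sb.2.
  by congr (_ * _); apply: eq_tsum => w _; rewrite normr_nat.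
have -> : avg_real (fun w => (w == vertex_word z)%:R : R) sb.2 = (nred R n sb.2)^-1.
  rewrite /avg_real (_ : tsum _ _ = 1) ?mulr1 //.
  have sz' : size (vertex_word z) == sb.2 by apply/eqP.
  have /andP[rz _] := vertex_wordP z.
  rewrite /tsum (bigD1 (Tuple sz')) //= eqxx rz mulr1 big1 ?addr0 // => t tz.
  by rewrite -val_eqE /= in tz; rewrite (negPf tz) mulr0.
have hi : Lm^-1 <= (nred R n sb.2)^-1 by rewrite lef_pV2 ?posrE.
rewrite /window_prob /prob [(2 * Lm)^-1]invfM; set P := expect _.
have Li0 : 0 < Lm^-1 by rewrite invr_gt0.
lra.
Qed.

(* [200 * 200 = 8 / dl ^+ 2 * 2], from the exponent in Chernoff's bound. *)
Lemma dev_prob i : prob R (dev i) <= 2 * (200 * 200 * K0%:R * (Lm / N%:R)) ^+ K0.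
Proof.
case: i => -[i j] z; rewrite /dev /=; set sb := nth _ _ _.
have sbw : sb \in windows p q s by rewrite mem_nth //; case: i @sb.
have K00 : (0 < K0)%N by rewrite expn_gt0.
have Kr0 : (0 : R) < K0%:R by rewrite ltr0n.
have N0' : (0 : R) < N%:R by rewrite ltr0n.
have LN0 : 0 <= Lm / N%:R by apply: divr_ge0; exact: ltW.
have c0 : 0 <= 200 * 200 * K0%:R * (Lm / N%:R).
  apply: mulr_ge0 LN0; move: Kr0; move: (K0%:R : R) => a; lra.
have rhs0 : 0 <= 2 * (200 * 200 * K0%:R * (Lm / N%:R)) ^+ K0.
  by apply: mulr_ge0 (exprn_ge0 _ c0); lra.
(* For a vertex of another length than the window, the count and its mean both vanish and the strict
   inequality in [dev] fails. *)
have [sz|/eqP sz] := eqVneq (size (vertex_word z)) sb.2; last first.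
  have [_ [c [lE b0 _]]] := windowsP n2 p0 q0 s0 nredP sbw.
  have no (r : Om) : (window sb (val r) == vertex_word z) = false.
    apply/negbTE/eqP => h; apply: sz; rewrite -h /window size_takel //.
    by rewrite size_rot size_tuple lE leq_addr.
  rewrite (_ : prob R _ = 0) // /prob (eq_expect (G := fun=> 0)) ?/expect ?big1_eq ?mulr0 //.
  move=> w; rewrite /window_prob /prob (eq_expect (T := Om) (G := fun=> 0)); last by move=> r; rewrite no.
  rewrite {1 2}/expect !big1_eq !mulr0 subr0 big1 ?normr0 ?ltxx // => t _.
  by rewrite no.
have hp := window_prob_ge sbw sz.
have L20 : 0 < (2 * Lm)^-1 by rewrite invr_gt0 mulr_gt0.
set pz := window_prob R p q s sb (vertex_word z) in hp *.
have pz0 : 0 < pz by apply: lt_le_trans hp.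
have dl1 : 0 < dl <= 1 by apply/andP; split; lra.
have := @chernoff_deviation R 'I_K Om (fun r => window sb (val r) == vertex_word z) (Bt j) Om0 dl dl1.
rewrite (card_batch JN) -/pz => /(_ (mulr_gt0 N0' pz0)) /le_trans; apply.
rewrite ler_pM2l //.
have t0 : 0 < dl ^+ 2 * (N%:R * pz) / 8.
  apply: divr_gt0 => //; apply: mulr_gt0 (mulr_gt0 N0' pz0).
  by rewrite exprn_gt0 // invr_gt0.
apply: le_trans (expRN_le t0 K00) _.
apply: lerXn2r; rewrite ?nnegrE //; first by apply: divr_ge0; exact: ltW.
rewrite ler_pdivrMr //.
have h1 : N%:R * (2 * Lm)^-1 <= N%:R * pz by rewrite ler_pM2l.
have h2 := ler_wpM2l c0 h1.
have e1 : 200 * 200 * K0%:R * (Lm / N%:R) * (N%:R * (2 * Lm)^-1) = 100 * 200 * K0%:R.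
  by move: Lm0 N0'; move: Lm (N%:R : R) => a b a0 b0; field; rewrite !gt_eqF.
rewrite e1 in h2; lra.
Qed.

(* [600 * 300 = 6 * 12 / dl ^+ 2]. *)
Lemma frob_prob (v : K0.-tuple 'I_J) :
  prob R (fun w => uniq v && (phi < frob (kprod (map (centered_batch M N Bt w) v)))) <=
   6 * Lm * (600 * 300 * Q * (Lm / N%:R)) ^+ K0.
Proof.
have N0' : (0 : R) < N%:R by rewrite ltr0n.
have rhs0 : 0 <= 6 * Lm * (600 * 300 * Q * (Lm / N%:R)) ^+ K0.
  have LN0 : 0 <= Lm / N%:R by apply: divr_ge0; exact: ltW.
  have q6 : 0 <= 600 * 300 * Q by move: Q0; lra.
  by apply: mulr_ge0 (exprn_ge0 _ (mulr_ge0 q6 LN0)); move: Lm0; lra.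
case: (boolP (uniq v)) => uv; last by rewrite /prob /expect big1_eq mulr0.
have dL0 : 0 < dl / Lm by rewrite divr_gt0.
have phi0 : 0 < phi by rewrite /phi divr_gt0 // exprn_gt0 // exprn_gt0.
apply: le_trans (markov_ineq _ phi0) _ => [w|]; first exact: frob_ge0.
have kp0 : 0 < kp by rewrite invr_gt0 nred_gt0.
have := @expect_frob_prod R 'I_K Om V M 6 (12 * kp) Om0
  (fun r => link_kernel_ge0 R p q s (@vertex_word n p q s) (val r))
  (fun r => link_kernel_row6 R p q s (@vertex_word_inj n p q s) (val r))
  (mean_row n2 p0 q0 s0 (@vertex_word_inj n p q s) nredP) J N Bt N0 (card_batch JN)
  (batch_disjoint JN) v uv.
rewrite size_tuple => h.
have D0 : 0 <= 6 * (12 * kp) by rewrite !mulr_ge0 // ltW.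
have {h} := h D0.
have A0 : 0 <= (6 * (12 * kp) / N%:R) ^+ K0 by rewrite exprn_ge0 // divr_ge0.
move=> /le_trans/(_ (ler_wpM2l A0 card_vertex_le)) h.
rewrite ler_pdivrMr //; apply: le_trans h _.
rewrite le_eqVlt; apply/orP; left; apply/eqP.
rewrite kpE.
have -> : 6 * (12 * (Q / Lm)) / N%:R = (600 * 300 * Q * (Lm / N%:R)) * (dl / Lm) ^+ 2.
  by move: Lm0 N0'; move: Lm (N%:R : R) => a b a0 b0; field; rewrite !gt_eqF.
by rewrite /phi exprMn; move: (_ ^+ K0) (_ ^+ K0) => a b; field.
Qed.

(** Union bound over [3 * J * #|V|] deviations, with [#|V| <= 3 * Lm] and probability factor 2,
    whence 18, and over the [J ^ K0] words in the batches. *)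
Theorem failure_prob_le :
  1 - gromov_prob n l d (property_T R) <=
  (18 * J%:R * (200 * 200 * K0%:R) ^+ K0 + 6 * J%:R ^+ K0 * (600 * 300 * Q) ^+ K0)
    * (Lm * (Lm / N%:R) ^+ K0).
Proof.
have T0 : (0 < #|{: K.-tuple Om}|)%N by rewrite card_tuple expn_gt0 Om0.
pose P (t : K.-tuple Om) := `[< property_T R (gromov_group t) >].
have -> : 1 - gromov_prob n l d (property_T R) = prob R (fun t : K.-tuple Om => ~~ P t).
  rewrite /gromov_prob /prob.
  rewrite (eq_expect (G := fun t => 1 - (P t)%:R)); last first.
    by move=> t; case: (P t); rewrite ?subr0 ?subrr.
  rewrite expectB (expect_cst T0); congr (_ - _).
  rewrite -/(prob R P) probE; congr (_%:R / _%:R).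
  by rewrite cardsE.
pose Qf v (w : {ffun 'I_K -> Om}) :=
  uniq v && (phi < frob (kprod (map (centered_batch M N Bt w) v))).
pose conb (w : {ffun 'I_K -> Om}) := ~~ [exists i, dev i w].
have step1 : prob R (fun t : K.-tuple Om => ~~ P t) <=
   prob R (fun t : K.-tuple Om => ~~ conb [ffun i => tnth t i]) +
   \sum_(v : K0.-tuple 'I_J) prob R (fun t : K.-tuple Om => Qf v [ffun i => tnth t i]).
  apply: prob_union => t Pt.
  case: (boolP (conb [ffun i => tnth t i])) => [cb|]; last by left.
  right; apply: contrapT => nex; move/negP: Pt; apply; apply/asboolP.
  apply: good_property_T; split; last first.
    move=> v uv; rewrite leNgt; apply/negP => hv; apply: nex; exists v.
    by rewrite /Qf uv.
  move=> sb sbw j z; rewrite leNgt; apply/negP => hd.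
  move: cb => /existsP; apply.
  have isb : (index sb (windows p q s) < 3)%N by rewrite -index_mem in sbw.
  exists (Ordinal isb, j, z); rewrite /dev /= nth_index //.
have et (Pr : pred {ffun 'I_K -> Om}) :
    prob R (fun t : K.-tuple Om => Pr [ffun i => tnth t i]) = prob R Pr.
  by rewrite /prob (expect_tuple (fun w => (Pr w)%:R)).
apply: le_trans step1 _; rewrite (et (fun w => ~~ conb w)).
have X0 : 0 <= (Lm / N%:R) ^+ K0 by rewrite exprn_ge0 // divr_ge0 // ltW.
have h1 : prob R (fun w => ~~ conb w) <=
   18 * J%:R * (200 * 200 * K0%:R) ^+ K0 * (Lm * (Lm / N%:R) ^+ K0).
  apply: (@le_trans _ _ (prob R (fun=> false) + \sum_i prob R (dev i))).
    by apply: prob_union => w; rewrite negbK => /existsP[i di]; right; exists i.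
  rewrite {1}/prob /expect big1_eq mulr0 add0r.
  apply: le_trans (ler_sum _ (fun i _ => dev_prob i)) _.
  rewrite sumr_const -(mulr_natl (2 * _)) !card_prod !card_ord !natrM exprMn.
  set Y := (200 * 200 * _) ^+ _; have Y0 : 0 <= Y by rewrite exprn_ge0 // mulr_ge0.
  have c0 : 0 <= 3 * J%:R * (2 * (Y * (Lm / N%:R) ^+ K0)) by rewrite !mulr_ge0.
  have := ler_wpM2l c0 card_vertex_le; lra.
have h2 : \sum_(v : K0.-tuple 'I_J) prob R (fun t : K.-tuple Om => Qf v [ffun i => tnth t i]) <=
   6 * J%:R ^+ K0 * (600 * 300 * Q) ^+ K0 * (Lm * (Lm / N%:R) ^+ K0).
  have -> : 6 * J%:R ^+ K0 * (600 * 300 * Q) ^+ K0 * (Lm * (Lm / N%:R) ^+ K0) =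
    \sum_(v : K0.-tuple 'I_J) 6 * Lm * (600 * 300 * Q * (Lm / N%:R)) ^+ K0.
    rewrite sumr_const card_tuple card_ord -(mulr_natl (_ * _)) natrX (exprMn _ (600 * 300 * Q)).
    ring.
  by apply: ler_sum => v _; rewrite (et (Qf v)); exact: frob_prob.
by rewrite mulrDl; apply: lerD.
Qed.

End FailureProbability.

(** * The limit *)

Lemma letter1P (y z : letter 1) : z = y \/ z = linv y.
Proof.
case: y z => [i b] [j c]; rewrite /linv /= (ord1 i) (ord1 j).
by case: b c => [] []; [left|right|right|left].
Qed.

Lemma noncancel1_eq (y z : letter 1) : noncancel y z -> z = y.
Proof.
rewrite /noncancel; case: (letter1P y z) => [//|->].
by rewrite linvK eqxx.
Qed.

Lemma cyclically_reduced1 l (w : word 1) : size w = l -> (0 < l)%N -> cyclically_reduced w ->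
  exists y, w = nseq l y.
Proof.
case: w => [|y w] <- // _; rewrite /cyclically_reduced /= rcons_path => /andP[h _].
exists y; congr (_ :: _); elim: w h => //= z w IH /andP[/noncancel1_eq zy].
by rewrite zy => /IH {1}->.
Qed.

(** The sum of the vectors [y^i v] for [i < l] is fixed because [y^l = 1]. The choice
    [eps = 1 / (2 * l)] keeps it within [l / 2] times the norm of [v] from [l *: v], so it is not
    zero. *)
Lemma property_T_rank1 (R : realType) l (y : letter 1) (rels : seq (word 1)) :
  (0 < l)%N -> nseq l y \in rels -> property_T R (presented rels).
Proof.
move=> l0 hr.
have l0' : (0 : R) < l%:R by rewrite ltr0n.
set eps : R := (2 * l%:R)^-1.
have eps0 : 0 < eps by rewrite invr_gt0 mulr_gt0.
exists [:: pres_class rels [:: y]], eps; split=> //.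
move=> H ip pi Hip Hpi [v [v0 hv]].
have HB := re_form_psd Hip; have Hr := pres_rep_rep Hpi.
set B := re_form ip in HB Hr; set rho := pres_rep pi in Hr.
pose nrm := fnorm B.
have nv0 : 0 < nrm v.
  rewrite lt_neqAle fnorm_ge0 andbT eq_sym; apply: contraNneq v0 => h.
  have h2 : B v v = 0 by rewrite -(fnorm_sq HB) -/(nrm v) h expr0n.
  by apply/eqP/(re_form_definite Hip).
have hy : nrm (rho [:: y] v - v) <= eps * nrm v.
  have := hv (pres_class rels [:: y]) (mem_head _ _).
  rewrite (fnorm_re_form Hip) (fnorm_re_form Hip v) -rmorphM ltcR; exact: ltW.
have ri z : fnorm B (rho [:: y] z) = fnorm B z by rewrite /fnorm (wr_iso Hr).
have hi i : nrm (rho (nseq i y) v - v) <= i%:R * (eps * nrm v).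
  elim: i => [|i IH].
    by rewrite mul0r (wr_nil Hr) subrr /nrm /fnorm (psd0l HB) sqrtr0.
  have -> : rho (nseq i.+1 y) v - v = rho [:: y] (rho (nseq i y) v - v) + (rho [:: y] v - v).
    by rewrite (wrB Hr) -(wr_cat Hr) addrA subrK.
  apply: le_trans (fnormD HB _ _) _; rewrite ri -natr1 mulrDl mul1r.
  exact: lerD IH hy.
pose w : realified H := \sum_(i < l) rho (nseq i y) v.
have wy : rho [:: y] w = w.
  have rho_sum (F : 'I_l -> realified H) : rho [:: y] (\sum_i F i) = \sum_i rho [:: y] (F i).
    exact: raddf_sum.
  rewrite /w rho_sum; under eq_bigr => i _ do rewrite -(wr_cat Hr) cat1s -/(nseq i.+1 y).
  case: l l0 hr {l0' eps eps0 hv hy hi w rho_sum} => // l _ hr.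
  rewrite big_ord_recr big_ord_recl /= (wr_nil Hr) addrC; congr (_ + _).
  exact: (pres_rep_relator Hpi hr).
have wz z : rho [:: z] w = w.
  case: (letter1P y z) => -> //.
  by rewrite -{1}wy -(wr_cat Hr) -[RHS](wr_inv Hr [:: y]) -(wr_cat Hr).
exists w; split; last exact: letters_invariant Hpi _ wz.
have dw : nrm (w - l%:R *: (v : realified H)) <= l%:R * (l%:R * (eps * nrm v)).
  have -> : w - l%:R *: (v : realified H) = \sum_(i < l) (rho (nseq i y) v - v).
    by rewrite sumrB sumr_const card_ord scaler_nat.
  have gen (I : finType) (F : I -> realified H) : nrm (\sum_i F i) <= \sum_i nrm (F i).
    elim/big_rec2: _ => [|i a b _ IH]; first by rewrite /nrm /fnorm (psd0l HB) sqrtr0.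
    by apply: le_trans (fnormD HB _ _) _; rewrite lerD2l.
  apply: le_trans (gen _ _) _.
  apply: (@le_trans _ _ (\sum_(i < l) l%:R * (eps * nrm v))).
    apply: ler_sum => i _; apply: le_trans (hi i) _.
    by rewrite ler_wpM2r ?mulr_ge0 ?fnorm_ge0 ?(ltW eps0) // ler_nat ltnW.
  by rewrite sumr_const card_ord -(mulr_natl (l%:R * _)).
apply: contraTneq nv0 => w0; rewrite -leNgt.
move: dw; rewrite w0 sub0r /nrm (fnormN HB).
have -> : fnorm B (l%:R *: (v : realified H)) = l%:R * fnorm B v.
  apply/eqP; rewrite -(@eqrXn2 _ 2) ?mulr_ge0 ?fnorm_ge0 // exprMn !(fnorm_sq HB) (psd_sqZ HB).
  by [].
rewrite ler_pM2l // /eps mulrA.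
have -> : l%:R / (2 * l%:R) = 2^-1 :> R.
  by move: l0'; move: (l%:R : R) => a a0; field; rewrite gt_eqF.
lra.
Qed.

(** Here [2 * n - 1 = 1], so there is exactly one relator whatever [d] is, and it is the [l]-th
    power of a letter. *)
Lemma gromov_prob_rank1 (R : realType) (d : R) l : (0 < l)%N ->
  gromov_prob 1 l d (property_T R) = 1.
Proof.
move=> l0.
have K1 : num_relators 1 l d = 1%N by rewrite /num_relators muln1 powR1 truncn1.
have all_T (t : relators 1 l d) : property_T R (gromov_group t).
  have i0 : 'I_(num_relators 1 l d) by rewrite K1; exact: ord0.
  have [y wy] := cyclically_reduced1 (size_tuple (val (tnth t i0))) l0 (valP (tnth t i0)).
  apply: (@property_T_rank1 R l y) => //; rewrite -wy.
  by apply/mapP; exists (tnth t i0) => //; exact: mem_tnth.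
rewrite /gromov_prob.
have -> : [set t : relators 1 l d | `[< property_T R (gromov_group t) >]]%SET = [set: relators 1 l d]%SET.
  by apply/setP => t; rewrite !inE; apply/asboolP/all_T.
rewrite cardsT divff // pnatr_eq0 -lt0n card_tuple expn_gt0; apply/orP; left.
apply/card_gt0P.
have y : letter 1 := (ord0, false).
have h : cyclically_reduced (nseq_tuple l y).
  rewrite /cyclically_reduced /=; case: (l) => //= k; rewrite rcons_path.
  have hp j : path (@noncancel 1) y (nseq j y) by elim: j => //= j ->; rewrite noncancel_refl.
  apply/andP; split; first exact: hp.
  have -> : last y (nseq k y) = y by elim: k.
  exact: noncancel_refl.
by exists (exist _ (nseq_tuple l y) h).
Qed.

Lemma gromov_prob_le1 (R : realType) n l (d : R) P : gromov_prob n l d P <= 1.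
Proof.
rewrite /gromov_prob; have [->|h] := eqVneq (#|{: relators n l d}|%:R : R) 0.
  by rewrite invr0 mulr0.
by rewrite ler_pdivrMr ?mul1r ?ler_nat ?max_card // lt_neqAle eq_sym h ler0n.
Qed.

(** * At least two generators: choice of the constants *)

Section Limit.
Variables (R : realType) (d : R) (n : nat).
Hypotheses (d3 : 1 / 3 < d) (n2 : (1 < n)%N).
Local Notation m := ((2 * n)%:R : R).
Local Notation Q := ((2 * n - 1)%:R : R).

Let n0 : (0 < n)%N := ltnW n2.
Let Q0 : 0 < Q := Q_gt0 R n0.
Let Q1 : 1 <= Q := Q_ge1 R n0.
Let m0 : 0 < m := m_gt0 R n0.

Lemma failure_geometric : exists C : R, \forall l \near \oo,
  1 - gromov_prob n l d (property_T R) <= C * Q^-1 ^+ l.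
Proof.
(* The excess 4/3 is 1/3, to absorb the factor [Lm] of size about [Q ^ (l / 3)], plus 1, to leave
   [Q ^ (- l)]. *)
have [k hk] : exists k, 4 / 3 <= (2 ^ k)%N%:R * (d - 1 / 3).
  have dd : 0 < d - 1 / 3 by rewrite subr_gt0.
  exists (Num.truncn (4 / 3 / (d - 1 / 3))).+1; rewrite -ler_pdivrMr //.
  apply: le_trans (ltW (truncnS_gt _)) _.
  by rewrite ler_nat ltnW // ltn_expl.
set K0 := (2 ^ k)%N in hk.
have [J J_large J0] : exists2 J : nat, 2 * K0%:R ^+ 2 * (1200 * Q) ^+ (2 * K0) <= J%:R & (0 < J)%N.
  by eexists; first exact: ltW (truncnS_gt _).
have [T hT] : exists T : nat, 200 * m + 2 * J%:R <= T%:R.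
  by eexists; exact: ltW (truncnS_gt _).
pose A : R := 18 * J%:R * (200 * 200 * K0%:R) ^+ K0 + 6 * J%:R ^+ K0 * (600 * 300 * Q) ^+ K0.
exists (A * (m * (2 * J%:R * m) ^+ K0)); exists (3 * T.+1)%N => // l /= Tl.
(* These three floors add up to [l], and the last two are [p] or [p + 1]. *)
pose p := (l %/ 3)%N; pose q := ((l + 1) %/ 3)%N; pose s := ((l + 2) %/ 3)%N.
have pT : (T.+1 <= p)%N by rewrite /p leq_divRL // mulnC.
have lE : (p + q + s)%N = l by rewrite /p /q /s; clear; lia.
have p0 : (0 < p)%N by apply: leq_trans pT.
have qp : q \in [:: p; p.+1].
  by rewrite !inE; apply/orP; rewrite /q /p; clear; lia.
have sp : s \in [:: p; p.+1].
  by rewrite !inE; apply/orP; rewrite /s /p; clear; lia.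
have J0' : (0 : R) < J%:R by rewrite ltr0n.
have Qp : 200 * m + 2 * J%:R <= Q ^+ p.
  apply: le_trans hT _; apply: (@le_trans _ _ p%:R); first by rewrite ler_nat ltnW.
  rewrite -natrX ler_nat ltnW // ltn_expl //; clear -n2; lia.
have p_large : 200 * m <= Q ^+ p.+1.
  apply: (@le_trans _ _ (Q ^+ p)); last by rewrite ler_weXn2l.
  by apply: le_trans Qp; rewrite lerDl mulr_ge0 // ltW.
pose X : R := Q `^ (l%:R * d).
pose z : R := Q `^ (l%:R / 3).
have z0 : 0 < z by rewrite powR_gt0.
have X0 : 0 < X by rewrite powR_gt0.
have Qpz : Q ^+ p <= z.
  rewrite -powR_mulrn ?(ltW Q0) //; apply: ler_powR => //.
  by rewrite ler_pdivlMr // -natrM ler_nat leq_trunc_div.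
have zX : z <= X.
  by apply: ler_powR => //; apply: ler_wpM2l => //; move: d3; lra.
have XJ : 2 * J%:R <= X.
  apply: le_trans zX; apply: le_trans Qpz; apply: le_trans Qp.
  by rewrite lerDr mulr_ge0 // ltW.
pose N := batch_size n p q s d J.
(* The two roundings, in [num_relators] and in the division by [J], lose together at most [J], which
   [XJ] bounds by [X / 2]. *)
have hN : X / 2 <= N%:R * J%:R.
  have : X < (N%:R + 1) * J%:R.
    apply: lt_le_trans (truncnS_gt _) _.
    rewrite -[1]/(1%:R) -natrD -natrM ler_nat addn1 /N /batch_size /num_relators.
    by rewrite lE ltn_ceil.
  by rewrite mulrDl mul1r; lra.
have N0 : (0 < N)%N.
  rewrite -(ltr0n R) -(pmulr_lgt0 _ J0'); apply: lt_le_trans hN.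
  by rewrite divr_gt0.
have N0' : (0 : R) < N%:R by rewrite ltr0n.
have := failure_prob_le n2 p0 qp sp p_large J0 J_large N0.
rewrite lE -/A => /le_trans; apply; rewrite -(mulrA A).
have A0 : 0 <= A.
  apply: addr_ge0; apply: mulr_ge0.
  - by move: J0'; lra.
  - apply: exprn_ge0; have : 0 <= K0%:R :> R by []. 
    by move: (K0%:R : R) => a; lra.
  - by apply: mulr_ge0 => //; apply: exprn_ge0; exact: ltW.
  - by apply: exprn_ge0; move: Q0; lra.
apply: ler_wpM2l => //.
have Lmz : nred R n p.+1 <= m * z by rewrite /nred /= ler_pM2l.
have Lm0 := nred_gt0 R n0 p.+1.
have LN : nred R n p.+1 / N%:R <= 2 * J%:R * m * (z / X).
  rewrite ler_pdivrMr //.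
  apply: le_trans Lmz _.
  have regroup (a b c x e : R) : 0 < x -> 2 * b * a * (c / x) * e = a * c * (e * b / (x / 2)).
    by move=> x0; field; rewrite gt_eqF.
  rewrite regroup //.
  rewrite ler_peMr ?mulr_ge0 ?(ltW m0) ?(ltW z0) //.
  by rewrite ler_pdivlMr ?divr_gt0 // mul1r.
have LN0 : 0 <= nred R n p.+1 / N%:R by apply: divr_ge0; exact: ltW.
have hpow := lerXn2r K0 LN0 (le_trans LN0 LN) LN.
have zK : z * (z / X) ^+ K0 <= Q^-1 ^+ l.
  have -> : z / X = Q `^ (l%:R / 3 - l%:R * d).
    by rewrite powRD ?powRN //; apply/implyP => _; rewrite gt_eqF.
  rewrite -powR_mulrn ?powR_ge0 // -powRrM -powRD; last by apply/implyP => _; rewrite gt_eqF.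
  rewrite exprVn -powR_mulrn ?(ltW Q0) // -powRN; apply: ler_powR => //.
  have := ler_wpM2l (ler0n R l) hk; move: (K0%:R : R) (l%:R : R) => a b; lra.
apply: (@le_trans _ _ (m * z * (2 * J%:R * m * (z / X)) ^+ K0)).
  by apply: ler_pM => //; [exact: ltW | exact: exprn_ge0].
rewrite (exprMn _ (2 * J%:R * m)).
have c0 : 0 <= m * (2 * J%:R * m) ^+ K0.
  by apply: mulr_ge0 (ltW m0) (exprn_ge0 _ _); apply: mulr_ge0 (ltW m0); move: J0'; lra.
have := ler_wpM2l c0 zK; move: (_ ^+ K0) (_ ^+ K0) => a b; lra.
Qed.

Lemma gromov_property_T_cvg : gromov_prob n l d (property_T R) @[l --> \oo] --> (1 : R).
Proof.
have [C hC] := failure_geometric.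
have Q3 : 1 < Q by rewrite ltr1n; move: n2; clear; lia.
have lim0 : 1 - C * Q^-1 ^+ l @[l --> \oo] --> (1 : R).
  rewrite -[X in _ --> X]subr0 -[X in 1 - X](mulr0 C).
  apply: cvgB; first exact: cvg_cst.
  apply: cvgM; first exact: cvg_cst.
  by apply: cvg_expr; rewrite ger0_norm ?invr_ge0 ?(ltW Q0) // invf_lt1.
have lim1 : cst (1 : R) l @[l --> \oo] --> (1 : R) by exact: cvg_cst.
apply: squeeze_cvgr lim0 lim1.
near=> l; rewrite gromov_prob_le1 andbT.
have : 1 - gromov_prob n l d (property_T R) <= C * Q^-1 ^+ l by near: l.
lra.
Unshelve. all: by end_near.
Qed.

End Limit.

Theorem theorem1p2 (R : realType) (d : R) (n : nat)
    (hd : 0 < d < 1) (hd3 : 1 / 3 < d) (hn : (1 <= n)%N) :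
  gromov_prob n l d (property_T R) @[l --> \oo] --> (1 : R).
Proof.
case: n hn => [//|[|n]] _; last exact: gromov_property_T_cvg.
by apply: cvg_near_cst; exists 1%N => // l /= l0; exact: gromov_prob_rank1.
Qed.
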